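(* Let $b\ge 2$ be an integer and let $W$ be a random weight, i.e. a non-constant random variable with $W\ge 0$ and $\mathbb{E}[W]=1$. Let $\nu$ be a Borel probability measure on $[0,1]$ with $\dim_F(\nu)>0$. Assume that $\mathbb{E}[W^{1+\delta}]<\infty$ for some $\delta>0$ and that $$\frac{\mathbb{E}[W\log W]}{\log b}<\lim_{p\to1^+}\underline{\dim}_p(\nu).$$ Then the random measure $Q\nu$ is non-degenerate (that is, $\mathbb{P}(Q\nu\neq0)>0$), and almost surely on $\{Q\nu\neq0\}$ we have $\dim_F(Q\nu)>0$.
   Context: Convention: $0\log0=0$. Let $\mathcal{A}=\{0,1,\dots,b-1\}$ and $\mathcal{A}^*=\bigsqcup_{n\ge0}\mathcal{A}^n$ (finite words, $\mathcal{A}^0=\{\emptyset\}$); $|u|$ is the length of $u$, $u_k$ its $k$-th letter, $u|_j$ its prefix of length $j$. For $|u|=n$ let $I_u=[\sum_{k=1}^n u_kb^{-k},\ \sum_{k=1}^n u_kb^{-k}+b^{-n})$. Let $(W(u))_{u\in\mathcal{A}^*\setminus\{\emptyset\}}$ be i.i.d. copies of $W$ and $W(\emptyset)=1$. Define random measures $Q_n\nu(dt)=\sum_{|u|=n}\big(\prod_{j=0}^nW(u|_j)\big)\mathbf{1}_{I_u}(t)\,\nu(dt)$. Almost surely $Q_n\nu$ converges weakly to a random measure, denoted $Q\nu$. For $p>1$ the $L^p$-dimension of $\nu$ is $\underline{\dim}_p(\nu)=\liminf_{n\to\infty}\dfrac{-\log\big(\sum_{|u|=n}\nu(I_u)^p\big)}{n(p-1)\log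 b}$. The function $p\mapsto\underline{\dim}_p(\nu)$ is non-increasing on $(1,\infty)$, so the limit as $p\to1^+$ exists. For a finite nonzero Borel measure $\mu$ on $[0,1]$, $\widehat{\mu}(\zeta)=\int e^{-2\pi i\zeta x}d\mu(x)$ and $\dim_F(\mu)=\sup\{D\in[0,1]: |\widehat{\mu}(\zeta)|^2=O(|\zeta|^{-D})\text{ as }|\zeta|\to\infty\}$. *)

(* Defs.v *)
From HB Require Import structures.
From mathcomp Require Import all_boot all_order all_algebra.
From mathcomp Require Import all_classical all_reals all_analysis.
From mathcomp Require Import complex.

Set Implicit Arguments.
Unset Strict Implicit.
Unset Printing Implicit Defensive.
Import Order.TTheory GRing.Theory Num.Theory.
Import numFieldNormedType.Exports.
Local Open Scope classical_set_scope.
Local Open Scope ring_scope.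

Definition mutually_independent (R : realType) (d : measure_display)
    (T : measurableType d) (P : probability T R) (I : eqType) (D : set I)
    (X : I -> {RV P >-> R}) : Prop :=
  forall (s : seq I) (B : I -> set (measurableTypeR R)),
    uniq s -> (forall i, i \in s -> D i) -> (forall i, measurable (B i)) ->
    P (\bigcap_(i in [set` s]) (X i @^-1` B i)) =
    (\prod_(i <- s) P (X i @^-1` B i))%E.

Definition bpoint (R : realType) (b n : nat) (u : n.-tuple 'I_b) : R :=
  \sum_(k < n) (tnth u k)%:R / b%:R ^+ k.+1.

Definition bitv (R : realType) (b n : nat) (u : n.-tuple 'I_b)
    : set (measurableTypeR R) :=
  `[bpoint R u, bpoint R u + (b%:R ^+ n)^-1[%classic.

Arguments bitv R {b n} u.

(* The extended logarithm [lne] satisfies [lne 0 = -oo]. The value at n = 0,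
   where the denominator vanishes, does not affect the limit inferior. *)
Definition Lp_dim (R : realType) (b : nat)
    (nu : {measure set (measurableTypeR R) -> \bar R}) (p : R) : \bar R :=
  limn_einf (fun n : nat =>
    (- lne (\sum_(u : n.-tuple 'I_b) nu (bitv R u) `^ p)%E *
       ((n%:R * (p - 1) * ln b%:R)^-1)%:E)%E).

(* exp(- 2 pi i zeta x) = cos(2 pi zeta x) - i sin(2 pi zeta x) *)
Definition fourier (R : realType)
    (mu : {measure set (measurableTypeR R) -> \bar R}) (zeta : R) : R[i] :=
  Complex (\int[mu]_x cos (2 * pi * zeta * x))
          (- \int[mu]_x sin (2 * pi * zeta * x)).

Definition sqnorm_fourier (R : realType)
    (mu : {measure set (measurableTypeR R) -> \bar R}) (zeta : R) : R :=
  ComplexField.Normc.normc (fourier mu zeta) ^+ 2.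

Definition fourier_dim (R : realType)
    (mu : {measure set (measurableTypeR R) -> \bar R}) : R :=
  sup [set D : R | 0 <= D <= 1 /\
    exists C M : R, forall zeta : R, M <= `|zeta| ->
      sqnorm_fourier mu zeta <= C * `|zeta| `^ (- D)].

(* Weak convergence to a finite measure. When every [m n] is carried by the
   closed set [0, 1], so is the limit, and testing against bounded continuous
   functions on R is the same as testing against continuous functions on
   [0, 1]. *)
Definition weak_cvg (R : realType) (m : nat -> set (measurableTypeR R) -> \bar R)
    (mu : {measure set (measurableTypeR R) -> \bar R}) : Prop :=
  (mu setT < +oo)%E /\
  forall f : R -> R, continuous f -> bounded_fun f ->
    (\int[m n]_x (f x)%:E)%E @[n --> \oo] --> (\int[mu]_x (f x)%:E)%E.

Definition cascade_density (R : realType) (b : nat) (Omega : Type)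
    (W : seq 'I_b -> Omega -> R) (n : nat) (w : Omega) (t : R) : R :=
  \sum_(u : n.-tuple 'I_b)
    (\prod_(0 <= j < n.+1) W (take j u) w) * \1_(bitv R u) t.

(* [Q_n nu] at the sample point [w]. It is a set function, which is a measure
   at every [w] where the weights are nonnegative, i.e. almost surely. *)
Definition cascade (R : realType) (b : nat) (Omega : Type)
    (W : seq 'I_b -> Omega -> R)
    (nu : {measure set (measurableTypeR R) -> \bar R}) (n : nat) (w : Omega)
    : set (measurableTypeR R) -> \bar R :=
  fun A => (\int[nu]_(t in A) (cascade_density W n w t)%:E)%E.

Definition random_weight (R : realType) (d : measure_display)
    (T : measurableType d) (P : probability T R) (W : {RV P >-> R}) : Prop :=
  [/\ {ae P, forall x, 0 <= W x},
      ~ (exists c : R, {ae P, forall x, W x = c}) &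
      ('E_P[W] = 1)%E].

Definition iid_weights (R : realType) (d d0 : measure_display)
    (Omega : measurableType d) (P : probability Omega R)
    (Omega0 : measurableType d0) (P0 : probability Omega0 R)
    (b : nat) (W0 : {RV P0 >-> R}) (W : seq 'I_b -> {RV P >-> R}) : Prop :=
  [/\ forall w, W [::] w = 1,
      forall u, u != [::] -> forall A : set (measurableTypeR R), measurable A ->
        distribution P (W u) A = distribution P0 W0 A &
      mutually_independent [set u | u != [::]] W].

(* [Q] is a version of the random measure [Q nu]: a random measure which is
   almost surely the weak limit of [Q_n nu]. This determines it up to a null
   event. *)
Definition cascade_limit (R : realType) (d : measure_display)
    (Omega : measurableType d) (P : probability Omega R) (b : nat)
    (W : seq 'I_b -> {RV P >-> R})
    (nu : {measure set (measurableTypeR R) -> \bar R})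
    (Q : R.-ker Omega ~> measurableTypeR R) : Prop :=
  {ae P, forall w,
    weak_cvg (fun n => cascade (fun u => W u : Omega -> R) nu n w) (Q w)}.

(* Main.v *)
Require Import Defs.
From HB Require Import structures.
From mathcomp Require Import all_boot all_order all_algebra.
From mathcomp Require Import all_classical all_reals all_analysis.
From mathcomp Require Import zify ring lra.
From mathcomp Require Import complex measurable_realfun.

(* Let p in (1, 2] be close to 1 and let q be a large even integer. Put
   N(x) = (sum_i wt_i x_i^q)^(p/q), the p-th power of a weighted l^q norm.
   Since l^q is smooth, N(x + y) <= N(x) + <N'(x), y> + C N(y). The integrals
   of cos(z t + al) against Q_n nu, with z running over sqrt(j+1) and al over
   {0, -pi/2}, form a vector-valued martingale whose increments are indexed
   by the words v, so that summing this inequality over the words gives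
     E N(Z_n - Z_0) <= C sum_v E[W^p]^(|v|-1) N(a_v),
   where a_v is the vector of the same integrals of nu over I_v. Its entries
   are at most nu(I_v), and they decay like a power of z uniformly in v,
   because indicator functions of intervals are well approximated by
   functions in the Wiener algebra while positivity of dim_F(nu) bounds the
   mass of short intervals. Interpolating between the two bounds gives
   N(a_v) <= C nu(I_v)^(p(1-th)) for small th. As E[W^p] is 1 + (p-1)E[W log W]
   up to O((p-1)^2), the assumption on the L^p-dimension makes the sum over v
   converge for suitable p and th. Applied to total masses the estimate
   yields uniform integrability, hence non-degeneracy. Applied to the
   frequencies sqrt(j+1) with weights j+1 it shows, by Fatou's lemma, that
   almost surely the transform of Q nu decays polynomially along them; their
   gaps being at most 1/z, and the transform being Lipschitz, it decays
   polynomially everywhere. *)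

Set Implicit Arguments.
Unset Strict Implicit.
Unset Printing Implicit Defensive.
Import Order.TTheory GRing.Theory Num.Theory.
Import numFieldNormedType.Exports.
Local Open Scope classical_set_scope.
Local Open Scope ring_scope.

(** Second moments of W may be infinite: only exponents p slightly above 1 are available, while
    infinitely many frequencies have to be controlled at once. The two exponents separate these
    difficulties. Raised to a power p in (1, 2], a weighted l^q norm with q >= 2 obeys a one-step
    inequality whose constant depends on q alone, not on the number of coordinates. The supremum
    norm has no such inequality, but a finite q still controls each coordinate through its weight.
    The price is a summation over frequencies: a power decay with a tiny exponent, made smaller by
    interpolation, becomes summable once raised to a large power q. Hence the order of choices: p
    from the gap in the entropy condition, then th from what remains of it in [m * beta < 1], then q
    from th and the decay exponent of [nu]. Estimates are proved for finitely many frequencies with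
    bounds uniform in their number, and the limit is taken along a diagonal, with n frequencies at
    level n. Weights are nonnegative only almost surely, so moments are computed from positive
    parts. *)

Section weighted_norm.
Context {R : realType}.

(** * Smoothness of the p-th power of a weighted l^q norm *)

Lemma exprn_even_norm (z : R) n : ~~ odd n -> z ^+ n = `|z| ^+ n.
Proof. by move=> en; rewrite -normrX ger0_norm// exprn_even_ge0. Qed.

(** Young's inequality for the exponents 1/r and 1/(1-r), with second factor 1. *)
Lemma powR_bernoulli (r z : R) : 0 < r <= 1 -> 0 <= z -> z `^ r <= r * z + (1 - r).
Proof.
move=> /andP[r0]; rewrite le_eqVlt => /predU1P[->|r1] z0.
  by rewrite powRr1// mul1r subrr addr0.
have r10 : 0 < 1 - r by rewrite subr_gt0.
have := @conjugate_powR _ (z `^ r) 1 r^-1 (1 - r)^-1 (powR_ge0 _ _) ler01.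
rewrite !invr_gt0 !invrK powR1 -powRrM mulfV ?gt_eqF//.
move: (powRr1 z0) => ->; rewrite mulr1 mul1r mulrC; apply => //; lra.
Qed.

Lemma powR_concave_tangent (r X h : R) : 0 < r <= 1 -> 0 < X -> 0 <= X + h ->
  (X + h) `^ r <= X `^ r + r * X `^ (r - 1) * h.
Proof.
move=> r01 X0 Xh.
have -> : X + h = X * (1 + h / X) by field; rewrite gt_eqF.
have z0 : 0 <= 1 + h / X.
  by rewrite -(pmulr_rge0 _ X0) mulrDr mulr1 mulrCA mulfV ?mulr1 ?gt_eqF.
rewrite powRM //; last exact: ltW.
rewrite powRB ?(gt_eqF X0) ?implybT// (powRr1 (ltW X0)).
have := powR_bernoulli r01 z0.
have := powR_gt0 r X0; set P := _ `^ _ => P0 H.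
have -> : P + r * (P / X) * h = P * (r * (1 + h / X) + (1 - r)) by field; rewrite gt_eqF.
by rewrite ler_pM2l.
Qed.

(** If |y| <= |x|, the factors of y beyond the second are replaced by x; otherwise every x is
    replaced by y. *)
Lemma norm_mono_le (x y : R) (k i : nat) : (1 < i)%N -> (i <= k.+2)%N ->
  `|x| ^+ (k.+2 - i) * `|y| ^+ i <= `|x| ^+ k * `|y| ^+ 2 + `|y| ^+ k.+2.
Proof.
move=> i1 ik; have [yx|/ltW xy] := leP `|y| `|x|.
  rewrite -[leLHS]addr0 lerD ?exprn_ge0//.
  rewrite -(subnKC i1) exprD mulrCA [leRHS]mulrC ler_wpM2l ?exprn_ge0//.
  apply: (@le_trans _ _ (`|x| ^+ (k.+2 - (2 + (i - 2))) * `|x| ^+ (i - 2))).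
    by rewrite ler_wpM2l ?exprn_ge0// lerXn2r ?nnegrE.
  by rewrite -exprD (_ : (k.+2 - (2 + (i - 2)) + (i - 2) = k)%N)//; lia.
rewrite -[leLHS]add0r; apply: lerD; first by apply: mulr_ge0; exact: exprn_ge0.
apply: (@le_trans _ _ (`|y| ^+ (k.+2 - i) * `|y| ^+ i)).
  by rewrite ler_wpM2r ?exprn_ge0// lerXn2r ?nnegrE.
by rewrite -exprD subnK.
Qed.

(** The binomial terms of degree 0 and 1 in y are kept exactly, because the linear one must later
    average to zero. Each other monomial is at most the bracket by [norm_mono_le], and the binomial
    coefficients sum to [2 ^+ k.+2]. *)
Lemma exprD_taylor_le (x y : R) (k : nat) : ~~ odd k ->
  (x + y) ^+ k.+2 <= x ^+ k.+2 + k.+2%:R * x ^+ k.+1 * y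
    + 2 ^+ k.+2 * (x ^+ k * y ^+ 2 + y ^+ k.+2).
Proof.
move=> ek; rewrite exprDn 2!big_ord_recl /= !subn0 subn1 /= expr0 mulr1 expr1 bin0 bin1.
rewrite mulr1n addrA -[(x ^+ k.+1 * y) *+ _]mulr_natl mulrA lerD2l.
have exE (z : R) : z ^+ k = `|z| ^+ k by rewrite exprn_even_norm.
have exE2 (z : R) : z ^+ k.+2 = `|z| ^+ k.+2.
  by rewrite exprn_even_norm//= negbK.
set B := _ * y ^+ 2 + _.
have -> : (2 : R) ^+ k.+2 * B = \sum_(i < k.+3) B *+ 'C(k.+2, i).
  have := exprDn (1:R) 1 k.+2; rewrite -[1 + 1]/2%:R => ->.
  by rewrite mulr_suml; apply: eq_bigr => i _; rewrite !expr1n mulr1 mulr_natl.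
have B0 : 0 <= B.
  rewrite /B exE exE2; apply: addr_ge0; last exact: exprn_ge0.
  by apply: mulr_ge0; [exact: exprn_ge0|exact: sqr_ge0].
rewrite [leRHS]big_ord_recl [X in _ + X]big_ord_recl addrA -[leLHS]add0r lerD//.
  by rewrite addr_ge0// mulrn_wge0.
apply: ler_sum => i _; rewrite lerMn2r; apply/orP; right.
apply: le_trans (ler_norm _) _; rewrite normrM !normrX.
have := @norm_mono_le x y k (lift ord0 (lift ord0 i)).
rewrite /B exE exE2 -[y ^+ 2]ger0_norm ?sqr_ge0// normrX; apply => //.
by rewrite /= /bump /=; have := ltn_ord i; lia.
Qed.

Lemma exprD_norm_le (x y : R) (q : nat) : ~~ odd q ->
  (x + y) ^+ q <= 2 ^+ q * (x ^+ q + y ^+ q).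
Proof.
move=> eq.
have exE (z : R) : z ^+ q = `|z| ^+ q by rewrite exprn_even_norm.
rewrite (exE (x + y)) (exE x) (exE y); have [yx|/ltW xy] := leP `|y| `|x|.
  apply: (@le_trans _ _ ((2 * `|x|) ^+ q)).
    by rewrite lerXn2r ?nnegrE ?mulr_ge0//; have := ler_normD x y; lra.
  by rewrite exprMn ler_wpM2l ?exprn_ge0// lerDl exprn_ge0.
apply: (@le_trans _ _ ((2 * `|y|) ^+ q)).
  by rewrite lerXn2r ?nnegrE ?mulr_ge0//; have := ler_normD x y; lra.
by rewrite exprMn ler_wpM2l ?exprn_ge0// lerDr exprn_ge0.
Qed.

Variables (I : finType) (wt : I -> R) (k : nat) (p : R).
Hypotheses (wt0 : forall i, 0 <= wt i) (ek : ~~ odd k) (p12 : 1 < p <= 2).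
Let q := k.+2.

(* [wder] is the gradient of [wnorm]; where [wsum] vanishes so does [wder],
   because [powR] is total. *)
Definition wsum (x : I -> R) : R := \sum_i wt i * x i ^+ q.
Definition wnorm (x : I -> R) : R := wsum x `^ (p / q%:R).
Definition wder (x : I -> R) (i : I) : R :=
  p * wsum x `^ (p / q%:R - 1) * (wt i * x i ^+ k.+1).

Let exq_ge0 (z : R) : 0 <= z ^+ q.
Proof. by rewrite exprn_even_ge0//= negbK. Qed.

Lemma wsum_ge0 x : 0 <= wsum x.
Proof. by apply: sumr_ge0 => i _; rewrite mulr_ge0. Qed.

Let wsum_eq0 x : wsum x = 0 -> forall i, wt i = 0 \/ x i = 0.
Proof.
move=> /eqP; rewrite psumr_eq0 => [/allP h i|i _]; last by rewrite mulr_ge0.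
have := h i (mem_index_enum _); rewrite mulf_eq0 expf_eq0 => /orP[/eqP|/andP[_ /eqP]]; tauto.
Qed.

(** Hoelder's inequality in additive form, with a free scale [s]. At the [s] chosen in [wnorm_step]
    the two terms on the right are equal. *)
Let scaled_bound1 (x y : I -> R) s : 0 < s ->
  \sum_i wt i * (`|x i| ^+ k.+1 * `|y i|) <= s * wsum x + s^-1 ^+ k.+1 * wsum y.
Proof.
move=> s0; rewrite /wsum !mulr_sumr -big_split ler_sum//= => i _.
rewrite [s * _]mulrCA [_^-1 ^+ _ * _]mulrCA -mulrDr ler_wpM2l//.
have exE2 (z : R) : z ^+ q = `|z| ^+ q by rewrite -normrX ger0_norm ?exq_ge0.
rewrite (exE2 (x i)) (exE2 (y i)).
have [a0 b0] : 0 <= `|x i| /\ 0 <= `|y i| by [].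
move: a0 b0; move: `|x i| `|y i| => a b a0 b0.
have -> : s^-1 ^+ k.+1 * b ^+ q = s * (b / s) ^+ q.
  by rewrite exprMn [s^-1 ^+ q]exprSr [RHS]mulrCA [s * (_ * s^-1)]mulrCA mulfV ?gt_eqF// mulr1 mulrC.
rewrite -mulrDr (_ : a ^+ k.+1 * b = s * (a ^+ k.+1 * (b / s))); last first.
  by field; rewrite gt_eqF.
rewrite ler_pM2l//; have c0 : 0 <= b / s by rewrite divr_ge0// ltW.
have [ca|/ltW ac] := leP (b / s) a.
  by rewrite -[leLHS]addr0 lerD ?exprn_ge0// /q [leRHS]exprSr ler_wpM2l ?exprn_ge0.
rewrite -[leLHS]add0r lerD ?exprn_ge0// /q [leRHS]exprSr ler_wpM2r//.
by rewrite lerXn2r ?nnegrE.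
Qed.

Let scaled_bound2 (x y : I -> R) s : 0 < s ->
  \sum_i wt i * (x i ^+ k * y i ^+ 2) <= s ^+ 2 * wsum x + s^-1 ^+ k * wsum y.
Proof.
move=> s0; rewrite /wsum !mulr_sumr -big_split ler_sum//= => i _.
rewrite [s ^+ 2 * _]mulrCA [_^-1 ^+ _ * _]mulrCA -mulrDr ler_wpM2l//.
have exE2 (z : R) : z ^+ q = `|z| ^+ q by rewrite -normrX ger0_norm ?exq_ge0.
rewrite (exE2 (x i)) (exE2 (y i)) -[_ * y i ^+ 2]ger0_norm; last first.
  by apply: mulr_ge0; rewrite ?sqr_ge0 ?exprn_even_ge0.
rewrite normrM !normrX.
have [a0 b0] : 0 <= `|x i| /\ 0 <= `|y i| by [].
move: a0 b0; move: `|x i| `|y i| => a b a0 b0.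
have -> : s^-1 ^+ k * b ^+ q = s ^+ 2 * (b / s) ^+ q.
  rewrite exprMn [s^-1 ^+ q](_ : _ = s^-1 ^+ 2 * s^-1 ^+ k); last by rewrite -exprD.
  by rewrite [RHS]mulrCA [s ^+ 2 * _]mulrA -exprMn mulfV ?gt_eqF// expr1n mul1r mulrC.
rewrite -mulrDr (_ : a ^+ k * b ^+ 2 = s ^+ 2 * (a ^+ k * (b / s) ^+ 2)); last first.
  by field; rewrite gt_eqF.
rewrite ler_pM2l ?exprn_gt0//; have c0 : 0 <= b / s by rewrite divr_ge0// ltW.
have [ca|/ltW ac] := leP (b / s) a.
  rewrite -[leLHS]addr0 lerD ?exprn_ge0// /q -(addn2 k) exprD.
  by rewrite ler_wpM2l ?exprn_ge0// lerXn2r ?nnegrE.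
rewrite -[leLHS]add0r lerD ?exprn_ge0// /q -(addn2 k) exprD.
by rewrite ler_wpM2r ?exprn_ge0// lerXn2r ?nnegrE.
Qed.

Let r := p / q%:R.

Let r01 : 0 < r <= 1.
Proof.
have q2 : (2 : R) <= q%:R by rewrite ler_nat.
have [p1 p2] := andP p12; rewrite /r divr_gt0 ?ltr0n// ?ler_pdivrMr ?ltr0n//; lra.
Qed.

(** With s the ratio of the l^q norms of y and x, N(y) = s^p N(x). For s <= 1 the linear term is
    exact and the remainder is of order s^2 N(x), at most s^p N(x) because p <= 2. For s > 1 every
    term, including the linear one of order s N(x), is at most a multiple of N(y) because p > 1. The
    second bound serves to make the linear term integrable. *)
Lemma wnorm_step (x y : I -> R) :
  wnorm (x \+ y) <= wnorm x + \sum_i wder x i * y i + 2 ^+ q.+3 * wnorm y /\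
  `|\sum_i wder x i * y i| <= 4 * (wnorm x + wnorm y).
Proof.
have [r0 r1] := andP r01; have [p1 p2] := andP p12.
rewrite /wnorm -/r; set X := wsum x; set Y := wsum y.
have C1 : 1 <= 2 ^+ q.+3 :> R by rewrite exprn_ege1//; lra.
have [X0|X0] := eqVneq X 0.
  have xw := wsum_eq0 X0.
  rewrite big1 ?normr0 => [|i _]; last first.
    rewrite /wder; have [->|->] := xw i; first by rewrite !mul0r mulr0 mul0r.
    by rewrite expr0n /= !mulr0 mul0r.
  have -> : wsum (x \+ y) = Y.
    apply: eq_bigr => i _ /=; have [->|->] := xw i; first by rewrite !mul0r.
    by rewrite add0r.
  rewrite X0 powR0 ?gt_eqF// !add0r mulr_ge0 ?powR_ge0//; split => //.
  by rewrite ler_peMl ?powR_ge0.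
have {X0} X0 : 0 < X by rewrite lt_neqAle eq_sym X0 wsum_ge0.
have [Y0|Y0] := eqVneq Y 0.
  have yw := wsum_eq0 Y0.
  rewrite big1 ?normr0 => [|i _]; last first.
    rewrite /wder; have [->|->] := yw i; first by rewrite mul0r mulr0 mul0r.
    by rewrite mulr0.
  have -> : wsum (x \+ y) = X.
    apply: eq_bigr => i _ /=; have [->|->] := yw i; first by rewrite !mul0r.
    by rewrite addr0.
  by rewrite Y0 powR0 ?gt_eqF// mulr0 !addr0 lexx mulr_ge0 ?powR_ge0.
have {Y0} Y0 : 0 < Y by rewrite lt_neqAle eq_sym Y0 wsum_ge0.
set s := (Y / X) `^ q%:R^-1.
have YX0 : 0 < Y / X by rewrite divr_gt0.
have s0 : 0 < s by rewrite powR_gt0.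
have sq : s ^+ q = Y / X.
  by rewrite -powR_mulrn ?ltW// -powRrM mulVf ?powRr1 ?ltW// pnatr_eq0.
have sqX : Y = s ^+ q * X by rewrite sq mulfVK ?gt_eqF.
have spX : s `^ p * X `^ r = Y `^ r.
  by rewrite /s -powRrM mulrC [q%:R^-1 * p]mulrC -powRM ?ltW// mulrC mulfVK ?gt_eqF.
have sk1 : s^-1 ^+ k.+1 * s ^+ q = s.
  by rewrite /q [s ^+ _]exprSr mulrA -exprMn mulVf ?gt_eqF// expr1n mul1r.
have sk2 : s^-1 ^+ k * s ^+ q = s ^+ 2.
  by rewrite /q -(addn2 k) exprD mulrA -exprMn mulVf ?gt_eqF// expr1n mul1r.
set D := \sum_i _.
have XrX : X `^ (r - 1) * X = X `^ r by rewrite mulrC mulr_powRB1 ?ltW.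
have DE : D = p * X `^ (r - 1) * \sum_i wt i * (x i ^+ k.+1 * y i).
  by rewrite mulr_sumr; apply: eq_bigr => i _; rewrite /wder -/X -/r !mulrA.
have Dle : `|D| <= 4 * (s * X `^ r).
  rewrite DE normrM ger0_norm ?mulr_ge0 ?powR_ge0//; last lra.
  apply: (@le_trans _ _ (p * X `^ (r - 1) * (2 * s * X))).
    rewrite ler_wpM2l ?mulr_ge0 ?powR_ge0//; first lra.
    apply: (@le_trans _ _ (\sum_i wt i * (`|x i| ^+ k.+1 * `|y i|))).
      apply: le_trans (ler_norm_sum _ _ _) _; apply: ler_sum => i _.
      by rewrite !normrM normrX ger0_norm.
    apply: le_trans (scaled_bound1 _ _ s0) _.
    by rewrite -/X -/Y sqX mulrA sk1 mulrDl mulrDl !mul1r.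
  have -> : p * X `^ (r - 1) * (2 * s * X) = p * 2 * (s * X `^ r).
    by rewrite -XrX; ring.
  by rewrite ler_wpM2r ?mulr_ge0 ?powR_ge0 ?(ltW s0)//; lra.
have sE : 0 < X `^ r by rewrite powR_gt0.
have [s1|/ltW s1] := leP s 1.
  split; last first.
    apply: le_trans Dle _; rewrite ler_wpM2l//.
    apply: (@le_trans _ _ (X `^ r)); first by rewrite ler_piMl ?powR_ge0.
    by rewrite lerDl powR_ge0.
  (* An upper bound for the increment of [wsum]: [scaled_bound2] contributes 2 s^2 X and Y = s^q X
     is at most s^2 X, whence the 3. *)
  pose h := q%:R * \sum_i wt i * (x i ^+ k.+1 * y i) + 2 ^+ q * (3 * s ^+ 2 * X).
  have leh : wsum (x \+ y) <= X + h.
    apply: (@le_trans _ _ (X + (q%:R * \sum_i wt i * (x i ^+ k.+1 * y i) +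
       2 ^+ q * (\sum_i wt i * (x i ^+ k * y i ^+ 2) + Y)))).
      rewrite /X /Y /wsum -big_split /= !mulr_sumr -!big_split /= ler_sum// => i _.
      have := exprD_taylor_le (x i) (y i) ek; rewrite -/q => /(ler_wpM2l (wt0 i)).
      by move=> /le_trans; apply; rewrite le_eqVlt; apply/orP; left; apply/eqP; ring.
    rewrite lerD2l lerD2l ler_wpM2l ?exprn_ge0//.
    apply: le_trans (lerD (scaled_bound2 _ _ s0) (lexx _)) _.
    rewrite -/X -/Y sqX mulrA sk2.
    rewrite (_ : s ^+ 2 * X + s ^+ 2 * X + s ^+ q * X =
      2 * s ^+ 2 * X + s ^+ 2 * s ^+ k * X); last first.
      by rewrite /q -(addn2 k) exprD; ring.
    rewrite (_ : 3 * s ^+ 2 * X = 2 * s ^+ 2 * X + s ^+ 2 * X); last ring.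
    by rewrite lerD2l ler_wpM2r ?(ltW X0)// ler_piMr ?exprn_ge0 ?(ltW s0)// exprn_ile1 ?(ltW s0) ?(ltW s1).
  apply: (@le_trans _ _ ((X + h) `^ r)).
    rewrite ge0_ler_powR ?nnegrE ?wsum_ge0 ?(ltW r0)//.
    by apply: le_trans leh; exact: wsum_ge0.
  apply: le_trans (powR_concave_tangent r01 X0 (le_trans (wsum_ge0 _) leh)) _.
  have -> : r * X `^ (r - 1) * h = D + 3 * 2 ^+ q * r * (s ^+ 2 * X `^ r).
    by rewrite /h DE -XrX /r; field; rewrite pnatr_eq0.
  rewrite addrA lerD2l -spX mulrA [leRHS]mulrA ler_wpM2r ?powR_ge0//.
  have z0 : 0 <= (2 : R) ^+ q by exact: exprn_ge0.
  have zr : 3 * 2 ^+ q * r <= 2 ^+ q.+3.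
    rewrite (exprS _ q.+2) (exprS _ q.+1) (exprS _ q).
    by move: z0; move: (2 ^+ q) => z z0; nra.
  have s2p : s ^+ 2 <= s `^ p by rewrite -powR_mulrn ?(ltW s0)// ger_powR ?s0.
  apply: ler_pM => //; last exact: exprn_ge0 (ltW s0).
  by apply: mulr_ge0 (ltW r0); exact: mulr_ge0.
have sp1 : s <= s `^ p by rewrite le1r_powR// ltW.
split; last first.
  apply: le_trans Dle _; rewrite ler_wpM2l//.
  rewrite -spX; apply: (@le_trans _ _ (s `^ p * X `^ r)); first by rewrite ler_pM2r.
  by rewrite lerDr ltW.
(* The linear term on the right may be negative, so the constant has to absorb 4 Y^r besides the
   factor 2^(q+1). *)
have Dl : - (4 * Y `^ r) <= D.
  rewrite lerNl; apply: le_trans (ler_norm _) _; rewrite normrN.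
  by apply: le_trans Dle _; rewrite ler_wpM2l// -spX ler_pM2r.
have XY : X <= Y by rewrite sqX ler_peMl ?exprn_ege1// ltW.
have le2 : wsum (x \+ y) <= 2 ^+ q.+1 * Y.
  apply: (@le_trans _ _ (2 ^+ q * (X + Y))).
    rewrite /X /Y /wsum -big_split /= mulr_sumr; apply: ler_sum => i _ /=.
    by rewrite -mulrDr [leRHS]mulrCA ler_wpM2l//; apply: exprD_norm_le; rewrite /= negbK.
  by rewrite exprSr -mulrA ler_wpM2l ?exprn_ge0//; lra.
have : wsum (x \+ y) `^ r <= 2 ^+ q.+1 * Y `^ r.
  have c1 : 1 <= (2 : R) ^+ q.+1 by rewrite exprn_ege1// ler1n.
  apply: (@le_trans _ _ ((2 ^+ q.+1 * Y) `^ r)).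
    by rewrite ge0_ler_powR ?nnegrE ?wsum_ge0 ?(ltW r0)// (le_trans _ le2) ?wsum_ge0.
  rewrite powRM ?(ltW Y0)//.
  by rewrite ler_wpM2r ?powR_ge0// ler1_powR.
have := powR_ge0 X r; have : 0 <= Y `^ r by rewrite powR_ge0.
have : 1 <= (2:R) ^+ q by rewrite exprn_ege1//; lra.
rewrite !exprS; move: (Y `^ r) (X `^ r) ((2:R) ^+ q) (_ `^ r) Dl.
by move=> y1 x1 z1 u1 *; nra.
Qed.

End weighted_norm.

(** * Independence with respect to the sigma-algebra of finitely many weights *)

Section independence.
Context {R : realType} {d : measure_display} {T : measurableType d}
  {P : probability T R} {I : choiceType} {D : set I} {X : I -> {RV P >-> R}}.
Hypothesis indX : mutually_independent D X.

(** A pi-system generating the sigma-algebra of the [X i] with i in [s]. Used as the structure of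
    the type [TS s], it makes measurability with respect to the past an ordinary measurability
    statement. *)
Definition cylinders (s : seq I) : set (set T) :=
  [set A | exists B : I -> set (measurableTypeR R),
     (forall i, measurable (B i)) /\ A = \bigcap_(i in [set` s]) (X i @^-1` B i)].

Local Notation "'TS' s" := (g_sigma_algebraType (cylinders s)) (at level 10).

Lemma measurable_cylinders s : cylinders s `<=` measurable.
Proof.
move=> _ [B [mB ->]]; apply: fin_bigcap_measurable => [|i _]; first exact: finite_seq.
exact: (measurable_funPTI (X i) (mB i)).
Qed.

Lemma setI_closed_cylinders s : setI_closed (cylinders s).
Proof.
move=> _ _ [B [mB ->]] [C [mC ->]]; exists (fun i => B i `&` C i); split.
  by move=> i; exact: measurableI.
by rewrite -bigcapI; apply: eq_bigcapr => i _; rewrite preimage_setI.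
Qed.

Lemma cylindersT s : cylinders s setT.
Proof.
exists (fun=> setT); split => [i|]; first exact: measurableT.
by apply/seteqP; split.
Qed.

Lemma measurable_cylinder_coord s i : i \in s ->
  measurable_fun setT (X i : TS s -> R).
Proof.
move=> is_ _ B mB; rewrite setTI; apply: sub_sigma_algebra.
exists (fun j => if j == i then B else setT); split.
  by move=> j; case: ifP.
apply/seteqP; split=> [w XB j _ /=|w /(_ i is_)/=]; last by rewrite eqxx.
by case: eqP => [->|].
Qed.

Lemma measurable_fun_cylinders {d'} {T' : measurableType d'} s (f : T -> T') :
  measurable_fun setT (f : TS s -> T') -> measurable_fun setT f.
Proof.
move=> mf _ B mB; have := mf measurableT _ mB; rewrite !setTI.
by apply: smallest_sub; [exact: sigma_algebra_measurable|exact: measurable_cylinders].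
Qed.

(** As functions of [A], both sides are finite measures. They agree on the pi-system of cylinders,
    where independence applies to the list [v :: s]. *)
Lemma indep_events s v (A : set T) (B : set (measurableTypeR R)) :
  uniq s -> v \notin s -> (forall i, i \in v :: s -> D i) ->
  <<s cylinders s >> A -> measurable B ->
  P (A `&` X v @^-1` B) = (P A * P (X v @^-1` B))%E.
Proof.
move=> us vs sD sA mB.
have mXB : measurable (X v @^-1` B).
  exact: (measurable_funPTI (X v) mB).
have PXB : P (X v @^-1` B) \is a fin_num by rewrite fin_num_measure.
have c0 : 0 <= fine (P (X v @^-1` B)) by rewrite fine_ge0.
pose c : {nonneg R} := NngNum c0.
rewrite muleC -(fineK PXB) -/(c%:num).
rewrite -[LHS]/(mrestr P mXB A) -[RHS]/(mscale c P A).
apply: (g_sigma_algebra_measure_unique (cylinders s) _ (fun=> setT)) => //.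
- exact: measurable_cylinders.
- by move=> _; exact: cylindersT.
- by rewrite bigcup_const.
- exact: setI_closed_cylinders.
- move=> _ [C [mC ->]]; rewrite /= /mrestr /mscale /= fineK//.
  have H (E : I -> set (measurableTypeR R)) (mE : forall i, measurable (E i)) :
      P (\bigcap_(i in [set` s]) (X i @^-1` E i)) = (\prod_(i <- s) P (X i @^-1` E i))%E.
    by apply: indX => // i is_; apply: sD; rewrite inE is_ orbT.
  rewrite H//.
  pose E i := if i == v then B else C i.
  transitivity (P (\bigcap_(i in [set` v :: s]) (X i @^-1` E i))).
    congr (P _); apply/seteqP; split=> [w [h1 h2] i /=|w h].
      by rewrite inE /E; case: eqP => [-> //|_ /= /h1].
    split; last by have := h v; rewrite /E /= eqxx inE eqxx; exact.
    move=> i is_; have := h i; rewrite /E /= inE is_ orbT.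
    case: eqP => [iv|_]; last exact.
    by move: vs; rewrite -iv => /negP; case.
  rewrite indX//; last 2 first.
    by rewrite /= vs us.
    by move=> i; rewrite /E; case: ifP.
  rewrite big_cons {1}/E eqxx; congr (_ * _)%E.
  apply: eq_big_seq => i is_; rewrite /E; case: eqP => // iv.
  by move: vs; rewrite -iv is_.
- by move=> _; rewrite /= /mrestr setTI (le_lt_trans (probability_le1 _ _))// ltry.
Qed.

(** By [indep_events] the joint law of the identity into [TS s] and of [X v] is a product measure,
    and Tonelli's theorem factors the integral. *)
Lemma indep_integral_ge0 s v (Y : T -> R) (g : R -> R) :
  uniq s -> v \notin s -> (forall i, i \in v :: s -> D i) ->
  measurable_fun setT (Y : TS s -> R) -> (forall w, 0 <= Y w) ->
  measurable_fun setT g -> (forall x, 0 <= g x) ->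
  (\int[P]_w (Y w * g (X v w))%:E =
   (\int[P]_w (Y w)%:E) * \int[P]_w (g (X v w))%:E)%E.
Proof.
move=> us vs sD mY Y0 mg g0.
pose idS : T -> TS s := fun w => w.
have mid : measurable_fun setT idS.
  move=> _ B mB; rewrite setTI.
  by apply: smallest_sub mB; [exact: sigma_algebra_measurable|exact: measurable_cylinders].
pose idM : {mfun T >-> TS s} := HB.pack idS (isMeasurableFun.Build _ _ _ _ idS mid).
pose phi : T -> TS s * R := fun w => (idS w, X v w).
have mphi : measurable_fun setT phi.
  by apply: measurable_fun_pair => //; exact: (measurable_funPT (X v)).
pose phiM : {mfun T >-> (TS s * R)%type} :=
  HB.pack phi (isMeasurableFun.Build _ _ _ _ phi mphi).
pose f : TS s * R -> \bar R := fun z => (Y z.1 * g z.2)%:E.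
have mf : measurable_fun setT f.
  apply/measurable_EFinP; apply: measurable_funM.
    exact: (measurableT_comp mY).
  exact: (measurableT_comp mg).
have f0 z : (0 <= f z)%E by rewrite lee_fin mulr_ge0.
transitivity (\int[distribution P phiM]_z f z)%E.
  by rewrite ge0_integral_distribution.
transitivity (\int[distribution P idM \x distribution P (X v)]_z f z)%E.
  apply: eq_measure_integral => A mA _; apply: esym.
  apply: product_measure_unique => // A1 A2 mA1 mA2.
  rewrite /= /distribution /pushforward /= -(indep_events us vs sD)//.
rewrite fubini_tonelli1// /fubini_F /f /=.
under eq_integral => x _.
  under eq_integral do rewrite EFinM.
  rewrite ge0_integralZl ?lee_fin//; last 2 first.
    exact/measurable_EFinP.
    by move=> y _; rewrite lee_fin.
  over.
rewrite ge0_integralZr//=.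
- congr (_ * _)%E.
    by apply: (ge0_integral_distribution idM (f := fun y => (Y y)%:E)); [exact/measurable_EFinP|].
  by apply: (ge0_integral_distribution (X v) (f := fun y => (g y)%:E)); [exact/measurable_EFinP|].
- exact/measurable_EFinP.
- by move=> x _; rewrite lee_fin.
- by apply: integral_ge0 => x _; rewrite lee_fin.
Qed.

End independence.

(** * Integrals of nonnegative real functions *)

Section real_valued_integral.
Context {R : realType} {d : measure_display} {T : measurableType d}
  (mu : {measure set T -> \bar R}).
Implicit Types f g : T -> R.

Lemma ge0_integralD_EFin f g : measurable_fun setT f -> measurable_fun setT g ->
  (forall w, 0 <= f w) -> (forall w, 0 <= g w) ->
  (\int[mu]_w (f w + g w)%:E = \int[mu]_w (f w)%:E + \int[mu]_w (g w)%:E)%E.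
Proof.
move=> mf mg f0 g0; under eq_integral do rewrite EFinD.
by rewrite ge0_integralD//; try exact/measurable_EFinP; move=> w _; rewrite lee_fin.
Qed.

Lemma ge0_integralMl_EFin f k : measurable_fun setT f ->
  (forall w, 0 <= f w) -> 0 <= k ->
  (\int[mu]_w (k * f w)%:E = k%:E * \int[mu]_w (f w)%:E)%E.
Proof.
move=> mf f0 k0; under eq_integral do rewrite EFinM.
by rewrite ge0_integralZl_EFin//; [move=> w _; rewrite lee_fin|exact/measurable_EFinP].
Qed.

Lemma ge0_le_integral_EFin f g : measurable_fun setT f -> measurable_fun setT g ->
  (forall w, 0 <= f w) -> (forall w, f w <= g w) ->
  (\int[mu]_w (f w)%:E <= \int[mu]_w (g w)%:E)%E.
Proof.
move=> mf mg f0 fg; apply: ge0_le_integral => //; try exact/measurable_EFinP.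
- by move=> w _; rewrite lee_fin.
- by move=> w _; rewrite lee_fin.
Qed.

Lemma integral_EFin_ge0 f : (forall w, 0 <= f w) -> (0 <= \int[mu]_w (f w)%:E)%E.
Proof. by move=> f0; apply: integral_ge0 => w _; rewrite lee_fin. Qed.

(* The pointwise inequality is written without subtractions, so that only
   integrals of nonnegative functions occur; [lp], [lpv] and [ln], [lnv] have
   equal integrals and cancel. *)
Lemma le_integral_balance (n' n lp ln lpv lnv g : T -> R) (c ip iN : R) :
  measurable_fun setT n' -> measurable_fun setT n ->
  measurable_fun setT lp -> measurable_fun setT ln ->
  measurable_fun setT lpv -> measurable_fun setT lnv -> measurable_fun setT g ->
  (forall w, 0 <= n' w) -> (forall w, 0 <= n w) ->
  (forall w, 0 <= lp w) -> (forall w, 0 <= ln w) ->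
  (forall w, 0 <= lpv w) -> (forall w, 0 <= lnv w) -> (forall w, 0 <= g w) ->
  0 <= c ->
  (\int[mu]_w (lp w)%:E = ip%:E)%E -> (\int[mu]_w (ln w)%:E = iN%:E)%E ->
  (\int[mu]_w (lpv w)%:E = ip%:E)%E -> (\int[mu]_w (lnv w)%:E = iN%:E)%E ->
  (forall w, n' w + lp w + lnv w <= n w + lpv w + ln w + c * g w) ->
  (\int[mu]_w (n' w)%:E <= \int[mu]_w (n w)%:E + c%:E * \int[mu]_w (g w)%:E)%E.
Proof.
move=> mn' mn mlp mln mlpv mlnv mg n'0 n0 lp0 ln0 lpv0 lnv0 g0 c0 lpE lnE lpvE lnvE key.
have l10 w : 0 <= n' w + lp w by exact: addr_ge0.
have ml1 : measurable_fun setT (fun w => n' w + lp w) by exact: measurable_funD.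
have l0 w : 0 <= n' w + lp w + lnv w by exact: addr_ge0.
have ml : measurable_fun setT (fun w => n' w + lp w + lnv w) by exact: measurable_funD.
have r10 w : 0 <= n w + lpv w by exact: addr_ge0.
have mr1 : measurable_fun setT (fun w => n w + lpv w) by exact: measurable_funD.
have r20 w : 0 <= n w + lpv w + ln w by exact: addr_ge0.
have mr2 : measurable_fun setT (fun w => n w + lpv w + ln w) by exact: measurable_funD.
have cg0 w : 0 <= c * g w by exact: mulr_ge0.
have mcg : measurable_fun setT (fun w => c * g w) by exact: measurable_funM.
have mr : measurable_fun setT (fun w => n w + lpv w + ln w + c * g w).
  exact: measurable_funD.
have := ge0_le_integral_EFin ml mr l0 key.
rewrite (ge0_integralD_EFin ml1 mlnv l10 lnv0) (ge0_integralD_EFin mn' mlp n'0 lp0).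
rewrite (ge0_integralD_EFin mr2 mcg r20 cg0) (ge0_integralD_EFin mr1 mln r10 ln0).
rewrite (ge0_integralD_EFin mn mlpv n0 lpv0) (ge0_integralMl_EFin mg g0 c0).
rewrite lpE lnE lpvE lnvE.
move: (\int[mu]_w (n' w)%:E)%E (\int[mu]_w (n w)%:E)%E (\int[mu]_w (g w)%:E)%E.
move=> A B G; rewrite -!addeA => H.
rewrite -(@leeD2rE _ (ip%:E + iN%:E)%E)//; apply: le_trans H _.
by rewrite -!addeA leeD2l// addeA addeC.
Qed.

End real_valued_integral.

Section wnorm_measurable.
Context {R : realType} {d : measure_display} {T : measurableType d}.
Variables (J : finType) (wt : J -> R) (k : nat) (p : R).

Lemma measurable_wsum (S : J -> T -> R) : (forall i, measurable_fun setT (S i)) ->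
  measurable_fun setT (fun w => wsum wt k (S^~ w)).
Proof.
move=> mS; apply: measurable_sum => i; apply: measurable_funM => //.
exact: measurable_funX.
Qed.

Lemma measurable_wnorm (S : J -> T -> R) : (forall i, measurable_fun setT (S i)) ->
  measurable_fun setT (fun w => wnorm wt k p (S^~ w)).
Proof.
move=> mS; apply: (measurableT_comp (measurable_powR _)); exact: measurable_wsum.
Qed.

Lemma measurable_wder (S : J -> T -> R) i : (forall i, measurable_fun setT (S i)) ->
  measurable_fun setT (fun w => wder wt k p (S^~ w) i).
Proof.
move=> mS; apply: measurable_funM; apply: measurable_funM => //.
  apply: (measurableT_comp (measurable_powR _)); exact: measurable_wsum.
exact: measurable_funX.
Qed.

Lemma wnorm_ge0 x : 0 <= wnorm wt k p x :> R.
Proof. exact: powR_ge0. Qed.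

Lemma wnormZ (c : R) (a : J -> R) : (forall i, 0 <= wt i) -> ~~ odd k ->
  wnorm wt k p (fun i => c * a i) = `|c| `^ p * wnorm wt k p a.
Proof.
move=> wt0 ek; rewrite /wnorm.
have -> : wsum wt k (fun i => c * a i) = `|c| ^+ k.+2 * wsum wt k a.
  rewrite /wsum mulr_sumr; apply: eq_bigr => i _.
  by rewrite exprMn mulrCA (@exprn_even_norm _ c)//= negbK.
rewrite powRM ?exprn_ge0 ?wsum_ge0//; congr (_ * _).
by rewrite -powR_mulrn// -powRrM mulrC divfK// pnatr_eq0.
Qed.

End wnorm_measurable.

Lemma funrposneg_eq {R : realType} (x : R) : x = Num.max x 0 - Num.max (- x) 0.
Proof. by case: (leP x 0) => x0; case: (leP (- x) 0) => ?; lra. Qed.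

Lemma integral_cst_prob {R : realType} {d} {T : measurableType d}
  (P : probability T R) (c : R) : (\int[P]_w c%:E = c%:E)%E.
Proof.
transitivity (c%:E * P setT)%E; first exact: integral_cst.
by rewrite probability_setT mule1.
Qed.

(** * The moment inequality for one word and its iteration over all words *)

Section cascade_moments.
Context {R : realType} {d : measure_display} {T : measurableType d}
  {P : probability T R} {b : nat} {W : seq 'I_b -> {RV P >-> R}}.
Hypothesis indW : mutually_independent [set u | u != [::]] W.

(** Positive parts make products and real powers of the weights well behaved at every sample point,
    not just almost surely. *)
Definition posw (u : seq 'I_b) (w : T) : R := Num.max (W u w) 0.

Lemma posw_ge0 u w : 0 <= posw u w.
Proof. by rewrite /posw le_max lexx orbT. Qed.

Lemma measurable_max0 : measurable_fun setT (fun x : R => Num.max x 0).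
Proof. exact: measurable_maxr. Qed.

Lemma measurable_posw u : measurable_fun setT (posw u).
Proof. by apply: measurable_maxr => //; exact: measurable_funPT. Qed.

Lemma measurable_cyl_posw s u : u \in s ->
  measurable_fun setT (posw u : g_sigma_algebraType (cylinders (X:=W) s) -> R).
Proof.
by move=> us; apply: measurable_maxr => //; exact: measurable_cylinder_coord.
Qed.

Lemma indep_posw s v (Y : T -> R) (g : R -> R) :
  uniq s -> v \notin s -> (forall u, u \in v :: s -> u != [::]) ->
  measurable_fun setT (Y : g_sigma_algebraType (cylinders (X:=W) s) -> R) ->
  (forall w, 0 <= Y w) ->
  measurable_fun setT g -> (forall x, 0 <= x -> 0 <= g x) ->
  (\int[P]_w (Y w * g (posw v w))%:E =
   (\int[P]_w (Y w)%:E) * \int[P]_w (g (posw v w))%:E)%E.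
Proof.
move=> us vs sn mY Y0 mg g0.
apply: (indep_integral_ge0 indW us vs sn mY Y0 (g := fun x => g (Num.max x 0))).
  exact: (measurableT_comp mg measurable_max0).
by move=> x; apply: g0; rewrite le_max lexx orbT.
Qed.

(** The empty prefix, of weight 1, is left out. The length [k] is separate from [v] so that the
    weight of [v] itself can be split off, with [k] one less than the size. *)
Definition wprod (k : nat) (v : seq 'I_b) (w : T) : R :=
  \prod_(0 <= j < k) posw (take j.+1 v) w.

Lemma wprod_ge0 k v w : 0 <= wprod k v w.
Proof. by apply: prodr_ge0 => j _; exact: posw_ge0. Qed.

Lemma measurable_wprod s k v : (forall j, (j < k)%N -> take j.+1 v \in s) ->
  measurable_fun setT (wprod k v : g_sigma_algebraType (cylinders (X:=W) s) -> R).
Proof.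
move=> vs; apply: measurable_prod => j; rewrite mem_index_iota => /andP[_ jk].
by apply: measurable_cyl_posw; exact: vs.
Qed.

(** Prefixes of different lengths are different words, so the factors are independent. Used with the
    identity for means and with the p-th power for moments. *)
Lemma integral_wprod (g : R -> R) (c : R) k v :
  (forall u, u != [::] -> (\int[P]_w (g (posw u w))%:E = c%:E)%E) ->
  measurable_fun setT g -> (forall x, 0 <= x -> 0 <= g x) ->
  (k <= size v)%N ->
  (\int[P]_w (\prod_(0 <= j < k) g (posw (take j.+1 v) w))%:E = (c ^+ k)%:E)%E.
Proof.
move=> gc mg g0; elim: k => [|k IH] kv.
  under eq_integral do rewrite big_nil.
  exact: integral_cst_prob.
under eq_integral do rewrite big_nat_recr//=.
have tk j : (j <= k)%N -> size (take j.+1 v) = j.+1.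
  by move=> jk; rewrite size_takel//; lia.
rewrite (indep_posw (s := [seq take j.+1 v | j <- iota 0 k])
  (Y := fun w => \prod_(0 <= j < k) g (posw (take j.+1 v) w)) (g := g)) //.
- by rewrite IH ?gc -?EFinM -?exprSr//; [rewrite -size_eq0 tk|lia].
- rewrite map_inj_in_uniq ?iota_uniq// => i j.
  rewrite !mem_iota !add0n /= => ik jk /(congr1 size); rewrite !tk; lia.
- apply/mapP => -[j]; rewrite mem_iota add0n /= => jk /(congr1 size).
  by rewrite !tk; lia.
- move=> u; rewrite inE -size_eq0 => /predU1P[->|]; first by rewrite tk.
  by move=> /mapP[j]; rewrite mem_iota add0n /= => jk ->; rewrite tk//; lia.
- apply: measurable_prod => j; rewrite mem_index_iota => /andP[_ jk].
  apply: (measurableT_comp mg); apply: measurable_cyl_posw.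
  by apply/mapP; exists j => //; rewrite mem_iota.
- by move=> w; apply: prodr_ge0 => j _; apply: g0; exact: posw_ge0.
Qed.

Lemma prod_powR (I : Type) (s : seq I) (F : I -> R) p : (forall i, 0 <= F i) ->
  (\prod_(i <- s) F i) `^ p = \prod_(i <- s) F i `^ p.
Proof.
move=> F0; elim: s => [|i s IH]; first by rewrite !big_nil powR1.
by rewrite !big_cons powRM ?IH// prodr_ge0.
Qed.

Variables (J : finType) (wt : J -> R) (k : nat) (p m : R).
Hypotheses (wt0 : forall i, 0 <= wt i) (ek : ~~ odd k) (p12 : 1 < p <= 2).
Hypothesis mean1 : forall u, u != [::] -> (\int[P]_w (posw u w)%:E = 1)%E.
Hypothesis momp : forall u, u != [::] -> (\int[P]_w (posw u w `^ p)%:E = m%:E)%E.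

Let N := wnorm wt k p.

(* The linear term of [wnorm_step] has mean zero, [posw v] being independent of
   [S] and [X]. *)
Lemma cascade_step s v (S : J -> T -> R) (X : T -> R) (a : J -> R) (e x : R) :
  uniq s -> v \notin s -> (forall u, u \in v :: s -> u != [::]) ->
  (forall i, measurable_fun setT (S i : g_sigma_algebraType (cylinders (X:=W) s) -> R)) ->
  measurable_fun setT (X : g_sigma_algebraType (cylinders (X:=W) s) -> R) ->
  (forall w, 0 <= X w) ->
  (\int[P]_w (N (S^~ w))%:E <= e%:E)%E ->
  (\int[P]_w (X w `^ p)%:E = x%:E)%E ->
  (\int[P]_w (N (fun i => S i w + X w * (posw v w - 1) * a i)%R)%:E <=
   (e + 2 ^+ k.+2.+3 * (m + 1) * (x * N a))%:E)%E.
Proof.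
move=> us vs sn mS mX X0 Se Xx.
have vn : v != [::] by apply: sn; rewrite inE eqxx.
have mTS i : measurable_fun setT (S i) by exact: measurable_fun_cylinders (mS i).
have mTX : measurable_fun setT X by exact: measurable_fun_cylinders mX.
have C0 : 0 <= (2 : R) ^+ k.+2.+3 by exact: exprn_ge0.
set C := 2 ^+ k.+2.+3 in C0 *.
pose L w := \sum_i wder wt k p (S^~ w) i * (X w * a i).
have mL : measurable_fun setT (L : g_sigma_algebraType (cylinders (X:=W) s) -> R).
  apply: measurable_sum => i; apply: measurable_funM; first exact: measurable_wder.
  exact: measurable_funM.
pose Lp w : R := Num.max (L w) 0; pose Ln w : R := Num.max (- L w) 0.
have mLp : measurable_fun setT (Lp : g_sigma_algebraType (cylinders (X:=W) s) -> R).
  exact: measurable_maxr.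
have mLn : measurable_fun setT (Ln : g_sigma_algebraType (cylinders (X:=W) s) -> R).
  by apply: measurable_maxr => //; exact: measurable_funN.
have mTLp := measurable_fun_cylinders mLp.
have mTLn := measurable_fun_cylinders mLn.
have Lp0 w : 0 <= Lp w by rewrite le_max lexx orbT.
have Ln0 w : 0 <= Ln w by rewrite le_max lexx orbT.
have LE w : L w = Lp w - Ln w by exact: funrposneg_eq.
have mV := measurable_posw v.
pose S' i w := S i w + X w * (posw v w - 1) * a i.
have mS' i : measurable_fun setT (S' i).
  apply: measurable_funD => //; apply: measurable_funM => //.
  by apply: measurable_funM => //; exact: measurable_funB.
pose g2 (z : R) := `|z - 1| `^ p.
have mg2 : measurable_fun setT g2.
  apply: (measurableT_comp (measurable_powR _)).
  by apply: measurableT_comp => //; exact: measurable_funB.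
have mN : measurable_fun setT (fun w => N (S^~ w)) by exact: measurable_wnorm.
have mN' : measurable_fun setT (fun w => N (S'^~ w)) by exact: measurable_wnorm.
have mXp : measurable_fun setT (fun w => X w `^ p : R).
  exact: (measurableT_comp (measurable_powR _)).
have mSXp : measurable_fun setT (fun w : g_sigma_algebraType (cylinders (X:=W) s) => X w `^ p : R).
  exact: (measurableT_comp (measurable_powR _)).
have mg2V : measurable_fun setT (fun w => g2 (posw v w)) by exact: measurableT_comp.
have ZN c : N (fun i => c * a i) = `|c| `^ p * N a := wnormZ p c a wt0 ek.
have step w (y : J -> R) : N (S^~ w \+ y) <= N (S^~ w) + \sum_i wder wt k p (S^~ w) i * y i + C * N y /\
  `|\sum_i wder wt k p (S^~ w) i * y i| <= 4 * (N (S^~ w) + N y) := wnorm_step wt0 ek p12 (S^~ w) y.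
(* [wnorm_step] for the increment X (V - 1) a, where V is the new weight. The linear term is L (V -
   1), and L = Lp - Ln is expanded so that no subtraction remains. *)
have key w : N (S'^~ w) + Lp w + Ln w * posw v w <=
    N (S^~ w) + Lp w * posw v w + Ln w + C * N a * (X w `^ p * g2 (posw v w)).
  have [+ _] := step w (fun i => X w * (posw v w - 1) * a i).
  rewrite (_ : \sum_i _ = L w * (posw v w - 1)); last first.
    by rewrite mulr_suml; apply: eq_bigr => i _; ring.
  rewrite ZN normrM (ger0_norm (X0 w)) powRM// -/(g2 _) (LE w).
  rewrite -[N (_ \+ _)]/(N (S'^~ w)).
  move: (N (S'^~ w)) (Lp w) (Ln w) (posw v w) (N (S^~ w)) (N a) (X w `^ p) (g2 _).
  by move=> n1 p1 q1 v1 n2 na x1 g1 H; lra.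
(* The second bound of [wnorm_step], for the increment X a without the weight, dominates |L| by
   integrable quantities. *)
have LN w : Lp w + Ln w <= 4 * (N (S^~ w) + X w `^ p * N a).
  have [_] := step w (fun i => X w * a i).
  rewrite -/(L w) ZN (ger0_norm (X0 w)).
  apply: le_trans; rewrite /Lp /Ln.
  have := ler_norm (L w); have := ler_norm (- L w); rewrite normrN.
  by case: (leP (L w) 0) => ?; case: (leP (- L w) 0) => ?; lra.
have Na0 : 0 <= N a by exact: wnorm_ge0.
have NS0 w : 0 <= N (S^~ w) by exact: wnorm_ge0.
have Xp0 w : 0 <= X w `^ p by exact: powR_ge0.
have V0 w := posw_ge0 v w.
have g20 z : 0 <= g2 z by exact: powR_ge0.
have mNX : measurable_fun setT (fun w => N a * X w `^ p) by exact: measurable_funM.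
have mNSX : measurable_fun setT (fun w => N (S^~ w) + N a * X w `^ p) by exact: measurable_funD.
have m4 : measurable_fun setT (fun w => 4 * (N (S^~ w) + N a * X w `^ p)) by exact: measurable_funM.
have Ifin (f : T -> R) : measurable_fun setT f -> (forall w, 0 <= f w) ->
    (forall w, f w <= 4 * (N (S^~ w) + X w `^ p * N a)) ->
    exists y, (\int[P]_w (f w)%:E = y%:E)%E.
  move=> mf f0 fle.
  have : (\int[P]_w (f w)%:E <= (4 * (e + N a * x))%:E)%E.
    apply: (@le_trans _ _ (\int[P]_w (4 * (N (S^~ w) + N a * X w `^ p))%:E)%E).
      by apply: ge0_le_integral_EFin mf m4 f0 _ => w; rewrite [N a * _]mulrC.
    have NX0 w : 0 <= N a * X w `^ p by rewrite mulr_ge0.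
    have NSX0 w : 0 <= N (S^~ w) + N a * X w `^ p by rewrite addr_ge0.
    rewrite (ge0_integralMl_EFin _ mNSX NSX0)// EFinM lee_pmul2l ?lte_fin//.
    rewrite (ge0_integralD_EFin _ mN mNX NS0 NX0).
    by rewrite (ge0_integralMl_EFin _ mXp Xp0 Na0) Xx EFinD leeD.
  have := integral_EFin_ge0 P f0; case: (integral _ _ _) => [y| |] //= _ _.
  by exists y.
have [lp lpE] : exists y, (\int[P]_w (Lp w)%:E = y%:E)%E.
  by apply: Ifin => // w; apply: le_trans (LN w); rewrite lerDl.
have [ln lnE] : exists y, (\int[P]_w (Ln w)%:E = y%:E)%E.
  by apply: Ifin => // w; apply: le_trans (LN w); rewrite lerDr.
have lpV : (\int[P]_w (Lp w * posw v w)%:E = lp%:E)%E.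
  by rewrite (indep_posw us vs sn mLp Lp0 (g := id))// lpE mean1// mule1.
have lnV : (\int[P]_w (Ln w * posw v w)%:E = ln%:E)%E.
  by rewrite (indep_posw us vs sn mLn Ln0 (g := id))// lnE mean1// mule1.
(* For z >= 0, |z - 1|^p is at most 1 when z < 1 and at most z^p otherwise. *)
have g2le : (\int[P]_w (g2 (posw v w))%:E <= (m + 1)%:E)%E.
  apply: (@le_trans _ _ (\int[P]_w (posw v w `^ p + 1)%:E)%E).
    apply: ge0_le_integral_EFin => //.
      by apply: measurable_funD => //; exact: (measurableT_comp (measurable_powR _)).
    have p0 : 0 <= p by have [? ?] := andP p12; lra.
    move=> w; rewrite /g2; have := V0 w; move: (posw v w) => z z0.
    have [z1|/ltW z1] := leP z 1.
      rewrite -[leLHS]add0r lerD ?powR_ge0//.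
      apply: (@le_trans _ _ (1 `^ p)); last by rewrite powR1.
      rewrite ge0_ler_powR ?nnegrE//.
      by rewrite distrC ger0_norm; lra.
    rewrite -[leLHS]addr0 lerD// ge0_ler_powR ?nnegrE//.
    by rewrite ger0_norm; lra.
  rewrite ge0_integralD_EFin//; last 2 first.
    exact: (measurableT_comp (measurable_powR _)).
    by move=> w; exact: powR_ge0.
  by rewrite momp// integral_cst_prob.
have Xg2 : (\int[P]_w (X w `^ p * g2 (posw v w))%:E <= (x * (m + 1))%:E)%E.
  rewrite (indep_posw us vs sn mSXp Xp0)// Xx EFinM lee_wpmul2l//.
  by rewrite -Xx; exact: integral_EFin_ge0.
have mXg2 : measurable_fun setT (fun w => X w `^ p * g2 (posw v w)) by exact: measurable_funM.
have mLpV : measurable_fun setT (fun w => Lp w * posw v w) by exact: measurable_funM.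
have mLnV : measurable_fun setT (fun w => Ln w * posw v w) by exact: measurable_funM.
have N'0 w : 0 <= N (S'^~ w) by exact: wnorm_ge0.
have LpV0 w : 0 <= Lp w * posw v w by exact: mulr_ge0.
have LnV0 w : 0 <= Ln w * posw v w by exact: mulr_ge0.
have Xg20 w : 0 <= X w `^ p * g2 (posw v w) by exact: mulr_ge0.
have CN : 0 <= C * N a by exact: mulr_ge0.
have := le_integral_balance mN' mN mTLp mTLn mLpV mLnV mXg2 N'0 NS0 Lp0 Ln0 LpV0
  LnV0 Xg20 CN lpE lnE lpV lnV key.
move=> /le_trans; apply; rewrite EFinD; apply: leeD Se _.
rewrite (_ : C * (m + 1) * (x * N a) = C * N a * (x * (m + 1))); last by ring.
by rewrite [in leRHS]EFinM; apply: lee_wpmul2l; rewrite ?lee_fin.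
Qed.

End cascade_moments.

Lemma mem_cat_split {T : eqType} (x : T) (s : seq T) :
  x \in s -> exists s1 s2, s = s1 ++ x :: s2.
Proof. by case/splitPr => s1 s2; exists s1, s2. Qed.

Section cascade_moments_bound.
Context {R : realType} {d : measure_display} {T : measurableType d}
  {P : probability T R} {b : nat} {W : seq 'I_b -> {RV P >-> R}}.
Hypothesis indW : mutually_independent [set u | u != [::]] W.
Variables (J : finType) (wt : J -> R) (k : nat) (p m : R).
Hypotheses (wt0 : forall i, 0 <= wt i) (ek : ~~ odd k) (p12 : 1 < p <= 2).
Local Notation posw := (posw (W := W)).
Local Notation wprod := (wprod (W := W)).
Hypothesis mean1 : forall u, u != [::] -> (\int[P]_w (posw u w)%:E = 1)%E.
Hypothesis momp : forall u, u != [::] -> (\int[P]_w (posw u w `^ p)%:E = m%:E)%E.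

Let N := wnorm wt k p.

(** Words are added one at a time, each by one use of [cascade_step]. Since nonempty proper prefixes
    of a word come earlier in [s], the coefficient of its centred weight is determined by the
    past. *)
Lemma cascade_moment_bound (a : seq 'I_b -> J -> R) (s : seq (seq 'I_b)) :
  uniq s -> (forall u, u \in s -> u != [::]) ->
  (forall s1 v s2, s = s1 ++ v :: s2 ->
     forall j, (j.+1 < size v)%N -> take j.+1 v \in s1) ->
  (\int[P]_w (N (fun i => \sum_(v <- s)
      wprod (size v).-1 v w * (posw v w - 1) * a v i)%R)%:E <=
   (2 ^+ k.+2.+3 * (m + 1) * \sum_(v <- s) m ^+ (size v).-1 * N (a v))%:E)%E.
Proof.
elim/last_ind: s => [|s v IH].
  move=> _ _ _; under eq_integral => w _.
    (* The zero vector is written as a multiple of itself so that homogeneity evaluates its norm. *)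
    rewrite (_ : (fun i => _) = (fun i : J => 0 * 0)); last first.
      by apply/funext => i; rewrite big_nil mul0r.
    rewrite [N _](wnormZ p 0 (fun=> 0) wt0 ek) normr0 powR0; last first.
      by have [? _] := andP p12; rewrite gt_eqF//; lra.
    rewrite mul0r; over.
  by rewrite integral_cst_prob big_nil mulr0.
rewrite rcons_uniq => /andP[vs us] sn pc.
have vn : v != [::] by apply: sn; rewrite mem_rcons inE eqxx.
have pcs j : (j.+1 < size v)%N -> take j.+1 v \in s.
  by apply: (pc s v [::]); rewrite cats1.
have {}IH := IH us _ _; rewrite big_rcons /= mulrDr.
under eq_integral => w _.
  rewrite (_ : (fun i => _) = (fun i : J =>
    \sum_(v <- s) wprod (size v).-1 v w * (posw v w - 1) * a v i +
    wprod (size v).-1 v w * (posw v w - 1) * a v i)); last first.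
    by apply/funext => i; rewrite big_rcons /= addrC.
  over.
apply: (cascade_step indW wt0 ek p12 mean1 momp (v := v) (x := m ^+ (size v).-1)
  (S := fun i w => \sum_(v <- s) wprod (size v).-1 v w * (posw v w - 1) * a v i)
  (X := wprod (size v).-1 v) (a v) us vs).
- by move=> u; rewrite -mem_rcons; exact: sn.
- move=> i; under eq_fun do rewrite big_tnth.
  apply: measurable_sum => j; have us' := mem_tnth j (in_tuple s).
  move: (tnth _ j) us' => u us'.
  apply: measurable_funM => //; apply: measurable_funM.
    apply: measurable_wprod => l lu.
    have [s1 [s2 e]] : exists s1 s2, s = s1 ++ u :: s2.
      exact: mem_cat_split us'.
    rewrite e mem_cat (pc s1 u (rcons s2 v))//; last by lia.
    by rewrite e rcons_cat.
  by apply: measurable_funB => //; exact: measurable_cyl_posw.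
- by apply: measurable_wprod => j jv; apply: pcs; lia.
- by move=> w; exact: wprod_ge0.
- apply: IH => [u us'|s1 u s2 e]; first by apply: sn; rewrite mem_rcons inE us' orbT.
  by apply: (pc s1 u (rcons s2 v)); rewrite e rcons_cat.
- rewrite -(integral_wprod indW (g := fun x => x `^ p) momp (measurable_powR p)
    (fun x _ => powR_ge0 x p) (leq_pred (size v))).
  apply: eq_integral => w _; rewrite /wprod prod_powR// => j.
  exact: posw_ge0.
Qed.

End cascade_moments_bound.

(** * Trigonometric bounds and a smoothed step function *)

Section trig_bounds.
Context {R : realType}.
Implicit Types x : R.

Lemma derive_ge0_le (f df : R -> R) (a b : R) : a <= b ->
  (forall t : R, is_derive t 1 f (df t)) -> (forall t, a <= t <= b -> 0 <= df t) ->
  f a <= f b.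
Proof.
move=> ab fdf df0.
have [|c /[!in_itv]/= cab e] := @MVT_segment _ f df a b ab (fun t _ => fdf t).
  apply: continuous_subspaceT => t; apply: differentiable_continuous.
  by apply/derivable1_diffP; apply: ex_derive.
by rewrite -subr_ge0 e mulr_ge0 ?df0// subr_ge0.
Qed.

Lemma sin_le_id x : 0 <= x -> sin x <= x.
Proof.
move=> x0; rewrite -subr_ge0.
pose f (t : R) := t - sin t.
have -> : 0 = f 0 by rewrite /f sin0 subrr.
apply: (@derive_ge0_le f (fun t => 1 - cos t)) => //.
Qed.

Lemma cos_ge_quadratic x : 1 - x ^+ 2 / 2 <= cos x.
Proof.
wlog x0 : x / 0 <= x => [h|].
  by have [/h//|/ltW x0] := leP 0 x; rewrite -cosN -sqrrN; apply: h; rewrite oppr_ge0.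
rewrite -subr_ge0.
pose f (t : R) := cos t - (1 - t ^+ 2 / 2).
have -> : 0 = f 0 by rewrite /f cos0 expr0n /= mul0r subr0 subrr.
apply: (@derive_ge0_le f (fun t => t - sin t)) => // t.
  by apply: is_derive_eq; rewrite /GRing.scale /=; field.
by move=> /andP[t0 _]; rewrite subr_ge0 sin_le_id.
Qed.

Lemma sin_ge_cubic x : 0 <= x -> x - x ^+ 3 / 6 <= sin x.
Proof.
move=> x0; rewrite -subr_ge0.
pose f (t : R) := sin t - (t - t ^+ 3 / 6).
have -> : 0 = f 0 by rewrite /f sin0 expr0n /= mul0r subr0 subrr.
apply: (@derive_ge0_le f (fun t => cos t - (1 - t ^+ 2 / 2))) => // t.
  by apply: is_derive_eq; rewrite /GRing.scale /=; field.
by move=> _; rewrite subr_ge0 cos_ge_quadratic.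
Qed.

(** The quartic Taylor bound and x^4 <= x^2 give the coefficient 1/2 - 1/24, of which 1/4 is kept.
    This makes high powers of cos exponentially small away from 0. *)
Lemma cos_le_quadratic x : `|x| <= 1 -> cos x <= 1 - x ^+ 2 / 4.
Proof.
wlog x0 : x / 0 <= x => [h|].
  have [/h//|/ltW x0 x1] := leP 0 x; rewrite -cosN -sqrrN.
  by apply: h; rewrite ?oppr_ge0 ?normrN.
rewrite ger0_norm// => x1.
suff : cos x <= 1 - x ^+ 2 / 2 + x ^+ 4 / 24.
  have : x ^+ 4 <= x ^+ 2 by rewrite ler_wiXn2l.
  by have := sqr_ge0 x; lra.
rewrite -subr_ge0.
pose f (t : R) := 1 - t ^+ 2 / 2 + t ^+ 4 / 24 - cos t.
have -> : 0 = f 0 by rewrite /f cos0 !expr0n /= !mul0r subr0 addr0 subrr.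
apply: (@derive_ge0_le f (fun t => sin t - (t - t ^+ 3 / 6))) => // t.
  by apply: is_derive_eq; rewrite /GRing.scale /=; field.
by move=> /andP[t0 _]; rewrite subr_ge0 sin_ge_cubic.
Qed.

End trig_bounds.

Section antiderivative_cos_odd.
Context {R : realType}.

(* [Gcos n] is the antiderivative of cos ^ (2n+1) vanishing at 0, computed by
   the Wallis reduction formula. *)
Fixpoint Gcos (n : nat) (u : R) : R :=
  if n is n'.+1 then
    (cos u ^+ n.*2 * sin u + n.*2%:R * Gcos n' u) / n.*2.+1%:R
  else sin u.

Lemma is_derive_Gcos n (u : R) : is_derive u 1 (Gcos n) (cos u ^+ n.*2.+1).
Proof.
elim: n => [|n IH] /=; first by rewrite double0 expr1; exact: is_derive_sin.
rewrite doubleS; move: n.*2 IH => m IH.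
have d1 : is_derive u 1 (fun v => cos v ^+ m.+2) (m.+2%:R * cos u ^+ m.+1 * - sin u).
  by have := is_deriveX m.+2 (is_derive_cos u); rewrite exprfctE.
have d2 : is_derive u 1 (fun v => cos v ^+ m.+2 * sin v)
    (cos u ^+ m.+2 * cos u + sin u * (m.+2%:R * cos u ^+ m.+1 * - sin u)).
  exact: is_deriveM.
have d3 : is_derive u 1 (fun v => m.+2%:R * Gcos n v) (m.+2%:R * cos u ^+ m.+1).
  exact: is_deriveZ.
have d4 : is_derive u 1 (fun v => cos v ^+ m.+2 * sin v + m.+2%:R * Gcos n v)
    (cos u ^+ m.+2 * cos u + sin u * (m.+2%:R * cos u ^+ m.+1 * - sin u) +
     m.+2%:R * cos u ^+ m.+1).
  exact: is_deriveD.
rewrite [X in is_derive _ _ X](_ : _ = fun v => m.+3%:R^-1 *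
    (cos v ^+ m.+2 * sin v + m.+2%:R * Gcos n v)); last first.
  by apply/funext => v; rewrite mulrC.
apply: is_derive_eq.
have e := cos2Dsin2 u.
rewrite /GRing.scale /=.
have -> : sin u * (m.+2%:R * cos u ^+ m.+1 * - sin u) =
    - (m.+2%:R * cos u ^+ m.+1 * (1 - cos u ^+ 2)) by rewrite -e; ring.
have m3 : m.+3%:R = m.+2%:R + 1 :> R by rewrite -natr1.
have m0 : 0 <= m.+2%:R :> R by [].
rewrite !(exprS _ m.+2) !(exprS _ m.+1) m3; move: (m.+2%:R) m0 => M M0; field.
by rewrite gt_eqF//; lra.
Qed.

Lemma GcosN n (u : R) : Gcos n (- u) = - Gcos n u.
Proof.
elim: n => [|n IH] /=; first by rewrite sinN.
by rewrite cosN sinN IH !mulrN -opprD mulNr.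
Qed.

Lemma Gcos0 n : Gcos n 0 = 0.
Proof. by elim: n => [|n IH] /=; rewrite ?IH ?mulr0 ?addr0 sin0 ?mulr0 ?mul0r. Qed.

(** At pi/2 the boundary term of the reduction formula vanishes, leaving a product of factors
    2j/(2j+1). A polynomial lower bound is enough, since the errors it will divide are exponentially
    small. *)
Lemma Gcos_pihalf_ge n : (n.*2.+1%:R)^-1 <= Gcos n (pi / 2).
Proof.
elim: n => [|n IH] /=; first by rewrite sin_pihalf invr1.
rewrite cos_pihalf expr0n doubleS /= mul0r add0r.
apply: le_trans (ler_wpM2r _ (ler_wpM2l _ IH)); rewrite ?invr_ge0//.
rewrite ler_peMl ?invr_ge0// ler_pdivlMr ?mul1r ?ler_nat//.
Qed.

End antiderivative_cos_odd.

Section step_approximation.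
Context {R : realType}.

Lemma pihalf_gt1 : 1 < pi / 2 :> R.
Proof.
have := cos_ge_quadratic (pi / 2 : R); rewrite cos_pihalf => h.
have /andP[p0 _] := pihalf_02 R.
have [//|p1] := ltP 1 (pi / 2 : R).
have : (pi / 2 : R) ^+ 2 <= 1 by apply: exprn_ile1 => //; exact: ltW.
by lra.
Qed.

Lemma Gcos_le n (s t : R) : - (pi / 2) <= s -> s <= t -> t <= pi / 2 ->
  Gcos n s <= Gcos n t.
Proof.
move=> s0 st t1.
apply: (@derive_ge0_le _ _ (fun v => cos v ^+ n.*2.+1)) => // v; first exact: is_derive_Gcos.
move=> /andP[sv vt]; apply: exprn_ge0; apply: cos_ge0_pihalf.
by rewrite (le_trans s0 sv) (le_trans vt t1).
Qed.

(** On [r, pi/2] the derivative cos^(2n+1) is at most its value at r, and the interval is shorter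
    than 2. *)
Lemma Gcos_tail n (r t : R) : 0 <= r -> r <= t -> t <= 1 ->
  Gcos n (pi / 2) - Gcos n t <= 2 * cos r ^+ n.*2.+1.
Proof.
move=> r0 rt t1.
have p1 := pihalf_gt1; have /andP[_ p2] := pihalf_02 R.
have cr0 : 0 <= cos r by apply: cos_ge0_pihalf; apply/andP; split; lra.
pose f v := cos r ^+ n.*2.+1 * v - Gcos n v.
have : f t <= f (pi / 2).
  apply: (@derive_ge0_le _ _ (fun v => cos r ^+ n.*2.+1 - cos v ^+ n.*2.+1)).
  - by lra.
  - move=> v; have := is_derive_Gcos n v => ?.
    have d1 : is_derive v 1 (fun v => cos r ^+ n.*2.+1 * v) (cos r ^+ n.*2.+1).
      by apply: is_derive_eq; rewrite /GRing.scale /= mulr1.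
    exact: is_deriveB.
  - move=> v /andP[tv vp]; rewrite subr_ge0; have p0 : 0 < pi :> R := pi_gt0 R.
    apply: lerXn2r; rewrite ?nnegrE//.
      by apply: cos_ge0_pihalf; apply/andP; split; lra.
    have [<-//|rv] := eqVneq r v.
    by apply: ltW; rewrite ltr_cos ?in_itv/= ?lt_neqAle ?rv/=; [lra|apply/andP; split; lra|apply/andP; split; lra].
rewrite /f => h; have := exprn_ge0 n.*2.+1 cr0 => c0; nra.
Qed.

(** [Gcos n] divided by its value at pi/2 is an odd, smoothed sign function. Within [r] of the jump
    the error is trivially at most 1; beyond it the tail bound is divided by a normalisation of at
    least 1/(2n+1). *)
Lemma step_approx n (r t : R) : 0 <= r <= 1 -> `|t| <= 1 ->
  `|(t < 0)%R%:R - (1 - Gcos n t / Gcos n (pi / 2)) / 2| <=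
  (`|t| < r)%R%:R + n.*2.+1%:R * cos r ^+ n.*2.+1.
Proof.
move=> /andP[r0 r1] t1.
have p1 := pihalf_gt1; have /andP[_ p2] := pihalf_02 R.
have cr0 : 0 <= cos r by apply: cos_ge0_pihalf; apply/andP; split; lra.
set c := Gcos n (pi / 2).
have cge : n.*2.+1%:R^-1 <= c := Gcos_pihalf_ge n.
have c0 : 0 < c by apply: lt_le_trans cge; rewrite invr_gt0 ltr0n.
wlog t0 : t t1 / 0 <= t => [h|].
  have [t0|] := boolP (0 <= t); [exact: h t1 t0|rewrite -ltNge => t0].
  have := h (- t); rewrite !normrN oppr_ge0 (ltW t0) => /(_ t1 isT).
  rewrite GcosN t0 (_ : (- t < 0) = false); last by rewrite oppr_lt0 ltNge (ltW t0).
  apply: le_trans; rewrite -[leRHS]normrN le_eqVlt; apply/orP; left; apply/eqP.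
  congr (`|_|); rewrite /= mulr0n mulr1n; by field; rewrite gt_eqF.
rewrite ltNge t0 /= sub0r normrN; rewrite ger0_norm// in t1 *.
have Gc : Gcos n t <= c by apply: Gcos_le; lra.
have G0 : 0 <= Gcos n t.
  by rewrite -(Gcos0 n); apply: Gcos_le; lra.
have S1 : Gcos n t / c <= 1 by rewrite ler_pdivrMr// mul1r.
have S0 : 0 <= Gcos n t / c by rewrite divr_ge0// ltW.
rewrite ger0_norm; last by apply: divr_ge0 => //; lra.
have E0 : 0 <= n.*2.+1%:R * cos r ^+ n.*2.+1 by rewrite mulr_ge0// exprn_ge0.
have [tr|rt] := ltP t r; first by rewrite mulr1n; lra.
rewrite mulr0n add0r.
have -> : (1 - Gcos n t / c) / 2 = c^-1 * ((c - Gcos n t) / 2) by field; rewrite gt_eqF.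
have := Gcos_tail n r0 rt t1; rewrite -/c => h.
apply: ler_pM; rewrite ?invr_ge0 ?(ltW c0)//.
- by rewrite divr_ge0// subr_ge0.
- by rewrite -[leRHS]invrK lef_pV2// posrE ?invr_gt0 ?ltr0n.
- by lra.
Qed.

Lemma cos_pow_le_expR (r : R) m : 0 <= r <= 1 ->
  cos r ^+ m <= expR (- (r ^+ 2 / 4 * m%:R)).
Proof.
move=> /andP[r0 r1].
have p1 := pihalf_gt1.
have cr0 : 0 <= cos r by apply: cos_ge0_pihalf; apply/andP; split; lra.
rewrite -mulNr [X in expR X]mulrC expRM_natl lerXn2r ?nnegrE ?expR_ge0//.
apply: le_trans (expR_ge1Dx _); apply: cos_le_quadratic; by rewrite ger0_norm.
Qed.

End step_approximation.

(** * Integrals of bounded functions and a substitute for the Wiener algebra *)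

Section bounded_integral.
Context {R : realType} (mu : {measure set (measurableTypeR R) -> \bar R}).
Hypothesis mufin : (mu setT < +oo)%E.
Implicit Types f g : measurableTypeR R -> R.

Definition bmeas f := measurable_fun setT f /\ exists M, forall x, `|f x| <= M.

Lemma bmeas_integrable f : bmeas f -> mu.-integrable setT (EFin \o f).
Proof.
move=> [mf [M fM]]; apply: measurable_bounded_integrable => //.
by exists M; split; [exact: num_real|move=> x Mx y _; exact: le_trans (fM _) (ltW Mx)].
Qed.

Lemma bmeas_cst c : bmeas (fun=> c).
Proof. by split; [exact: measurable_cst|exists `|c|]. Qed.

Lemma bmeasD f g : bmeas f -> bmeas g -> bmeas (fun x => f x + g x).
Proof.
move=> [mf [M fM]] [mg [N gN]]; split; first exact: measurable_funD.
by exists (M + N) => x; rewrite (le_trans (ler_normD _ _))// lerD.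
Qed.

Lemma bmeasM f g : bmeas f -> bmeas g -> bmeas (fun x => f x * g x).
Proof.
move=> [mf [M fM]] [mg [N gN]]; split; first exact: measurable_funM.
by exists (M * N) => x; rewrite normrM ler_pM.
Qed.

Lemma bmeas_cos z al : bmeas (fun x => cos (z * x + al)).
Proof.
split; last by exists 1 => x; exact: cos_max.
apply: continuous_measurable_fun => x; apply: continuous_comp; last exact: continuous_cos.
by apply: cvgD; [apply: cvgM; [exact: cvg_cst|exact: cvg_id]|exact: cvg_cst].
Qed.

Lemma bmeas_indic A : measurable A -> bmeas (\1_A).
Proof.
move=> mA; split; first exact: measurable_indic.
by exists 1 => x; rewrite indicE; case: (_ \in _); rewrite ?normr0 ?normr1.
Qed.

Local Notation I f := (\int[mu]_x f x).

Lemma RintD f g : bmeas f -> bmeas g -> I (fun x => f x + g x) = I f + I g.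
Proof. by move=> bf bg; apply: RintegralD => //; exact: bmeas_integrable. Qed.

Lemma RintZ c f : bmeas f -> I (fun x => c * f x) = c * I f.
Proof. by move=> bf; apply: RintegralZl => //; exact: bmeas_integrable. Qed.

Lemma le_Rint f g : bmeas f -> bmeas g -> (forall x, f x <= g x) -> I f <= I g.
Proof. by move=> bf bg fg; apply: le_Rintegral => //; exact: bmeas_integrable. Qed.

Lemma Rint_cst c : I (fun=> c) = c * fine (mu setT).
Proof. exact: Rintegral_cst. Qed.

Lemma Rint_indic A : measurable A -> I (\1_A) = fine (mu A).
Proof. by move=> mA; rewrite /Rintegral integral_indic// setIT. Qed.

Lemma bmeas_norm f : bmeas f -> bmeas (fun x => `|f x|).
Proof.
move=> [mf [M fM]]; split; first exact: measurableT_comp.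
by exists M => x; rewrite normr_id.
Qed.

Lemma norm_Rint_le f g : bmeas f -> bmeas g -> (forall x, `|f x| <= g x) ->
  `|I f| <= I g.
Proof.
move=> bf bg fg; apply: le_trans (le_normr_Rintegral _ (bmeas_integrable bf)) _ => //.
by apply: le_Rint => //; exact: bmeas_norm.
Qed.

Lemma bmeas_sum (J : Type) (s : seq J) (F : J -> measurableTypeR R -> R) :
  (forall j, bmeas (F j)) -> bmeas (fun x => \sum_(j <- s) F j x).
Proof.
move=> bF; elim: s => [|j s IH].
  by under eq_fun do rewrite big_nil; exact: bmeas_cst.
by under eq_fun do rewrite big_cons; exact: bmeasD.
Qed.

Lemma Rint_sum (J : Type) (s : seq J) (F : J -> measurableTypeR R -> R) :
  (forall j, bmeas (F j)) ->
  I (fun x => \sum_(j <- s) F j x) = \sum_(j <- s) I (F j).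
Proof.
move=> bF; elim: s => [|j s IH].
  by under eq_Rintegral do rewrite big_nil; rewrite Rint_cst mul0r big_nil.
under eq_Rintegral do rewrite big_cons.
by rewrite RintD ?IH ?big_cons//; exact: bmeas_sum.
Qed.

(** One real quantity for both parts of the transform at angular frequency [z]: the cosine part for
    phase 0, the sine part for -pi/2. General phases absorb translations. *)
Definition cosint (z al : R) : R := I (fun x => cos (z * x + al)).

Lemma norm_cosint_le z al : `|cosint z al| <= fine (mu setT).
Proof.
rewrite -[leRHS]mul1r -Rint_cst; apply: norm_Rint_le; first exact: bmeas_cos.
  exact: bmeas_cst.
by move=> x; exact: cos_max.
Qed.

(* A substitute for the norm of [f] in the algebra of absolutely convergent
   Fourier series with frequencies of modulus at most [K]. *)
Definition wiener_bound f (A K : R) := bmeas f /\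
  forall z M, (forall y al, `|y - z| <= K -> `|cosint y al| <= M) ->
  forall al, `|I (fun x => f x * cos (z * x + al))| <= A * M.

Lemma wiener_bound1 : wiener_bound (fun=> 1) 1 0.
Proof.
split; first exact: bmeas_cst.
move=> z M h al; rewrite mul1r; under eq_Rintegral do rewrite mul1r.
by apply: h; rewrite subrr normr0.
Qed.

(** By the product-to-sum formula, multiplying by a cosine averages two integrals whose frequencies
    are shifted by 1 up and down, so [A] does not grow. *)
Lemma wiener_bound_cos f A K a : 0 <= A -> wiener_bound f A K ->
  wiener_bound (fun x => f x * cos (x - a)) A (K + 1).
Proof.
move=> A0 [bf h]; split.
  by apply: bmeasM => //; have := bmeas_cos 1 (- a); under eq_fun do rewrite mul1r.
move=> z M hM al.
have bc y be : bmeas (fun x => f x * cos (y * x + be)) by apply: bmeasM => //; exact: bmeas_cos.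
have -> : I (fun x => f x * cos (x - a) * cos (z * x + al)) =
    2^-1 * (I (fun x => f x * cos ((z + 1) * x + (al - a))) +
            I (fun x => f x * cos ((z - 1) * x + (al + a)))).
  rewrite -RintD// -RintZ; last exact: bmeasD.
  apply: eq_Rintegral => x _.
  have -> : (z + 1) * x + (al - a) = (z * x + al) + (x - a) by ring.
  have -> : (z - 1) * x + (al + a) = (z * x + al) - (x - a) by ring.
  by move: (z * x + al) (x - a) => u v; rewrite (cosD u v) (cosB u v); field.
have h1 : `|I (fun x => f x * cos ((z + 1) * x + (al - a)))| <= A * M.
  apply: h => y be yz; apply: hM; have := ler_normD (y - (z + 1)) 1.
  by rewrite (_ : y - (z + 1) + 1 = y - z) ?normr1; [lra|ring].
have h2 : `|I (fun x => f x * cos ((z - 1) * x + (al + a)))| <= A * M.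
  apply: h => y be yz; apply: hM; have := ler_normB (y - (z - 1)) 1.
  by rewrite (_ : y - (z - 1) - 1 = y - z) ?normr1; [lra|ring].
move: h1 h2; set u := Rintegral _ _ _; set v := Rintegral _ _ _ => h1 h2.
rewrite normrM ger0_norm ?invr_ge0//; have := ler_normD u v; lra.
Qed.

Lemma wiener_bound_mono f A K K' : K <= K' ->
  wiener_bound f A K -> wiener_bound f A K'.
Proof.
move=> KK' [bf h]; split=> // z M hM al.
by apply: h => y be yz; apply: hM; exact: le_trans KK'.
Qed.

Lemma wiener_bound_comb f g A B K c e : wiener_bound f A K -> wiener_bound g B K ->
  wiener_bound (fun x => c * f x + e * g x) (`|c| * A + `|e| * B) K.
Proof.
move=> [bf hf] [bg hg].
have bZ c' f' : bmeas f' -> bmeas (fun x => c' * f' x).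
  by move=> b'; apply: bmeasM => //; exact: bmeas_cst.
split; first by apply: bmeasD; exact: bZ.
move=> z M hM al.
have bc f' : bmeas f' -> bmeas (fun x => f' x * cos (z * x + al)).
  by move=> b'; apply: bmeasM => //; exact: bmeas_cos.
have -> : I (fun x => (c * f x + e * g x) * cos (z * x + al)) =
    c * I (fun x => f x * cos (z * x + al)) + e * I (fun x => g x * cos (z * x + al)).
  rewrite -(RintZ c (bc _ bf)) -(RintZ e (bc _ bg)) -RintD; [|by apply: bZ; exact: bc|by apply: bZ; exact: bc].
  by apply: eq_Rintegral => x _; ring.
apply: le_trans (ler_normD _ _) _; rewrite !normrM mulrDl -!mulrA.
by apply: lerD; apply: ler_wpM2l => //; [exact: hf|exact: hg].
Qed.

Lemma wiener_bound_cosX n a : wiener_bound (fun x => cos (x - a) ^+ n) 1 n%:R.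
Proof.
elim: n => [|n IH].
  by under eq_fun do rewrite expr0; exact: wiener_bound1.
under eq_fun do rewrite exprSr; rewrite -natr1.
exact: wiener_bound_cos.
Qed.

(** The Wallis recursion is an average: its coefficients 1/(2n+3) and (2n+2)/(2n+3) add up to 1, so
    the bound 1 persists while the frequencies grow with the degree. *)
Lemma wiener_bound_Gcos n a : wiener_bound (fun x => Gcos n (x - a)) 1 n.*2.+1%:R.
Proof.
have sinE (x : R) : sin (x - a) = cos (x - (a + pi / 2)).
  by rewrite opprD addrA cosBpihalf.
elim: n => [|n IH] /=.
  under eq_fun do rewrite sinE -[cos _]mul1r.
  have := wiener_bound_cos (a + pi / 2) ler01 wiener_bound1.
  by rewrite add0r double0.
have h1 : wiener_bound (fun x => cos (x - a) ^+ n.+1.*2 * sin (x - a)) 1 n.+1.*2.+1%:R.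
  under eq_fun do rewrite sinE.
  by have := wiener_bound_cos (a + pi / 2) ler01 (wiener_bound_cosX n.+1.*2 a); rewrite natr1.
have h2 : wiener_bound (fun x => Gcos n (x - a)) 1 n.+1.*2.+1%:R.
  by apply: wiener_bound_mono IH; rewrite ler_nat doubleS; lia.
have := wiener_bound_comb (n.+1.*2.+1%:R^-1) (n.+1.*2%:R / n.+1.*2.+1%:R) h1 h2.
rewrite !mulr1 !ger0_norm ?divr_ge0 ?invr_ge0//.
rewrite (_ : _^-1 + _ / _ = 1); last first.
  by rewrite -[X in X + _]mul1r -mulrDl nat1r mulfV// pnatr_eq0.
rewrite (_ : (fun x => _) = (fun x : measurableTypeR R =>
  (cos (x - a) ^+ n.+1.*2 * sin (x - a) + n.+1.*2%:R * Gcos n (x - a)) / n.+1.*2.+1%:R))//.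
apply/funext => x.
by rewrite [RHS]mulrDl; congr (_ + _); [exact: mulrC|exact: mulrAC].
Qed.

End bounded_integral.

(** * Fourier decay of the restriction of nu to a half-line *)

Section fourier_decay_restriction.
Context {R : realType} (nu : probability (measurableTypeR R) R).
Variables (C s : R).
Hypotheses (C0 : 0 <= C) (s01 : 0 < s <= 1).
Hypothesis nu01 : nu `[0, 1]%classic = 1%E.
Hypothesis decay : forall y al, 1 <= `|y| -> `|cosint nu y al| <= C * `|y| `^ (- s).

Let nufin : (nu setT < +oo)%E.
Proof. by rewrite probability_setT ltry. Qed.

Let nuT : fine (nu setT) = 1.
Proof. by rewrite probability_setT. Qed.

Local Notation I f := (\int[nu]_x f x).

Let decay_mono y t al : 1 <= t -> t <= `|y| -> `|cosint nu y al| <= C * t `^ (- s).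
Proof.
move=> t1 ty; have [s0 s1] := andP s01.
apply: le_trans (decay _ (le_trans t1 ty)) _; apply: ler_wpM2l => //.
rewrite !powRN lef_pV2 ?posrE ?powR_gt0 ?(lt_le_trans _ (le_trans t1 ty)) ?(lt_le_trans _ t1)//.
by rewrite ge0_ler_powR ?nnegrE ?(ltW s0) ?(le_trans _ t1).
Qed.

Lemma sum_sqr_cos_sin (L : nat) (v : R) :
  (\sum_(i < L) cos (i%:R * v)) ^+ 2 + (\sum_(i < L) sin (i%:R * v)) ^+ 2 =
  \sum_(i < L) \sum_(j < L) cos ((i%:R - j%:R) * v).
Proof.
rewrite !expr2 !big_distrlr /= -big_split; apply: eq_bigr => i _ /=.
by rewrite -big_split; apply: eq_bigr => j _ /=; rewrite mulrBl cosB.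
Qed.

Lemma dist_natr_ge1 (i j : nat) : i != j -> 1 <= `|i%:R - j%:R| :> R.
Proof.
wlog ij : i j / (i < j)%N => [h|_].
  by rewrite neq_ltn => /orP[ij|ij]; [|rewrite distrC]; apply: h; rewrite // ltn_eqF.
by rewrite distrC -natrB ?(ltnW ij)// normr_nat ler1n subn_gt0.
Qed.

Lemma sumr_const_ord (L : nat) (x : R) : \sum_(i < L) x = x * L%:R.
Proof. by rewrite sumr_const card_ord mulr_natr. Qed.

(* The Fejer kernel [`|\sum_(i < L) exp(sqrt(-1) * i * L * (x - a))|^2 / L^2] is
   bounded below on the interval, and its integral is controlled by [decay]. *)
Lemma frostman_bound (L : nat) (a : R) : (0 < L)%N ->
  fine (nu [set x | `|x - a| <= (L%:R ^+ 2)^-1]) <= 4 * (L%:R^-1 + C * L%:R `^ (- s)).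
Proof.
move=> L0; set A := [set x | _].
have L1 : 1 <= L%:R :> R by rewrite ler1n.
have L0' : 0 < L%:R :> R by rewrite ltr0n.
have mA : measurable (A : set (measurableTypeR R)).
  have -> : A = `[a - (L%:R ^+ 2)^-1, a + (L%:R ^+ 2)^-1]%classic.
    by apply/seteqP; split=> x; rewrite /A /= in_itv /= ler_distl.
  exact: measurable_itv.
pose F (x : measurableTypeR R) := \sum_(i < L) \sum_(j < L)
   cos (((i%:R - j%:R) * L%:R) * x + - ((i%:R - j%:R) * L%:R * a)).
have FE x : F x = \sum_(i < L) \sum_(j < L) cos ((i%:R - j%:R) * (L%:R * (x - a))).
  by apply: eq_bigr => i _; apply: eq_bigr => j _; congr cos; ring.
have bF : bmeas F by apply: bmeas_sum => i; apply: bmeas_sum => j; exact: bmeas_cos.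
have le1 : I (fun x => L%:R ^+ 2 / 4 * \1_A x) <= I F.
  apply: (le_Rint nufin) => //.
    by apply: bmeasM; [exact: bmeas_cst|exact: bmeas_indic].
  move=> x; rewrite FE -sum_sqr_cos_sin indicE.
  have [xA|_] := boolP (x \in A); last by rewrite mulr0 addr_ge0 ?sqr_ge0.
  rewrite mulr1 -[leLHS]addr0 lerD ?sqr_ge0//.
  rewrite (_ : L%:R ^+ 2 / 4 = (L%:R / 2) ^+ 2); last by field.
  (* On the interval every argument is at most L * L / L^2 = 1 in modulus, so every cosine is at
     least 1/2. *)
  have cosge : L%:R / 2 <= \sum_(i < L) cos (i%:R * (L%:R * (x - a))).
    rewrite mulrC -sumr_const_ord; apply: ler_sum => i _.
    apply: le_trans (cos_ge_quadratic _).
    suff : (i%:R * (L%:R * (x - a))) ^+ 2 <= 1 by lra.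
    rewrite -real_normK ?num_real// exprn_ile1// normrM normrM !normr_nat.
    move: xA; rewrite inE /A /= => xA.
    apply: (@le_trans _ _ (L%:R * (L%:R * (L%:R ^+ 2)^-1))).
      rewrite ler_pM ?mulr_ge0// ?ler_nat ?(ltnW (ltn_ord i))// ler_wpM2l//.
    by rewrite mulrA -expr2 mulfV// expf_neq0// gt_eqF.
  have L20 : 0 <= L%:R / 2 :> R by rewrite divr_ge0.
  by apply: lerXn2r => //; rewrite nnegrE; exact: le_trans cosge.
have le2 : I F <= L%:R ^+ 2 * (L%:R^-1 + C * L%:R `^ (- s)).
  rewrite (Rint_sum nufin)//; last by move=> i; apply: bmeas_sum => j; exact: bmeas_cos.
  apply: (@le_trans _ _ (\sum_(i < L) \sum_(j < L) ((i == j)%:R + C * L%:R `^ (- s)))).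
    apply: ler_sum => i _; rewrite (Rint_sum nufin)//; last by move=> j; exact: bmeas_cos.
    apply: ler_sum => j _; rewrite -/(cosint _ _ _); apply: le_trans (ler_norm _) _.
    (* Each of the L diagonal terms gives at most the total mass 1; off the diagonal the frequency
       is at least L. *)
    have [<-|ij] := eqVneq i j.
      apply: le_trans (norm_cosint_le nufin _ _) _.
      by rewrite nuT lerDl mulr_ge0// powR_ge0.
    rewrite add0r; apply: decay_mono => //.
    by rewrite normrM [`|L%:R|]ger0_norm// ler_peMl// dist_natr_ge1.
  rewrite le_eqVlt; apply/orP; left; apply/eqP.
  under eq_bigr => i _.
    rewrite big_split /= (bigD1 i)//= eqxx big1 => [|j /negbTE ji]; last by rewrite eq_sym ji.
    rewrite addr0 sumr_const_ord mulr1n; over.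
  rewrite sumr_const_ord; field.
  by rewrite gt_eqF.
move: (le_trans le1 le2); rewrite (RintZ nufin); last exact: bmeas_indic.
rewrite Rint_indic// => h.
rewrite -(@ler_pM2l _ (L%:R ^+ 2 / 4)) ?divr_gt0 ?exprn_gt0//.
apply: le_trans h _; rewrite le_eqVlt; apply/orP; left; apply/eqP; field.
by rewrite gt_eqF.
Qed.

Let ind_lt (a : R) : measurableTypeR R -> R := fun x => (x < a)%R%:R.

Lemma bmeas_ind_lt a : bmeas (ind_lt a).
Proof.
rewrite (_ : ind_lt a = \1_(`]-oo, a[%classic : set (measurableTypeR R))).
  by apply: bmeas_indic; exact: measurable_itv.
by apply/funext => x; rewrite indicE mem_setE in_itv.
Qed.

Lemma natr_double1 n : n.*2.+1%:R = 2 * n%:R + 1 :> R.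
Proof. by rewrite -natr1 -mul2n natrM. Qed.

Lemma Gcos_pihalf_gt0 n : 0 < Gcos n (pi / 2) :> R.
Proof. by apply: lt_le_trans (Gcos_pihalf_ge n); rewrite invr_gt0 ltr0n. Qed.

(** The constant function contributes 1/2 and [Gcos] at most (2n+1)/2, its normalisation being at
    least 1/(2n+1). *)
Lemma wiener_bound_step n a :
  wiener_bound nu (fun x => (1 - Gcos n (x - a) / Gcos n (pi / 2)) / 2) n.+1%:R n.*2.+1%:R.
Proof.
set c := Gcos n (pi / 2); have c0 : 0 < c := Gcos_pihalf_gt0 n.
have := wiener_bound_comb nufin 2^-1 (- (2 * c)^-1)
  (wiener_bound_mono (ler0n R n.*2.+1) (wiener_bound1 nu)) (wiener_bound_Gcos nufin n a).
rewrite (_ : (fun x => _) = (fun x : measurableTypeR R => (1 - Gcos n (x - a) / c) / 2)); last first.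
  by apply/funext => x; field; rewrite gt_eqF.
move=> [bf h]; split=> // z M hM al; apply: le_trans (h _ _ hM al) _.
have M0 : 0 <= M by apply: le_trans (hM z 0 _); rewrite // subrr normr0.
apply: ler_wpM2r => //; rewrite !mulr1 normrN !ger0_norm ?invr_ge0 ?mulr_ge0 ?(ltW c0)//.
have : c^-1 <= n.*2.+1%:R.
  by rewrite -[leRHS]invrK lef_pV2 ?posrE ?invr_gt0 ?ltr0n//; exact: Gcos_pihalf_ge.
rewrite invfM natr_double1 -[n.+1%:R]natr1; lra.
Qed.

(* The indicator function of [x < a] is replaced by an affine image of [Gcos],
   whose frequencies are at most [`|z| / 2]. The error is exponentially small
   away from [a], and [frostman_bound] controls it near [a]. *)
Lemma cosint_lt_bound (L : nat) (a z al : R) : (0 < L)%N -> 0 <= a <= 1 ->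
  6 * L%:R ^+ 5 <= `|z| ->
  `|I (fun x => ind_lt a x * cos (z * x + al))| <=
  (L ^ 5).+1%:R * (C * (`|z| / 2) `^ (- s)) + (4 * (L%:R^-1 + C * L%:R `^ (- s))
   + (L ^ 5).*2.+1%:R * cos ((L%:R ^+ 2)^-1) ^+ (L ^ 5).*2.+1).
Proof.
move=> L0 /andP[a0 a1] zL.
have L1 : 1 <= L%:R :> R by rewrite ler1n.
have L0' : 0 < L%:R :> R by rewrite ltr0n.
set n := (L ^ 5)%N; set r := (L%:R ^+ 2)^-1.
have r0 : 0 < r by rewrite invr_gt0 exprn_gt0.
have r1 : r <= 1 by rewrite invf_le1 ?exprn_gt0// exprn_ege1.
have L51 : 1 <= L%:R ^+ 5 :> R by rewrite exprn_ege1.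
set E := _ * cos r ^+ _.
pose f (x : measurableTypeR R) := (1 - Gcos n (x - a) / Gcos n (pi / 2)) / 2.
have [bf wf] := wiener_bound_step n a; rewrite -/f in bf wf.
have bi := bmeas_ind_lt a.
have bc := bmeas_cos z al.
have bN : bmeas (fun x => ind_lt a x - f x).
  apply: bmeasD => //; under eq_fun do rewrite -mulN1r.
  by apply: bmeasM => //; exact: bmeas_cst.
have [_ [B hB]] := bN.
have -> : I (fun x => ind_lt a x * cos (z * x + al)) =
    I (fun x => f x * cos (z * x + al)) + I (fun x => (ind_lt a x - f x) * cos (z * x + al)).
  rewrite -(RintD nufin); [|exact: bmeasM|exact: bmeasM].
  by apply: eq_Rintegral => x _; ring.
apply: le_trans (ler_normD _ _) _; apply: lerD.
  (* The frequencies that occur differ from [z] by at most 2 L^5 + 1 <= 3 L^5 <= |z|/2, so they stay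
     above |z|/2. *)
  apply: wf => y be yz; apply: decay_mono; first by lra.
  have := ler_normD (y - z) (- y); rewrite normrN addrAC subrr sub0r normrN => h.
  have : n.*2.+1%:R <= `|z| / 2.
    rewrite natr_double1 /n natrX; lra.
  by lra.
pose A : set (measurableTypeR R) := [set x | `|x - a| <= r].
have mA : measurable A.
  have -> : A = `[a - r, a + r]%classic.
    by apply/seteqP; split=> x; rewrite /A /= in_itv /= ler_distl.
  exact: measurable_itv.
(* Outside [0, 1] the distance to [a] may exceed 1, where [step_approx] says nothing. The crude
   bound [B] suffices there because [nu] gives this set no mass. *)
pose U : set (measurableTypeR R) := ~` `[0, 1]%classic.
have mU : measurable U by apply: measurableC; exact: measurable_itv.
have nuU : fine (nu U) = 0.
  by rewrite /U probability_setC ?nu01 ?subee//; exact: measurable_itv.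
have bAE : bmeas (fun x => \1_A x + E).
  by apply: bmeasD; [exact: bmeas_indic|exact: bmeas_cst].
have bBU : bmeas (fun x => B * \1_U x).
  by apply: bmeasM; [exact: bmeas_cst|exact: bmeas_indic].
have cr0 : 0 <= cos r.
  have : r ^+ 2 <= 1 by apply: exprn_ile1 => //; exact: ltW.
  by have := cos_ge_quadratic r; lra.
have E0 : 0 <= E by rewrite mulr_ge0// exprn_ge0.
apply: (@le_trans _ _ (I (fun x => (\1_A x + E) + B * \1_U x))).
  apply: (norm_Rint_le nufin); [exact: bmeasM|exact: bmeasD|].
  move=> x; rewrite normrM; apply: le_trans (_ : `|ind_lt a x - f x| <= _).
    by rewrite ler_piMr// cos_max.
  have [xU|xU] := boolP (x \in U).
    rewrite [\1_U x]indicE xU mulr1; apply: le_trans (hB x) _.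
    by rewrite lerDr addr_ge0// indicE.
  rewrite [\1_U x]indicE (negbTE xU) mulr0 addr0.
  have /andP[x0 x1] : 0 <= x <= 1.
    by move: xU; rewrite /U notin_setE /= => /contrapT; rewrite in_itv.
  have := @step_approx R n r (x - a) _ _; rewrite subr_lt0 -/(f x) -/(ind_lt a x) => h.
  apply: le_trans (h _ _) _; rewrite ?(ltW r0) ?r1// ?ler_norml; first by apply/andP; split; lra.
  rewrite lerD2r indicE; case: (ltP `|x - a| r) => // xar.
  by rewrite /A mem_set//= ltW.
rewrite (RintD nufin)// (RintD nufin); [|exact: bmeas_indic|exact: bmeas_cst].
rewrite (RintZ nufin B (bmeas_indic mU)).
rewrite !Rint_indic// nuU mulr0 addr0 Rint_cst nuT mulr1 lerD2r.
exact: frostman_bound.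
Qed.

Let powN_le (u v e : R) : 0 < u -> u <= v -> 0 <= e -> v `^ (- e) <= u `^ (- e).
Proof.
move=> u0 uv e0; have v0 := lt_le_trans u0 uv.
by rewrite !powRN lef_pV2 ?posrE ?powR_gt0// ge0_ler_powR ?nnegrE ?(ltW u0) ?(ltW v0).
Qed.

Let powN_le1 (u e f : R) : 1 <= u -> e <= f -> u `^ (- f) <= u `^ (- e).
Proof. by move=> u1 ef; rewrite ler_powR// lerN2. Qed.

(** With r = L^(-2) and an exponent near 2 L^5, the bound exp(-r^2 m / 4) is about exp(-L/2). The
    Taylor term of degree 6 of exp(L/2) beats the factor L^5 by one power of L, whence 2^6 6! in
    [B]. *)
Lemma exp_tail_le : exists2 B : R, 0 < B & forall L : nat, (0 < L)%N ->
  (L ^ 5).*2.+1%:R * cos ((L%:R ^+ 2)^-1) ^+ (L ^ 5).*2.+1 <= 3 * B / L%:R :> R.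
Proof.
set B : R := 2 ^+ 6 * (6`!)%:R.
have B0 : 0 < B by rewrite /B mulr_gt0 ?exprn_gt0// ltr0n fact_gt0.
exists B => // L L0; have L1 : 1 <= L%:R :> R by rewrite ler1n.
have L0' : 0 < L%:R :> R by rewrite ltr0n.
set r := (L%:R ^+ 2)^-1; set m := (L ^ 5).*2.+1.
have r01 : 0 <= r <= 1.
  by rewrite invr_ge0 exprn_ge0//= invf_le1 ?exprn_gt0// exprn_ege1.
have L51 : 1 <= L%:R ^+ 5 :> R by rewrite exprn_ege1.
have mE : m%:R = 2 * L%:R ^+ 5 + 1 :> R by rewrite natr_double1 natrX.
have e1 : cos r ^+ m <= expR (- (L%:R / 2)).
  apply: le_trans (cos_pow_le_expR m r01) _; rewrite ler_expR lerN2 mE.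
  have -> : L%:R / 2 = r ^+ 2 / 4 * (2 * L%:R ^+ 5).
    by rewrite /r; field; rewrite gt_eqF.
  rewrite ler_wpM2l//; first by rewrite divr_ge0// sqr_ge0.
  by lra.
have e2 : L%:R ^+ 6 / B <= expR (L%:R / 2 : R).
  have := @expR_ge1Dxn R (L%:R / 2) 5; rewrite divr_ge0// => /(_ isT).
  apply: le_trans; rewrite (_ : L%:R ^+ 6 / B = (L%:R / 2) ^+ 6 / (6`!)%:R); last first.
    by rewrite /B [in RHS]exprMn [2^-1 ^+ 6]exprVn invfM mulrA.
  by rewrite lerDr.
clearbody B.
have e3 : expR (- (L%:R / 2)) <= B / L%:R ^+ 6 :> R.
  rewrite expRN -[leRHS]invf_div lef_pV2 ?posrE ?expR_gt0//.
  by rewrite divr_gt0// exprn_gt0.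
apply: (@le_trans _ _ ((3 * L%:R ^+ 5) * (B / L%:R ^+ 6))).
  apply: ler_pM => //.
  - by apply: exprn_ge0; have /andP[? ?] := r01; have := cos_ge_quadratic r; nra.
  - by rewrite mE; lra.
  - exact: le_trans e3.
rewrite le_eqVlt; apply/orP; left; apply/eqP; field.
by rewrite gt_eqF.
Qed.

Let powN_half (u : R) : 0 < u -> (u / 2) `^ (- s) <= 2 * u `^ (- s).
Proof.
move=> u0; rewrite powRM ?(ltW u0)//.
have -> : 2^-1 `^ (- s) = 2 `^ s :> R by rewrite -powR_inv1// -powRrM mulN1r opprK.
rewrite mulrC; apply: ler_wpM2r; first exact: powR_ge0.
have [s0 s1] := andP s01.
by apply: ler1_powR => //; rewrite ler1n.
Qed.

(** L is taken of order |z|^(s/10). The polynomial cost L^5 is then at most |z|^(s/2), half of the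
    available decay, and the slowest remaining term L^(-s) is of order |z|^(-s^2/10). *)
Lemma cosint_lt_decay : exists2 K : R, 0 <= K &
  forall a z al : R, 0 <= a <= 1 -> 1 <= `|z| ->
  `|I (fun x => ind_lt a x * cos (z * x + al))| <= K * `|z| `^ (- (s ^+ 2 / 10)).
Proof.
have [B B0 exp_tail] := exp_tail_le.
(* 44 = 8 + 36: the terms free of [C] and [B] add up to 8 at high frequencies, and 36 covers |z| <
   36 through the trivial bound 1. *)
exists (12 * C + 44 + 6 * B).
  by rewrite !addr_ge0// mulr_ge0// ltW.
move=> a z al a01; have [s0 s1] := andP s01; have bound L := @cosint_lt_bound L a z al.
move: (`|z| : R) bound => x bound x1.
have x0 : 0 < x by lra.
pose t := x `^ (s / 10); pose T := t `^ (- s).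
have -> : x `^ (- (s ^+ 2 / 10)) = T.
  by rewrite /T /t -powRrM; congr (_ `^ _); ring.
have t1 : 1 <= t.
  apply: (@le_trans _ _ (1 `^ (s / 10))); first by rewrite powR1.
  by rewrite ge0_ler_powR ?nnegrE ?divr_ge0//; lra.
have t0 : 0 < t by lra.
have T0 : 0 < T by rewrite powR_gt0.
have tT : t^-1 <= T by rewrite -powR_inv1 ?(ltW t0)// powN_le1.
have BT : 0 < B * T by exact: mulr_gt0.
have CT : 0 <= C * T by rewrite mulr_ge0// ltW.
have [x36|x36] := ltP x 36.
  apply: (@le_trans _ _ 1).
    apply: (@le_trans _ _ (I (fun=> 1))); last by rewrite Rint_cst nuT mulr1.
    apply: (norm_Rint_le nufin); [|exact: bmeas_cst|].
      by apply: bmeasM; [exact: bmeas_ind_lt|exact: bmeas_cos].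
    move=> y; rewrite normrM ger0_norm /ind_lt; last by case: (y < a).
    by case: (y < a); rewrite ?mul1r ?mul0r ?cos_max ?normr0.
  have : t <= 36.
    apply: le_trans (ltW x36); rewrite -[leRHS]powRr1 ?(ltW x0)//.
    by rewrite ler_powR//; lra.
  move=> t36; have tV : 36^-1 <= t^-1 by rewrite lef_pV2 ?posrE.
  by lra.
pose L := Num.truncn t.
have /andP[Lt tL] : L%:R <= t < L.+1%:R by rewrite truncn_itv// ltW.
have L0 : (0 < L)%N by rewrite lt0n; apply/eqP => L0; move: tL; rewrite L0; lra.
have L1 : 1 <= L%:R :> R by rewrite ler1n.
have tL2 : t <= 2 * L%:R by move: tL; rewrite -natr1; lra.
have t10 : t ^+ 10 = x `^ s.
  by rewrite -powR_mulrn ?(ltW t0)// /t -powRrM divfK.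
have t5 : t ^+ 5 = x `^ (s / 2).
  by rewrite -powR_mulrn ?(ltW t0)// /t -powRrM; congr (_ `^ _); field.
have L5 : L%:R ^+ 5 <= t ^+ 5 by rewrite lerXn2r ?nnegrE ?(ltW t0).
(* L^5 is at most |z|^(1/2), so |z|^(1/2) >= 6 is enough; this is the origin of the threshold 36. *)
have zL : 6 * L%:R ^+ 5 <= x.
  have xh : x = x `^ (1 / 2) * x `^ (1 / 2).
    rewrite -powRD ?(gt_eqF x0) ?implybT//.
    by rewrite (_ : 1 / 2 + 1 / 2 = 1) ?powRr1 ?(ltW x0)//; field.
  have x6 : 6 <= x `^ (1 / 2).
    have : 0 <= x `^ (1 / 2) by exact: powR_ge0.
    by move: xh; move: (x `^ (1 / 2)) => y xy y0; nra.
  rewrite [leRHS]xh ler_pM ?exprn_ge0//; apply: le_trans L5 _.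
  by rewrite t5 ler_powR//; lra.
apply: le_trans (bound L L0 a01 zL) _.
have b1 : (L ^ 5).+1%:R * (C * (x / 2) `^ (- s)) <= 4 * (C * T).
  have -> : 4 * (C * T) = (2 * t ^+ 5) * (C * (2 * (t ^- 5 * T))).
    by field; rewrite gt_eqF.
  have t51 : 1 <= t ^+ 5 by rewrite exprn_ege1.
  apply: ler_pM; rewrite ?mulr_ge0 ?powR_ge0//.
    by rewrite -natr1 natrX; lra.
  apply: ler_wpM2l => //.
  apply: le_trans (powN_half x0) _; apply: ler_wpM2l => //.
  rewrite powRN -t10 -[10%N]/(5 + 5)%N exprD invfM ler_wpM2l ?invr_ge0 ?exprn_ge0 ?(ltW t0)//.
  by apply: le_trans tT; rewrite lef_pV2 ?posrE ?exprn_gt0// ler_eXnr.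
have b2 : L%:R^-1 <= 2 * T.
  apply: (@le_trans _ _ (2 * t^-1)); last by lra.
  by rewrite -[leRHS]invrK invfM invrK lef_pV2 ?posrE ?mulr_gt0 ?invr_gt0 ?ltr0n//; lra.
have b3 : L%:R `^ (- s) <= 2 * T.
  apply: le_trans (powN_half t0).
  by apply: powN_le; [exact: divr_gt0|lra|exact: ltW].
have b5 : 3 * B / L%:R <= 6 * (B * T).
  by have := ler_wpM2l (ltW B0) b2; lra.
have b6 : C * L%:R `^ (- s) <= C * (2 * T) by rewrite ler_wpM2l.
have b4 := exp_tail L L0.
have b7 := lerD b1 (lerD (ler_wpM2l (ler0n R 4) (lerD b2 b6)) (le_trans b4 b5)).
apply: le_trans b7 _.
have -> : (12 * C + 44 + 6 * B) * T =
  4 * (C * T) + (4 * (2 * T + C * (2 * T)) + 6 * (B * T)) + 36 * T by ring.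
by rewrite lerDl mulr_ge0// ltW.
Qed.

End fourier_decay_restriction.

(** * The L^p-dimension and its monotonicity in p *)

Section limn_einf_facts.
Context {R : realType}.
Implicit Types u v : (\bar R)^nat.

Lemma limn_einf_sup_einfs u : limn_einf u = ereal_sup (range (einfs u)).
Proof. by rewrite limn_einf_lim; apply/cvg_lim => //; exact: cvg_einfs_sup. Qed.

Lemma le_limn_einf u v : (forall n, (u n <= v n)%E) -> (limn_einf u <= limn_einf v)%E.
Proof.
move=> uv; rewrite !limn_einf_sup_einfs; apply: ge_ereal_sup => _ [n _ <-].
apply: (@le_trans _ _ (einfs v n)); last by apply: ereal_sup_ubound; exists n.
apply: le_ereal_inf_tmp => _ [k nk <-]; apply: (@le_trans _ _ (u k)) => //.
by apply: ereal_inf_lbound; exists k.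
Qed.

Lemma lt_limn_einf u x : (x < limn_einf u)%E ->
  exists N, forall n, (N <= n)%N -> (x < u n)%E.
Proof.
rewrite limn_einf_sup_einfs => /ereal_sup_gt[_ [N _ <-] xN]; exists N => n Nn.
by apply: lt_le_trans xN _; apply: ereal_inf_lbound; exists n.
Qed.

End limn_einf_facts.

Section power_means.
Context {R : realType} (J : finType) (a : J -> R).
Hypotheses (a0 : forall i, 0 <= a i) (a1 : \sum_i a i = 1).

Lemma sum_powR_gt0 (p : R) : 0 < \sum_i a i `^ p.
Proof.
rewrite lt_neqAle sumr_ge0 ?andbT => [|i _]; last exact: powR_ge0.
rewrite eq_sym psumr_neq0 => [|i _]; last exact: powR_ge0.
have : \sum_i a i != 0 by rewrite a1 oner_neq0.
rewrite psumr_neq0//; apply: sub_has => i /= ai.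
by rewrite powR_gt0.
Qed.

(** Jensen's inequality for the probability weights [a i] and the concave power t = (p-1)/(q-1),
    applied to a_i^(q-1). Concavity enters as Bernoulli's inequality at the mean [S]. *)
Lemma ln_sum_powR_le (p q : R) : 1 < p -> p <= q ->
  ln (\sum_i a i `^ p) / (p - 1) <= ln (\sum_i a i `^ q) / (q - 1).
Proof.
move=> p1 pq; have p10 : 0 < p - 1 by lra.
have q10 : 0 < q - 1 by lra.
set S := \sum_i a i `^ q; have S0 : 0 < S by exact: sum_powR_gt0.
set t := (p - 1) / (q - 1).
have t01 : 0 < t <= 1 by rewrite divr_gt0//= ler_pdivrMr// mul1r; lra.
have [t0 _] := andP t01.
have aE r i : 0 < r -> a i `^ r = a i * a i `^ (r - 1).
  by move=> r0; rewrite mulr_powRB1.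
have le1 : \sum_i a i `^ p <= S `^ t.
  have -> : \sum_i a i `^ p = S `^ t * \sum_i a i * (a i `^ (q - 1) / S) `^ t.
    rewrite mulr_sumr; apply: eq_bigr => i _.
    have qt : (q - 1) * t = p - 1 by rewrite /t mulrC divfK// gt_eqF.
    have SV : S^-1 `^ t = (S `^ t)^-1.
      by rewrite -powR_inv1 ?(ltW S0)// -powRrM mulN1r powRN.
    rewrite powRM ?powR_ge0 ?invr_ge0 ?(ltW S0)// -powRrM qt SV aE; last by lra.
    by field; rewrite gt_eqF ?powR_gt0.
  rewrite ler_piMr ?powR_ge0//.
  apply: (@le_trans _ _ (\sum_i (t / S * a i `^ q + (1 - t) * a i))).
    apply: ler_sum => i _.
    have z0 : 0 <= a i `^ (q - 1) / S by rewrite divr_ge0 ?powR_ge0 ?ltW.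
    have := ler_wpM2l (a0 i) (powR_bernoulli t01 z0).
    move=> /le_trans; apply; rewrite (aE q) ?le_eqVlt; last by lra.
    by apply/orP; left; apply/eqP; ring.
  rewrite big_split /= -!mulr_sumr a1 mulr1 -/S divfK ?gt_eqF//; lra.
rewrite ler_pdivrMr// mulrAC -mulrA -/t mulrC -ln_powR ler_ln ?posrE ?powR_gt0//.
exact: sum_powR_gt0.
Qed.

End power_means.

Section Lp_dimension.
Context {R : realType} (b : nat) (nu : probability (measurableTypeR R) R).
Hypothesis b2 : (2 <= b)%N.

Definition cell_mass n (u : n.-tuple 'I_b) : R := fine (nu (bitv R u)).

Hypothesis mass1 : forall n, \sum_(u : n.-tuple 'I_b) cell_mass u = 1.

Lemma cell_mass_ge0 n (u : n.-tuple 'I_b) : 0 <= cell_mass u.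
Proof. exact: fine_ge0. Qed.

Let lnb : 0 < ln b%:R :> R.
Proof. by rewrite ln_gt0// ltr1n. Qed.

Lemma Lp_dimE (p : R) : Lp_dim b nu p = limn_einf (fun n =>
  (- ln (\sum_(u : n.-tuple 'I_b) cell_mass u `^ p) / (n%:R * (p - 1) * ln b%:R))%:E).
Proof.
congr (limn_einf _); apply/funext => n.
rewrite (_ : (\sum_(u : n.-tuple 'I_b) nu (bitv R u) `^ p)%E =
  (\sum_(u : n.-tuple 'I_b) cell_mass u `^ p)%:E); last first.
  rewrite -sumEFin; apply: eq_bigr => u _; rewrite -poweR_EFin /cell_mass fineK//.
  by apply: fin_num_measure; exact: measurable_itv.
by rewrite lne_EFin -?EFinN -?EFinM// sum_powR_gt0// => u; exact: cell_mass_ge0.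
Qed.

Lemma Lp_dim_nonincreasing (p q : R) : 1 < p -> p <= q ->
  (Lp_dim b nu q <= Lp_dim b nu p)%E.
Proof.
move=> p1 pq; rewrite !Lp_dimE; apply: le_limn_einf => n; rewrite lee_fin.
have := ln_sum_powR_le (@cell_mass_ge0 n) (mass1 n) p1 pq.
rewrite !mulNr lerN2 [_ * (p - 1)]mulrC [_ * (q - 1)]mulrC -!mulrA !invfM !mulrA.
by move=> h; do 2 (rewrite ler_wpM2r ?invr_ge0 ?(ltW lnb)//).
Qed.

(** By monotonicity the limit is a supremum, so a number strictly below it lies strictly below the
    dimension at some exponent, and then at all smaller ones. *)
Lemma lim_Lp_dim : lim (Lp_dim b nu p @[p --> (1 : R)^'+]) =
  ereal_sup [set Lp_dim b nu p | p in `]1, +oo[%classic].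
Proof.
apply/cvg_lim => //.
have := @nonincreasing_at_right_cvge R (Lp_dim b nu) 1 +oo%O isT; apply.
move=> p q; rewrite !in_itv /= !andbT => p1 q1 pq.
exact: Lp_dim_nonincreasing.
Qed.

Lemma Lp_dim_gt_sum (p c : R) : 1 < p -> (c%:E < Lp_dim b nu p)%E ->
  exists2 K : R, 0 <= K & forall n, \sum_(u : n.-tuple 'I_b) cell_mass u `^ p <=
    K * expR (- (c * (p - 1) * ln b%:R)) ^+ n.
Proof.
move=> p1; rewrite Lp_dimE => /lt_limn_einf[N hN].
set beta := expR _; have beta0 : 0 < beta by exact: expR_gt0.
pose S n := \sum_(u : n.-tuple 'I_b) cell_mass u `^ p.
have S0 n : 0 < S n by apply: sum_powR_gt0 => // u; exact: cell_mass_ge0.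
(* The lower limit controls only n >= N; the other levels are absorbed in the constant. Level 0 is
   always among them, so n > 0 in the remaining case. *)
exists (1 + \sum_(n < N.+1) S n / beta ^+ n).
  rewrite addr_ge0// sumr_ge0// => n _; rewrite divr_ge0 ?exprn_ge0 ?(ltW beta0)//.
  exact: ltW.
move=> n; rewrite -/(S n) mulrDl mul1r; have bn : 0 < beta ^+ n by rewrite exprn_gt0.
have sum0 : 0 <= \sum_(n < N.+1) S n / beta ^+ n.
  by apply: sumr_ge0 => i _; rewrite divr_ge0 ?exprn_ge0 ?(ltW beta0) ?(ltW (S0 _)).
have [nN|Nn] := ltnP n N.+1.
  apply: (@le_trans _ _ (S n / beta ^+ n * beta ^+ n)); first by rewrite divfK ?gt_eqF.
  apply: ler_wpDl; first exact: ltW.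
  rewrite ler_pM2r// (bigD1 (Ordinal nN))//= lerDl sumr_ge0// => i _.
  by rewrite divr_ge0 ?exprn_ge0 ?(ltW beta0) ?(ltW (S0 _)).
apply: (@le_trans _ _ (beta ^+ n)); last by rewrite lerDl mulr_ge0// ltW.
have := hN n (ltnW Nn); rewrite lte_fin -/(S n).
have n0 : 0 < n%:R :> R by rewrite ltr0n; exact: leq_trans Nn.
have p10 : 0 < p - 1 by lra.
rewrite ltr_pdivlMr ?mulr_gt0// => h.
rewrite -[S n]lnK ?posrE// /beta -expRM_natl ler_expR; lra.
Qed.

End Lp_dimension.

(** * Moments of the weight at exponents near 1 *)

Section moment_expansion.
Context {R : realType}.
Implicit Types w z h a : R.

Lemma expR_le_quadratic_pos z : 0 <= z -> expR z <= 1 + z + z ^+ 2 * expR z.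
Proof.
move=> z0; have e0 := expR_gt0 z.
have [z1|z1] := leP 1 z.
  have : expR z <= z ^+ 2 * expR z by rewrite ler_peMl ?(ltW e0)// exprn_ege1.
  by lra.
have h : expR z * (1 - z) <= 1.
  have := expR_ge1Dx (- z); rewrite expRN => /(ler_wpM2l (ltW e0)).
  by rewrite mulfV ?gt_eqF.
by move: (expR z) e0 h => E E0 h; nra.
Qed.

Lemma expR_le_quadratic_neg z : z <= 0 -> expR z <= 1 + z + z ^+ 2.
Proof.
move=> z0; have e0 := expR_gt0 z.
have h : expR z * (1 - z) <= 1.
  have := expR_ge1Dx (- z); rewrite expRN => /(ler_wpM2l (ltW e0)).
  by rewrite mulfV ?gt_eqF.
by move: (expR z) e0 h => E E0 h; nra.
Qed.

Lemma sqr_le_expR z : 0 <= z -> z ^+ 2 <= 2 * expR z.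
Proof.
move=> z0; have := expR_ge1Dxn 1 z0; rewrite (_ : (2`!)%:R = 2)//.
have := sqr_ge0 z; lra.
Qed.

Lemma powR_ln w h : 0 < w -> w `^ h = expR (h * ln w).
Proof. by move=> w0; rewrite /powR gt_eqF. Qed.

(** Second-order expansion of w exp(h ln w) in [h]. For w >= 1 the factor (ln w)^2 costs a multiple
    of w^a and w^h is at most w^a, hence the exponent 1 + 2a. For 0 < w < 1 the remainder is
    controlled by w (ln w)^2 <= 2. *)
Lemma powR_moment_taylor w h a : 0 <= w -> 0 < h -> h <= a ->
  w `^ (1 + h) <= w + h * (w * ln w) +
    h ^+ 2 * ((2 / a ^+ 2 + 2) * (1 + w `^ (1 + 2 * a))).
Proof.
move=> w0 h0 ha; have a0 : 0 < a by lra.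
have C0 : 0 <= 2 / a ^+ 2 by rewrite divr_ge0// sqr_ge0.
have P0 : 0 <= w `^ (1 + 2 * a) by exact: powR_ge0.
have h20 : 0 <= h ^+ 2 by exact: sqr_ge0.
have [->|wn0] := eqVneq w 0.
  rewrite ln0// !powR0 ?mulr0 ?add0r; [|lra|lra].
  by rewrite mulr_ge0// mulr_ge0//; lra.
have {w0 wn0} w0 : 0 < w by rewrite lt_neqAle eq_sym wn0.
set y := ln w.
have wE : w = expR y by rewrite lnK.
have whE : w `^ (1 + h) = w * expR (h * y).
  by rewrite powRD ?(gt_eqF w0) ?implybT// powRr1 ?(ltW w0)// powR_ln.
rewrite whE.
have [y0|/ltW y0] := leP 0 y.
  have e := expR_le_quadratic_pos (mulr_ge0 (ltW h0) y0).
  apply: le_trans (ler_wpM2l (ltW w0) e) _.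
  have -> : w * (1 + h * y + (h * y) ^+ 2 * expR (h * y)) =
    w + h * (w * y) + h ^+ 2 * (w * (y ^+ 2 * expR (h * y))) by ring.
  rewrite lerD2l ler_wpM2l//.
  apply: (@le_trans _ _ (2 / a ^+ 2 * w `^ (1 + 2 * a))); last first.
    by move: C0 P0; move: (2 / a ^+ 2) (w `^ _) => c P ? ?; nra.
  rewrite powR_ln// -/y (_ : (1 + 2 * a) * y = y + (a * y + a * y)); last by ring.
  rewrite !expRD -wE [leRHS]mulrCA ler_pM2l// [leRHS]mulrA ler_pM ?expR_ge0 ?sqr_ge0//; last first.
    by rewrite ler_expR ler_wpM2r.
  have := sqr_le_expR (mulr_ge0 (ltW a0) y0).
  by rewrite exprMn [2 / _ * _]mulrAC ler_pdivlMr ?exprn_gt0// mulrC.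
have e := expR_le_quadratic_neg (mulr_ge0_le0 (ltW h0) y0).
apply: le_trans (ler_wpM2l (ltW w0) e) _.
have -> : w * (1 + h * y + (h * y) ^+ 2) =
  w + h * (w * y) + h ^+ 2 * (w * y ^+ 2) by ring.
rewrite lerD2l ler_wpM2l//; apply: (@le_trans _ _ 2).
  have := @sqr_le_expR (- y); rewrite oppr_ge0 sqrrN expRN -wE => /(_ y0).
  by move=> y2; rewrite mulrC -ler_pdivlMr.
by move: C0 P0; move: (2 / a ^+ 2) (w `^ _) => c P ? ?; nra.
Qed.

Lemma norm_xlnx_le w a : 0 <= w -> 0 < a -> `|w * ln w| <= 1 + a^-1 * w `^ (1 + 2 * a).
Proof.
move=> w0 a0; have P0 : 0 <= w `^ (1 + 2 * a) by exact: powR_ge0.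
have C0 : 0 <= a^-1 * w `^ (1 + 2 * a) by rewrite mulr_ge0// invr_ge0 ltW.
have [->|wn0] := eqVneq w 0; first by rewrite mul0r normr0 powR0; lra.
have {w0 wn0} w0 : 0 < w by rewrite lt_neqAle eq_sym wn0.
set y := ln w; have wE : w = expR y by rewrite lnK.
have [y0|/ltW y0] := leP 0 y.
  rewrite ger0_norm ?mulr_ge0 ?(ltW w0)//.
  apply: (@le_trans _ _ (a^-1 * w `^ (1 + 2 * a))); last by lra.
  rewrite powR_ln// -/y (_ : (1 + 2 * a) * y = y + 2 * a * y); last by ring.
  rewrite expRD -wE [leRHS]mulrCA ler_pM2l// mulrC ler_pdivlMr//.
  have := expR_ge1Dx (2 * a * y); have := mulr_ge0 (ltW a0) y0; lra.
rewrite ler0_norm ?mulr_ge0_le0 ?(ltW w0)//.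
apply: (@le_trans _ _ 1); last by lra.
have := expR_ge1Dx (- y); rewrite expRN -wE => h.
have : w * (1 - y) <= 1 by rewrite mulrC -ler_pdivlMr// div1r.
lra.
Qed.

Lemma powR_le_1D w p q : 0 <= w -> 0 < p -> p <= q -> w `^ p <= 1 + w `^ q.
Proof.
move=> w0 p0 pq; have [w1|/ltW w1] := leP w 1.
  apply: (@le_trans _ _ 1); last by rewrite lerDl powR_ge0.
  by apply: (@le_trans _ _ (1 `^ p)); [rewrite ge0_ler_powR ?nnegrE ?(ltW p0)|rewrite powR1].
by apply: ler_wpDl => //; rewrite ler_powR.
Qed.

End moment_expansion.

Section weight_moments.
Context {R : realType} {d0 : measure_display} {Omega0 : measurableType d0}
  {P0 : probability Omega0 R} {W0 : {RV P0 >-> R}} {delta : R}.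
Hypotheses (hW0 : random_weight W0) (hdelta : 0 < delta)
  (hmom : ('E_P0[(fun x => W0 x `^ (1 + delta))%R] < +oo)%E).

Let V x : R := Num.max (W0 x) 0.

Let V0 x : 0 <= V x.
Proof. by rewrite /V le_max lexx orbT. Qed.

Let mV : measurable_fun setT V.
Proof. by apply: measurable_maxr => //; exact: measurable_funPT. Qed.

Let mVp p : measurable_fun setT (fun x => V x `^ p).
Proof. exact: (measurableT_comp (measurable_powR p)). Qed.

(** [ln] is 0 at nonpositive reals, which also realises the convention 0 log 0 = 0. *)
Lemma xlnx_pos x : W0 x * ln (W0 x) = V x * ln (V x).
Proof.
rewrite /V; case: (leP (W0 x) 0) => // w0.
by rewrite ln0// mulr0 mul0r.
Qed.

Let iVd : P0.-integrable setT (EFin \o (fun x => V x `^ (1 + delta))).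
Proof.
apply/integrableP; split; first exact/measurable_EFinP.
apply: le_lt_trans hmom; rewrite unlock.
apply: ge0_le_integral => //.
- by apply/measurable_EFinP; apply: measurableT_comp => //; exact: mVp.
- by apply/measurable_EFinP; apply: (measurableT_comp (measurable_powR _)); exact: measurable_funPT.
move=> x _ /=; rewrite lee_fin ger0_norm ?powR_ge0// /V.
case: (leP (W0 x) 0) => // _; rewrite powR0 ?powR_ge0//.
by rewrite gt_eqF// ltr_wpDl.
Qed.

Let icst (c : R) : P0.-integrable setT (EFin \o (fun=> c)).
Proof. exact: finite_measure_integrable_cst. Qed.

Lemma integral_pos_weight : (\int[P0]_x (V x)%:E = 1)%E.
Proof.
have [W0ae _ <-] := hW0; rewrite unlock; apply: ae_eq_integral => //.
- exact/measurable_EFinP.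
- by apply/measurable_EFinP; exact: measurable_funPT.
by apply: filterS W0ae => x W0x _; rewrite /V; case: (leP (W0 x) 0) => // h; rewrite (le_anti (introT andP (conj h W0x))).
Qed.

Let iV : P0.-integrable setT (EFin \o V).
Proof.
apply/integrableP; split; first exact/measurable_EFinP.
under eq_integral => x _ do rewrite /= ger0_norm//.
by rewrite integral_pos_weight ltry.
Qed.

Let mln : measurable_fun setT (fun x => V x * ln (V x)).
Proof. by apply: measurable_funM => //; apply: (measurableT_comp (@measurable_ln R)). Qed.

Let iVln : P0.-integrable setT (EFin \o (fun x => V x * ln (V x))).
Proof.
have a0 : 0 < delta / 2 by rewrite divr_gt0.
apply: (@le_integrable _ _ _ _ _ measurableT _ (EFin \o (fun x => 1 + (delta / 2)^-1 * V x `^ (1 + delta)))).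
- exact/measurable_EFinP.
- move=> x _ /=; rewrite lee_fin [leRHS]ger0_norm; last first.
    by rewrite addr_ge0// mulr_ge0 ?invr_ge0 ?powR_ge0// ltW.
  by have := norm_xlnx_le (V0 x) a0; rewrite [2 * _]mulrC divfK.
- rewrite /comp; under eq_fun do rewrite EFinD EFinM.
  by apply: integrableD => //; [exact: (icst 1)|exact: (integrableZl measurableT _ iVd)].
Qed.

Lemma entropy_fin : ('E_P0[(fun x => W0 x * ln (W0 x))%R] =
  (\int[P0]_x (V x * ln (V x)))%R%:E)%E.
Proof.
rewrite unlock /Rintegral fineK.
  by apply: eq_integral => x _; rewrite xlnx_pos.
exact: integrable_fin_num.
Qed.

(** [powR_moment_taylor] is integrated with a = delta/2, so that 1 + 2a is the exponent of the
    assumed moment. The mean being 1, the entropy appears as the first-order coefficient. *)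
Lemma moment_expansion : exists2 K : R, 0 <= K &
  forall h : R, 0 < h -> h <= delta / 2 -> exists m : R,
    (\int[P0]_x (V x `^ (1 + h))%:E = m%:E)%E /\
    m <= 1 + h * \int[P0]_x (V x * ln (V x)) + h ^+ 2 * K.
Proof.
pose C : R := 2 / (delta / 2) ^+ 2 + 2.
have C0 : 0 <= C by rewrite addr_ge0// divr_ge0// sqr_ge0.
pose M := \int[P0]_x (V x `^ (1 + delta)).
exists (C * (1 + M)).
  by rewrite mulr_ge0// addr_ge0// Rintegral_ge0// => x _; exact: powR_ge0.
move=> h h0 hd.
have iVh : P0.-integrable setT (EFin \o (fun x => V x `^ (1 + h))).
  apply: (@le_integrable _ _ _ _ _ measurableT _ (EFin \o (fun x => 1 + V x `^ (1 + delta)))).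
  - exact/measurable_EFinP.
  - move=> x _ /=; rewrite lee_fin !ger0_norm ?powR_ge0 ?addr_ge0 ?powR_ge0//.
    by apply: powR_le_1D => //; lra.
  - by rewrite /comp; under eq_fun do rewrite EFinD; exact: (integrableD measurableT (icst 1) iVd).
exists (\int[P0]_x (V x `^ (1 + h))); split.
  by rewrite /Rintegral fineK//; exact: integrable_fin_num.
have i1 : P0.-integrable setT (EFin \o (fun x => h * (V x * ln (V x)))).
  by rewrite /comp; under eq_fun do rewrite EFinM; exact: (integrableZl measurableT _ iVln).
have i2 : P0.-integrable setT (EFin \o (fun x => 1 + V x `^ (1 + delta))).
  by rewrite /comp; under eq_fun do rewrite EFinD; exact: (integrableD measurableT (icst 1) iVd).
have i3 : P0.-integrable setT (EFin \o (fun x => h ^+ 2 * C * (1 + V x `^ (1 + delta)))).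
  by rewrite /comp; under eq_fun do rewrite EFinM; exact: (integrableZl measurableT _ i2).
have i4 : P0.-integrable setT (EFin \o (fun x => V x + h * (V x * ln (V x)))).
  by rewrite /comp; under eq_fun do rewrite EFinD; exact: (integrableD measurableT iV i1).
apply: (@le_trans _ _ (\int[P0]_x (V x + h * (V x * ln (V x)) + h ^+ 2 * C * (1 + V x `^ (1 + delta))))).
  apply: le_Rintegral => //.
    by rewrite /comp; under eq_fun do rewrite EFinD; exact: (integrableD measurableT i4 i3).
  move=> x _; apply: le_trans (powR_moment_taylor (V0 x) h0 hd) _.
  by rewrite [2 * (delta / 2)]mulrC divfK// -/C [h ^+ 2 * (_ * _)]mulrA.
rewrite RintegralD// RintegralD// RintegralZl// RintegralZl// RintegralD//.
have -> : \int[P0]_x (1 : R) = 1 by rewrite /Rintegral integral_cst_prob.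
have -> : \int[P0]_x V x = 1 by rewrite /Rintegral integral_pos_weight.
by rewrite -/M [h ^+ 2 * (_ * _)]mulrA.
Qed.

End weight_moments.

Section choose_exponent.
Context {R : realType} {d0 : measure_display} {Omega0 : measurableType d0}
  {P0 : probability Omega0 R} {W0 : {RV P0 >-> R}} {delta : R} {b : nat}
  {nu : probability (measurableTypeR R) R}.
Hypotheses (b2 : (2 <= b)%N) (hW0 : random_weight W0) (hdelta : 0 < delta)
  (hmom : ('E_P0[(fun x => W0 x `^ (1 + delta))%R] < +oo)%E)
  (mass1 : forall n, \sum_(u : n.-tuple 'I_b) cell_mass nu u = 1)
  (hent : ('E_P0[(fun x => W0 x * ln (W0 x))%R] * ((ln b%:R)^-1)%:E
           < lim (Lp_dim b nu p @[p --> (1 : R)^'+]))%E).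

Lemma lt_real_between (x : R) (y : \bar R) : (x%:E < y)%E ->
  exists2 c : R, x < c & (c%:E < y)%E.
Proof.
case: y => [y| |] //; last by exists (x + 1); rewrite ?ltry//; lra.
rewrite lte_fin => xy; exists ((x + y) / 2); rewrite ?lte_fin; lra.
Qed.

Lemma supercritical_exponent : exists p m beta K : R,
  [/\ 1 < p <= 2, (\int[P0]_x ((Num.max (W0 x) 0) `^ p)%:E = m%:E)%E,
    0 < beta, m * beta < 1 & 0 <= K /\
    forall n, \sum_(u : n.-tuple 'I_b) cell_mass nu u `^ p <= K * beta ^+ n].
Proof.
have lnb : 0 < ln b%:R :> R by rewrite ln_gt0// ltr1n.
have [K K0 moment] := moment_expansion hW0 hdelta hmom.
move: hent; rewrite (entropy_fin hdelta hmom) (lim_Lp_dim b2 mass1) -EFinM.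
move=> /ereal_sup_gt[_ [q /= + <-]]; rewrite in_itv /= andbT => q1.
set e0 := Rintegral _ _ _ => /lt_real_between[c e0c cq].
have gap : 0 < c * ln b%:R - e0 by move: e0c; rewrite ltr_pdivrMr//; lra.
(* p will be 1 + h. The four constraints keep, in order, the dimension at p above c, p at most 2,
   the moment expansion valid, and its second-order term below the entropy gap. [K + 1] keeps the
   divisor positive. *)
pose h := Num.min (Num.min (q - 1) 1) (Num.min (delta / 2) ((c * ln b%:R - e0) / (K + 1) / 2)).
have h0 : 0 < h.
  rewrite /h !lt_min; apply/andP; split; apply/andP; split; rewrite ?divr_gt0//; lra.
have [hq h1] : h <= q - 1 /\ h <= 1.
  by split; rewrite /h ge_min ge_min lexx ?orbT.
have [hd hg] : h <= delta / 2 /\ h <= (c * ln b%:R - e0) / (K + 1) / 2.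
  by split; rewrite /h ge_min [X in _ || X]ge_min lexx ?orbT.
have [m [mE mle]] := moment h h0 hd.
have p1 : 1 < 1 + h by lra.
have cp : (c%:E < Lp_dim b nu (1 + h))%E.
  by apply: lt_le_trans cq _; apply: (Lp_dim_nonincreasing b2 mass1) => //; lra.
have [K' K'0 hK'] := Lp_dim_gt_sum b2 mass1 p1 cp.
exists (1 + h), m, (expR (- (c * (1 + h - 1) * ln b%:R))), K'; split => //.
- by apply/andP; split; lra.
- exact: expR_gt0.
have hK : h * K < c * ln b%:R - e0.
  have : h * (K + 1) <= (c * ln b%:R - e0) / 2.
    by rewrite -ler_pdivlMr; [move: hg; rewrite mulrAC|lra].
  by lra.
have mE2 : m <= expR (h * (e0 + h * K)).
  by apply: le_trans mle _; apply: le_trans (expR_ge1Dx _); rewrite -/e0; lra.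
apply: (@le_lt_trans _ _ (expR (h * (e0 + h * K)) * expR (- (c * (1 + h - 1) * ln b%:R)))).
  by rewrite ler_wpM2r ?expR_ge0.
rewrite -expRD -[ltRHS]expR0 ltr_expR.
have -> : h * (e0 + h * K) + - (c * (1 + h - 1) * ln b%:R) =
  h * (h * K - (c * ln b%:R - e0)) by ring.
by rewrite pmulr_rlt0// subr_lt0.
Qed.

End choose_exponent.

(** * Words and b-adic cells *)

Section words.
Context {b : nat}.
Local Notation word := (seq 'I_b).

Fixpoint words (n : nat) : seq word :=
  if n is n'.+1 then [seq rcons u x | u <- words n', x <- enum 'I_b] else [:: [::]].

Lemma mem_words n u : (u \in words n) = (size u == n).
Proof.
elim: n u => [|n IH] u; first by rewrite inE size_eq0.
apply/allpairsP/eqP => [[[v x] /= [+ _ ->]]|].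
  by rewrite IH size_rcons => /eqP ->.
case/lastP: u => [//|u x]; rewrite size_rcons => -[un].
by exists (u, x); rewrite /= IH un eqxx mem_enum.
Qed.

Lemma words_uniq n : uniq (words n).
Proof.
elim: n => [//|n IH] /=; apply: allpairs_uniq => //; first exact: enum_uniq.
by move=> [u x] [v y] _ _ /= /rcons_inj[-> ->].
Qed.

Lemma big_words_tuple (V : nmodType) (F : word -> V) n :
  \sum_(u : n.-tuple 'I_b) F u = \sum_(u <- words n) F u.
Proof.
transitivity (\sum_(u <- [seq val u | u <- enum {: n.-tuple 'I_b}]) F u).
  by rewrite big_map big_enum.
apply: perm_big; apply: uniq_perm; last 1 first.
- move=> u; rewrite mem_words; apply/mapP/eqP => [[v _ ->]|/eqP un]; first exact: size_tuple.
  by exists (Tuple un); rewrite ?mem_enum.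
- by rewrite map_inj_uniq ?enum_uniq//; exact: val_inj.
- exact: words_uniq.
Qed.

Lemma big_wordsS (V : nmodType) (F : word -> V) n :
  \sum_(v <- words n.+1) F v = \sum_(u <- words n) \sum_(x < b) F (rcons u x).
Proof.
rewrite big_allpairs_dep; apply: eq_bigr => u _.
by rewrite big_enum.
Qed.

(** Nonempty words only, ordered by length: the empty word carries no randomness, and prefixes have
    to precede their extensions. *)
Fixpoint words_upto (n : nat) : seq word :=
  if n is n'.+1 then words_upto n' ++ words n else [::].

Lemma words_uptoS n : words_upto n.+1 = words_upto n ++ words n.+1.
Proof. by []. Qed.

Lemma mem_words_upto n u : (u \in words_upto n) = (0 < size u <= n)%N.
Proof.
elim: n => [|n IH]; first by rewrite in_nil; lia.
by rewrite words_uptoS mem_cat IH mem_words; lia.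
Qed.

Lemma words_upto_uniq n : uniq (words_upto n).
Proof.
elim: n => [//|n IH]; rewrite words_uptoS cat_uniq IH words_uniq andbT andTb.
apply/hasPn => u; rewrite mem_words => /eqP un.
by rewrite /= mem_words_upto un ltnn andbF.
Qed.

(** If the position of [v] falls in an earlier level, induction applies to the truncated list.
    Otherwise [v] has length n + 1 and [s1] already contains all shorter nonempty words. *)
Lemma words_upto_prefix n s1 v s2 : words_upto n = s1 ++ v :: s2 ->
  forall j, (j.+1 < size v)%N -> take j.+1 v \in s1.
Proof.
elim: n s1 v s2 => [|n IH] s1 v s2; first by case: s1.
rewrite words_uptoS => e j jv.
have [lt|ge] := ltnP (size s1) (size (words_upto n)).
  have [k kE] : exists k, (size (words_upto n) - size s1 = k.+1)%N.
    by exists (size (words_upto n) - size s1).-1; rewrite prednK// subn_gt0.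
  have e' : words_upto n = s1 ++ v :: take k s2.
    have := congr1 (take (size (words_upto n))) e.
    by rewrite take_size_cat// take_cat ltnNge (ltnW lt) kE.
  exact: IH e' _ jv.
have e1 : s1 = words_upto n ++ drop (size (words_upto n)) s1.
  rewrite -{1}(cat_take_drop (size (words_upto n)) s1); congr (_ ++ _).
  have := congr1 (take (size (words_upto n))) e.
  by rewrite take_size_cat// takel_cat.
have vn : size v = n.+1.
  have := congr1 (drop (size (words_upto n))) e.
  rewrite drop_size_cat// {1}e1 -catA drop_size_cat// => e2.
  by apply/eqP; rewrite -mem_words e2 mem_cat inE eqxx orbT.
rewrite e1 mem_cat; apply/orP; left; rewrite mem_words_upto size_takel ?(ltnW jv)//.
by move: jv; rewrite vn.
Qed.

End words.

Section cells.
Context {R : realType} {b : nat}.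
Local Notation word := (seq 'I_b).
Hypothesis b2 : (2 <= b)%N.

(** [bpoint] for lists. Digits are read as naturals because ['I_b] offers no default element for a
    variable [b]. *)
Definition wpoint (u : word) : R := \sum_(k < size u) (nth 0%N (map val u) k)%:R / b%:R ^+ k.+1.

Definition wcell (u : word) : set (measurableTypeR R) :=
  `[wpoint u, wpoint u + (b%:R ^+ size u)^-1[%classic.

Lemma measurable_wcell u : measurable (wcell u).
Proof. exact: measurable_itv. Qed.

Lemma bitvE n (u : n.-tuple 'I_b) : bitv R u = wcell u.
Proof.
rewrite /bitv /wcell size_tuple (_ : bpoint R u = wpoint u)//.
rewrite /bpoint /wpoint; have := size_tuple u => e.
rewrite -(big_mkord xpredT (fun k => (nth 0%N (map val u) k)%:R / b%:R ^+ k.+1 : R)) e.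
rewrite big_mkord; apply: eq_bigr => k _.
have x0 : 'I_b by exact: tnth u k.
by rewrite (tnth_nth x0) (nth_map x0)// e.
Qed.

Let bR : 0 < b%:R :> R.
Proof. by rewrite ltr0n; lia. Qed.

Lemma wpoint_rcons u (x : 'I_b) :
  wpoint (rcons u x) = wpoint u + x%:R / b%:R ^+ (size u).+1.
Proof.
rewrite /wpoint size_rcons big_ord_recr /=; congr (_ + _).
  apply: eq_bigr => k _; rewrite map_rcons nth_rcons size_map.
  by have := ltn_ord k => /= ->.
by rewrite map_rcons nth_rcons size_map ltnn eqxx.
Qed.

Lemma sum_unit_steps (m : nat) (y : R) :
  \sum_(x < m) ((x%:R <= y) && (y < x%:R + 1))%R%:R = ((0 <= y) && (y < m%:R))%R%:R :> R.
Proof.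
elim: m => [|m IH].
  by rewrite big_ord0; case: (leP 0 y) => //= y0; rewrite ltNge y0.
rewrite big_ord_recr /= IH natr1.
have [y0|y0] := leP 0 y => /=.
  have [ym|ym] := ltP y m%:R; rewrite ?addr0 ?add0r//=.
    by rewrite (lt_trans ym) ?addr0// ltr_nat.
have [ym|ym] := leP m%:R y => /=; last by rewrite addr0.
by move: (ler0n R m); lra.
Qed.

Lemma indic_wcell u (t : R) : \1_(wcell u) t =
  ((wpoint u <= t) && (t < wpoint u + (b%:R ^+ size u)^-1))%R%:R :> R.
Proof. by rewrite indicE mem_setE in_itv. Qed.

(** Rescaling by b^(size u + 1) turns the subcells into the unit intervals [x, x + 1), which tile
    [0, b). *)
Lemma indic_wcell_rcons u (t : R) :
  \1_(wcell u) t = \sum_(x < b) \1_(wcell (rcons u x)) t :> R.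
Proof.
pose c : R := b%:R ^+ (size u).+1; have c0 : 0 < c by rewrite exprn_gt0.
pose y := (t - wpoint u) * c.
transitivity (\sum_(x < b) ((x%:R <= y) && (y < x%:R + 1))%R%:R : R); last first.
  apply: eq_bigr => x _; rewrite indic_wcell wpoint_rcons size_rcons -/c.
  congr ((_ && _)%:R).
    by rewrite /y -ler_pdivrMr// lerBrDl.
  by rewrite /y -ltr_pdivlMr// ltrBlDl mulrDl mul1r addrA.
rewrite sum_unit_steps indic_wcell; congr ((_ && _)%:R).
  by rewrite /y pmulr_lge0// subr_ge0.
rewrite /y -ltr_pdivlMr// ltrBlDl; congr (_ < _ + _).
by rewrite /c exprS invfM mulrA mulfV ?mul1r// gt_eqF.
Qed.

Lemma sum_indic_wcell n (t : R) :
  \sum_(u <- words n) \1_(wcell u) t = ((0 <= t) && (t < 1))%R%:R :> R.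
Proof.
elim: n => [|n IH].
  by rewrite big_seq1 indic_wcell /wpoint big_ord0 expr0 invr1 add0r.
rewrite big_wordsS -IH; apply: eq_bigr => u _.
by rewrite -indic_wcell_rcons.
Qed.

Lemma wcell_sub (u : word) : 0 <= wpoint u /\ wpoint u + (b%:R ^+ size u)^-1 <= 1 :> R.
Proof.
elim/last_ind: u => [|u x [u0 u1]].
  by rewrite /wpoint big_ord0 expr0 invr1 add0r.
rewrite wpoint_rcons size_rcons; split; first by rewrite addr_ge0// divr_ge0// exprn_ge0.
apply: le_trans u1; rewrite -addrA lerD2l -[X in _ + X]mul1r -mulrDl natr1.
rewrite ler_pdivrMr ?exprn_gt0// exprS mulrCA mulVf ?mulr1 ?ler_nat//.
by rewrite expf_neq0// gt_eqF.
Qed.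

End cells.

(** * The cascade as a sum over words *)

Section cascade_telescope.
Context {R : realType} {d : measure_display} {T : measurableType d}
  {P : probability T R} {b : nat} {W : seq 'I_b -> {RV P >-> R}}.
Local Notation word := (seq 'I_b).
Local Notation posw := (posw (W := W)).
Local Notation wprod := (wprod (W := W)).

Lemma wprod_rcons (u : word) x w :
  wprod (size u).+1 (rcons u x) w = wprod (size u) u w * posw (rcons u x) w.
Proof.
rewrite /wprod big_nat_recr//=; congr (_ * _).
  by apply: eq_big_nat => j ju; rewrite -cats1 takel_cat//; case/andP: ju.
by rewrite take_oversize// size_rcons.
Qed.

Lemma wprod_take k (u : word) x w : (k <= size u)%N ->
  wprod k (rcons u x) w = wprod k u w.
Proof.
move=> ku; apply: eq_big_nat => j /andP[_ jk].
by rewrite -cats1 takel_cat//; exact: leq_trans jk ku.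
Qed.

(** When [a u] is the integral of a function against [nu] over the cell of [u], this is its integral
    against Q_n nu. *)
Definition cascade_sum (a : word -> R) n w := \sum_(u <- words n) wprod n u w * a u.

(** Additivity of [a] refines level n to level n + 1 without new weights, so passing to the weighted
    sum at level n + 1 only adds terms with centred weights. *)
Lemma cascade_sum_telescope (a : word -> R) n w :
  (forall u, a u = \sum_(x < b) a (rcons u x)) ->
  cascade_sum a n w = a [::] +
    \sum_(v <- words_upto n) wprod (size v).-1 v w * (posw v w - 1) * a v.
Proof.
move=> aE; elim: n => [|n IH].
  by rewrite /cascade_sum big_seq1 /wprod big_nil mul1r big_nil addr0.
rewrite words_uptoS big_cat addrA -IH /cascade_sum !big_wordsS -big_split.
rewrite !big_seq; apply: eq_bigr => u; rewrite mem_words => /eqP un.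
rewrite {1}aE mulr_sumr -big_split; apply: eq_bigr => x _ /=.
by rewrite size_rcons /= -un wprod_rcons wprod_take//; ring.
Qed.

End cascade_telescope.

Section integral_set_function.
Context {d : measure_display} {T : measurableType d} {R : realType}.

Import HBNNSimple.

(** [cascade] is a bare set function, to which lemmas on measures do not apply. Its integral depends
    only on its values on measurable sets, where it will coincide with a genuine measure. *)
Lemma eq_integral_measurable_sets (m1 : set T -> \bar R) (m2 : {measure set T -> \bar R})
    (f : T -> \bar R) :
  (forall A, measurable A -> m1 A = m2 A) ->
  (\int[m1]_x f x = \int[m2]_x f x)%E.
Proof.
move=> m12; have eqs (h : {nnsfun T >-> R}) : sintegral m1 h = sintegral m2 h.
  by apply: eq_fsbigr => r _; rewrite m12.
rewrite /integral.
by congr (ereal_sup _ - ereal_sup _)%E; apply/seteqP; split => _ [h hf <-]; exists h; rewrite ?eqs.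
Qed.

Lemma ge0_integral_mrestr (m : {measure set T -> \bar R}) (A : set T)
    (mA : measurable A) (f : T -> \bar R) :
  measurable_fun setT f -> (forall x, 0 <= f x)%E ->
  (\int[mrestr m mA]_x f x = \int[m]_(x in A) f x)%E.
Proof.
move=> mf f0; have mCA := measurableC mA.
rewrite (@ge0_negligible_integral _ _ _ (mrestr m mA) setT (~` A))//; last first.
  by rewrite /= /mrestr setICl measure0.
rewrite setTD setCK; apply: eq_measure_integral => B mB BA.
by rewrite /= /mrestr setIidl.
Qed.

End integral_set_function.

Section cascade_integral.
Context {R : realType} (b : nat) (nu : probability (measurableTypeR R) R).
Local Notation word := (seq 'I_b).

Variables (s : seq word) (x : word -> R).
Hypothesis x0 : forall u, 0 <= x u.

Let m_ (i : nat) : {measure set (measurableTypeR R) -> \bar R} :=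
  mscale (NngNum (x0 (nth [::] s i))) (mrestr nu (measurable_wcell (nth [::] s i))).

Let cell_sum : {measure set (measurableTypeR R) -> \bar R} := msum m_ (size s).

(** On measurable sets the set function equals [cell_sum], a finite sum of scaled restrictions of
    [nu] to cells. *)
Lemma integral_cell_density (f : measurableTypeR R -> R) :
  measurable_fun setT f -> (forall t, 0 <= f t) ->
  (\int[fun A => (\int[nu]_(t in A) (\sum_(u <- s) x u * \1_(wcell u) t)%:E)%E]_t (f t)%:E =
   \sum_(u <- s) (x u)%:E * \int[nu]_t (\1_(wcell u) t * f t)%:E)%E.
Proof.
move=> mf f0; rewrite (eq_integral_measurable_sets (m2 := cell_sum)); last first.
  move=> A mA; rewrite /cell_sum /= /msum.
  under eq_integral do rewrite -sumEFin.
  rewrite ge0_integral_sum//; last 2 first.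
  - by move=> u; apply/measurable_EFinP; apply: measurable_funM => //; apply: measurable_indic; exact: measurable_wcell.
  - by move=> u t _; rewrite lee_fin mulr_ge0// indicE.
  rewrite (big_nth [::]) big_mkord; apply: eq_bigr => i _.
  rewrite /m_ /= /mscale /= /mrestr setIC -integral_indic//; last exact: measurable_wcell.
  rewrite -ge0_integralZl_EFin//.
  - by apply/measurable_EFinP; apply: measurable_indic; exact: measurable_wcell.
rewrite /cell_sum ge0_integral_measure_sum//; last 2 first.
- by move=> t _; rewrite lee_fin.
- exact/measurable_EFinP.
rewrite (big_nth [::]) big_mkord; apply: eq_bigr => i _; rewrite /m_.
have mfE : measurable_fun setT (EFin \o f) by exact/measurable_EFinP.
rewrite (ge0_integral_mscale _ _ _ mfE)//; last by move=> t _; rewrite lee_fin.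
rewrite /= ge0_integral_mrestr//; congr (_ * _)%E.
rewrite integral_mkcond; apply: eq_integral => t _.
by rewrite patchE indicE; case: (_ \in _); rewrite ?mul1r ?mul0r.
Qed.

End cascade_integral.

(** * Fourier dimension in terms of cosine integrals *)

Section cosint_fourier.
Context {R : realType} (mu : {measure set (measurableTypeR R) -> \bar R}).
Hypothesis mufin : (mu setT < +oo)%E.

Lemma cosint_rotate z al :
  cosint mu z al = cos al * cosint mu z 0 - sin al * cosint mu z (- (pi / 2)).
Proof.
rewrite /cosint -mulNr -(RintZ mufin (cos al) (bmeas_cos z 0)).
rewrite -(RintZ mufin (- sin al) (bmeas_cos z (- (pi / 2)))).
rewrite -(RintD mufin); last 2 first.
- by apply: bmeasM; [exact: bmeas_cst|exact: bmeas_cos].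
- by apply: bmeasM; [exact: bmeas_cst|exact: bmeas_cos].
apply: eq_Rintegral => x _.
by rewrite addr0 cosBpihalf cosD mulNr [cos al * _]mulrC [sin al * _]mulrC.
Qed.

Lemma norm_cosint_rotate z al :
  `|cosint mu z al| <= `|cosint mu z 0| + `|cosint mu z (- (pi / 2))|.
Proof.
rewrite cosint_rotate; apply: le_trans (ler_normB _ _) _; rewrite !normrM.
by apply: lerD; rewrite ler_piMl// ?cos_max ?sin_max.
Qed.

Lemma sqnorm_fourierE zeta : sqnorm_fourier mu zeta =
  cosint mu (2 * pi * zeta) 0 ^+ 2 + cosint mu (2 * pi * zeta) (- (pi / 2)) ^+ 2.
Proof.
rewrite /sqnorm_fourier /fourier /ComplexField.Normc.normc sqr_sqrtr; last first.
  by rewrite addr_ge0 ?sqr_ge0.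
rewrite sqrrN; congr (_ ^+ 2 + _ ^+ 2); apply: eq_Rintegral => x _.
  by rewrite addr0.
by rewrite cosBpihalf.
Qed.

Lemma cosintN z al : cosint mu (- z) al = cosint mu z (- al).
Proof. by apply: eq_Rintegral => x _; rewrite -cosN; congr cos; ring. Qed.

Lemma fourier_dim_gt0 (C s : R) : 0 < s ->
  (forall y al, 1 <= y -> `|cosint mu y al| <= C * y `^ (- s)) ->
  0 < fourier_dim mu.
Proof.
move=> s0 h; pose D := Num.min 1 s.
have D0 : 0 < D by rewrite lt_min ltr01.
have [D1 Ds] : D <= 1 /\ D <= s by split; rewrite ge_min lexx ?orbT.
have h' y al : 1 <= `|y| -> `|cosint mu y al| <= C * `|y| `^ (- s).
  have [y0|y0] := leP 0 y; first by rewrite ger0_norm//; exact: h.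
  by rewrite ltr0_norm// => y1; rewrite -[y]opprK cosintN opprK; exact: h.
apply: (lt_le_trans D0); apply: ub_le_sup.
  by exists 1 => E [/andP[_ E1] _].
split; first by rewrite (ltW D0).
exists (2 * C ^+ 2), 1 => zeta z1.
have p1 := @pihalf_gt1 R.
have z0 : 0 < `|zeta| by lra.
have yz : `|zeta| <= `|2 * pi * zeta|.
  rewrite normrM ler_peMl// ger0_norm ?mulr_ge0 ?pi_ge0//.
  have := @pihalf_gt1 R; lra.
have y1 := le_trans z1 yz.
have bound al : cosint mu (2 * pi * zeta) al ^+ 2 <= C ^+ 2 * `|zeta| `^ (- D).
  rewrite -real_normK ?num_real//.
  have := h' _ al y1; set c := `|cosint _ _ _|; set Y := `|_| `^ _ => cC.
  have Y0 : 0 <= Y by exact: powR_ge0.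
  apply: (@le_trans _ _ ((C * Y) ^+ 2)).
    have CY0 : 0 <= C * Y := le_trans (normr_ge0 _) cC.
    by apply: lerXn2r; rewrite ?nnegrE ?normr_ge0.
  rewrite exprMn ler_wpM2l ?sqr_ge0//.
  (* Squaring doubles the decay exponent; only half of it is kept. *)
  apply: (@le_trans _ _ (Y * 1)).
    rewrite expr2 ler_wpM2l//; apply: (@le_trans _ _ (`|2 * pi * zeta| `^ 0)).
      by rewrite ler_powR// oppr_le0 ltW.
    by rewrite powRr0.
  rewrite mulr1 /Y; apply: (@le_trans _ _ (`|2 * pi * zeta| `^ (- D))).
    by rewrite ler_powR// lerN2.
  rewrite !powRN lef_pV2 ?posrE ?powR_gt0 ?(lt_le_trans z0)//.
  by rewrite ge0_ler_powR ?nnegrE ?(ltW D0).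
rewrite sqnorm_fourierE; have := bound 0; have := bound (- (pi / 2)).
lra.
Qed.

End cosint_fourier.

Lemma cosint_decay_of_fourier_dim {R : realType} (nu : probability (measurableTypeR R) R) :
  0 < fourier_dim nu -> exists C s : R, [/\ 0 <= C, 0 < s <= 1 &
    forall y al, 1 <= `|y| -> `|cosint nu y al| <= C * `|y| `^ (- s)].
Proof.
have nufin : (nu setT < +oo)%E by rewrite probability_setT ltry.
have nuT : fine (nu setT) = 1 by rewrite probability_setT.
rewrite /fourier_dim => sup0.
have [D [/andP[_ D1] [C1 [M hM]]] D0] : exists2 D, [set D : R | 0 <= D <= 1 /\
    exists C M : R, forall zeta : R, M <= `|zeta| ->
      sqnorm_fourier nu zeta <= C * `|zeta| `^ (- D)] D & 0 < D.
  move: sup0; set A := [set D | _]; have [->|/set0P A0] := eqVneq A set0.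
    by rewrite sup0 ltxx.
  by move=> /(sup_gt A0).
have p0 : 0 < 2 * pi :> R by rewrite mulr_gt0// pi_gt0.
(* The first summand handles |y| below 2 pi M, where only the trivial bound 1 is known; the second
   comes from the decay of the squared transform. Having C >= 1 gives C <= C^2 when squares are
   compared. *)
pose C := (2 * pi * `|M| + 1) + (2 * `|C1| * (2 * pi) `^ D + 1).
have P0 : 0 <= (2 * pi : R) `^ D by exact: powR_ge0.
have a0 : 0 <= 2 * pi * `|M| by rewrite mulr_ge0// ltW.
have b0 : 0 <= 2 * `|C1| * (2 * pi) `^ D by rewrite mulr_ge0// mulr_ge0.
have C1' : 1 <= C by rewrite /C; lra.
exists C, (D / 2); split; [lra|by apply/andP; split; lra|].
move=> y al y1; have y0 : 0 < `|y| by lra.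
have Y0 : 0 < `|y| `^ (- (D / 2)) by rewrite powR_gt0.
have [My|yM] := leP M `|y / (2 * pi)|.
  have sq := hM _ My; rewrite sqnorm_fourierE// in sq.
  rewrite (_ : 2 * pi * (y / (2 * pi)) = y) in sq; last by rewrite mulrC divfK// gt_eqF.
  have le1 : `|cosint nu y al| ^+ 2 <= (C * `|y| `^ (- (D / 2))) ^+ 2.
    apply: (@le_trans _ _ (2 * (cosint nu y 0 ^+ 2 + cosint nu y (- (pi / 2)) ^+ 2))).
      have h := norm_cosint_rotate nufin y al.
      apply: (@le_trans _ _ ((`|cosint nu y 0| + `|cosint nu y (- (pi / 2))|) ^+ 2)).
        by rewrite lerXn2r ?nnegrE// addr_ge0.
      rewrite -[cosint nu y 0 ^+ 2]real_normK ?num_real//.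
      rewrite -[cosint nu y (- _) ^+ 2]real_normK ?num_real//.
      by have := sqr_ge0 (`|cosint nu y 0| - `|cosint nu y (- (pi / 2))|); lra.
    apply: (@le_trans _ _ (2 * (`|C1| * (`|y| `^ (- D) * (2 * pi) `^ D)))).
      rewrite ler_wpM2l//; apply: le_trans sq _.
      have -> : `|y / (2 * pi)| `^ (- D) = `|y| `^ (- D) * (2 * pi) `^ D.
        rewrite normrM [`|_^-1|]ger0_norm ?invr_ge0 ?(ltW p0)//.
        have tV : (2 * pi)^-1 `^ (- D) = (2 * pi) `^ D :> R.
          by rewrite -powR_inv1 ?(ltW p0)// -powRrM mulN1r opprK.
        have pV0 : 0 <= (2 * pi)^-1 :> R by rewrite invr_ge0 ltW.
        by rewrite (powRM (- D) (normr_ge0 y) pV0) tV.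
      by rewrite ler_wpM2r ?mulr_ge0 ?powR_ge0// ler_norm.
    rewrite exprMn -[(_ `^ (- (D / 2))) ^+ 2]powR_mulrn ?powR_ge0// -powRrM.
    rewrite (_ : - (D / 2) * 2 = - D); last by field.
    rewrite (_ : 2 * (`|C1| * (`|y| `^ (- D) * (2 * pi) `^ D)) =
      2 * `|C1| * (2 * pi) `^ D * `|y| `^ (- D)); last by ring.
    rewrite ler_wpM2r ?powR_ge0//; apply: (@le_trans _ _ C); first by rewrite /C; lra.
    by rewrite expr2 ler_peMl//; lra.
  rewrite -(@ler_pXn2r _ 2) ?nnegrE//.
  by rewrite mulr_ge0 ?(ltW Y0)//; lra.
apply: (@le_trans _ _ 1); first by rewrite -nuT; exact: norm_cosint_le.
rewrite powRN ler_pdivlMr ?powR_gt0// mul1r.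
apply: (@le_trans _ _ `|y|).
  by rewrite -[leRHS]powRr1// ler_powR//; lra.
move: yM; rewrite normrM [`|_^-1|]ger0_norm ?invr_ge0 ?(ltW p0)// ltr_pdivrMr// => yM.
apply: (le_trans (ltW yM)); rewrite mulrC /C.
have : 2 * pi * M <= 2 * pi * `|M| by rewrite ler_pM2l// ler_norm.
lra.
Qed.

(** * Masses and transforms of nu over cells *)

Section cell_integrals.
Context {R : realType} {b : nat} (nu : probability (measurableTypeR R) R).
Local Notation word := (seq 'I_b).
Hypothesis b2 : (2 <= b)%N.

Let nufin : (nu setT < +oo)%E.
Proof. by rewrite probability_setT ltry. Qed.

Definition wmass (u : word) : R := fine (nu (wcell u)).

Definition cellint (z al : R) (u : word) : R :=
  \int[nu]_x (\1_(wcell u) x * cos (z * x + al)).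

Lemma bmeas_wcell (u : word) : bmeas (\1_(wcell u : set (measurableTypeR R))).
Proof. by apply: bmeas_indic; exact: measurable_wcell. Qed.

Lemma bmeas_cellint z al (u : word) :
  bmeas (fun x : measurableTypeR R => \1_(wcell u) x * cos (z * x + al)).
Proof. by apply: bmeasM; [exact: bmeas_wcell|exact: bmeas_cos]. Qed.

Lemma wmassE u : wmass u = \int[nu]_x \1_(wcell u) x.
Proof. by rewrite Rint_indic//; exact: measurable_wcell. Qed.

Lemma wmass_ge0 u : 0 <= wmass u.
Proof. exact: fine_ge0. Qed.

Lemma wmass_le1 u : wmass u <= 1.
Proof.
rewrite -lee_fin /wmass fineK; last by apply: fin_num_measure; exact: measurable_wcell.
by apply: probability_le1; exact: measurable_wcell.
Qed.

Lemma norm_cellint_le z al u : `|cellint z al u| <= wmass u.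
Proof.
rewrite wmassE; apply: (norm_Rint_le nufin); [exact: bmeas_cellint|exact: bmeas_wcell|].
move=> x; have i0 : 0 <= \1_(wcell u) x :> R by rewrite indicE.
by rewrite normrM (ger0_norm i0) ler_piMr// cos_max.
Qed.

Lemma wmass_rcons u : wmass u = \sum_(x < b) wmass (rcons u x).
Proof.
rewrite wmassE; under eq_Rintegral do rewrite (indic_wcell_rcons b2).
rewrite (Rint_sum nufin); last by move=> x; exact: bmeas_wcell.
by apply: eq_bigr => x _; rewrite wmassE.
Qed.

Lemma cellint_rcons z al u : cellint z al u = \sum_(x < b) cellint z al (rcons u x).
Proof.
rewrite /cellint; under eq_Rintegral do rewrite (indic_wcell_rcons b2) mulr_suml.
by rewrite (Rint_sum nufin)// => x; exact: bmeas_cellint.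
Qed.

Variables (C s : R).
Hypotheses (C0 : 0 <= C) (s01 : 0 < s <= 1).
Hypothesis nu01 : nu `[0, 1]%classic = 1%E.
Hypothesis decay : forall y al, 1 <= `|y| -> `|cosint nu y al| <= C * `|y| `^ (- s).

(** [frostman_bound] on shrinking intervals. The cells cover [0, 1) only, so their masses sum to 1
    once the point 1 is known to have mass 0. *)
Lemma no_atom (a : R) : nu [set a] = 0%E.
Proof.
have [s0 s1] := andP s01.
have ma : measurable ([set a] : set (measurableTypeR R)) by exact: measurable_set1.
have fa : nu [set a] \is a fin_num by exact: fin_num_measure.
rewrite -(fineK fa); set v := fine _; apply/eqP; rewrite eqe.
apply/negPn/negP => vn0.
have v0 : 0 < v by rewrite lt_neqAle eq_sym vn0 fine_ge0.
have h (L : nat) : (0 < L)%N -> v * L%:R `^ s <= 4 * (1 + C).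
  move=> L0; have L1 : 1 <= L%:R :> R by rewrite ler1n.
  have L0' : 0 < L%:R :> R by rewrite ltr0n.
  have Ls : 0 < L%:R `^ s :> R by rewrite powR_gt0.
  have : v <= 4 * (L%:R^-1 + C * L%:R `^ (- s)).
    apply: le_trans (frostman_bound C0 s01 decay a L0).
    have mA : measurable ([set x | `|x - a| <= (L%:R ^+ 2)^-1] : set (measurableTypeR R)).
      rewrite (_ : [set x | _] = `[a - (L%:R ^+ 2)^-1, a + (L%:R ^+ 2)^-1]%classic).
        exact: measurable_itv.
      by apply/seteqP; split=> x /=; rewrite in_itv /= ler_distl.
    apply: fine_le => //; first exact: fin_num_measure.
    apply: le_measure; rewrite ?inE// => x /= ->.
    by rewrite subrr normr0 invr_ge0 exprn_ge0.
  have Lle : L%:R^-1 <= L%:R `^ (- s) :> R.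
    by rewrite -powR_inv1 ?(ltW L0')// ler_powR// lerN2.
  move=> hv; rewrite -ler_pdivlMr// -powRN.
  apply: le_trans hv _; rewrite -mulrA ler_wpM2l// mulrDl mul1r lerD2r.
  exact: Lle.
have C4 : 0 < 4 * (1 + C) by rewrite mulr_gt0// ltr_pwDl.
pose L := (Num.truncn ((4 * (1 + C) / v) `^ s^-1)).+1.
have LB : (4 * (1 + C) / v) `^ s^-1 < L%:R by exact: truncnS_gt.
have := h L isT; rewrite leNgt => /negP; apply.
rewrite [ltRHS]mulrC -ltr_pdivrMr//.
have q0 : 0 <= 4 * (1 + C) / v by rewrite divr_ge0 ?(ltW C4) ?(ltW v0).
have -> : 4 * (1 + C) / v = ((4 * (1 + C) / v) `^ s^-1) `^ s.
  by rewrite -powRrM mulVf ?gt_eqF// powRr1.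
by apply: gt0_ltr_powR; rewrite ?nnegrE ?powR_ge0.
Qed.

Lemma sum_wmass n : \sum_(u <- words n) wmass u = 1.
Proof.
under eq_bigr do rewrite wmassE.
rewrite -(Rint_sum nufin); last by move=> u; exact: bmeas_wcell.
under eq_Rintegral do rewrite (sum_indic_wcell b2).
have -> : (fun x : measurableTypeR R => ((0 <= x) && (x < 1))%R%:R) =
    \1_(`[0, 1[%classic : set (measurableTypeR R)) :> (_ -> R).
  by apply/funext => x; rewrite indicE mem_setE in_itv.
rewrite Rint_indic; last exact: measurable_itv.
have : nu `[0, 1]%classic = (nu `[0%R, 1%R[%classic + nu [set 1%R])%E.
  rewrite -measureU//; last first.
    by apply/seteqP; split => // x [/=]; rewrite in_itv /= => /andP[_ + e]; rewrite e ltxx.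
  by rewrite setUitv1// bnd_simp.
by rewrite no_atom adde0 nu01 => /esym h; exact: (congr1 fine h).
Qed.

(** A cell indicator is the difference of two half-line indicators with endpoints in [0, 1]. The
    decay for half-lines is uniform in the endpoint, hence here in [u]. *)
Lemma cellint_decay : exists2 K : R, 0 <= K & exists2 eta : R, 0 < eta &
  forall u z al, 1 <= `|z| -> `|cellint z al u| <= K * `|z| `^ (- eta).
Proof.
have [K K0 hK] := cosint_lt_decay C0 s01 nu01 decay.
exists (2 * K); first by rewrite mulr_ge0.
exists (s ^+ 2 / 10); first by rewrite divr_gt0// exprn_gt0//; case/andP: s01.
move=> u z al z1.
have [u0 u1] := @wcell_sub R b b2 u.
have bR : 0 <= (b%:R ^+ size u)^-1 :> R by rewrite invr_ge0 exprn_ge0.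
set l := wpoint u in u0 u1; set r := l + _ in u1.
have -> : cellint z al u =
    \int[nu]_x ((x < r)%R%:R * cos (z * x + al)) - \int[nu]_x ((x < l)%R%:R * cos (z * x + al)).
  have bl a : bmeas (fun x : measurableTypeR R => (x < a)%R%:R * cos (z * x + al)).
    by apply: bmeasM; [exact: bmeas_ind_lt|exact: bmeas_cos].
  rewrite -mulN1r -(RintZ nufin (-1) (bl l)) -(RintD nufin); last 2 first.
  - exact: bl.
  - by apply: bmeasM; [exact: bmeas_cst|exact: bl].
  apply: eq_Rintegral => x _; rewrite mulN1r -mulrBl; congr (_ * _).
  rewrite indic_wcell -/l -/r.
  have [lx|xl] := leP l x; first by rewrite subr0.
  by rewrite (lt_le_trans xl) ?subrr// lerDl.
have h1 := hK r z al _ z1; have h2 := hK l z al _ z1.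
apply: le_trans (ler_normB _ _) _.
rewrite -mulrA mulrDl mul1r; apply: lerD; [apply: h1|apply: h2].
  by apply/andP; split => //; rewrite addr_ge0.
by apply/andP; split => //; apply: le_trans u1; rewrite lerDl.
Qed.

End cell_integrals.

(** * Sums over frequencies and over words *)

Section frequency_norms.
Context {R : realType}.

Lemma interpolate_le (x A B th : R) : 0 <= x -> x <= A -> x <= B -> 0 <= th <= 1 ->
  x <= A `^ (1 - th) * B `^ th.
Proof.
move=> x0 xA xB /andP[t0 t1]; have t10 : 0 <= 1 - th by lra.
have [->|xn0] := eqVneq x 0; first by rewrite mulr_ge0 ?powR_ge0.
have {1}-> : x = x `^ (1 - th) * x `^ th.
  by rewrite -powRD ?xn0 ?implybT// subrK powRr1.
by apply: ler_pM; rewrite ?powR_ge0// ge0_ler_powR ?nnegrE//; apply: le_trans x0 _.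
Qed.

(** Telescoping comparison of 1/u^2 with 2/u - 2/(u+1), valid for u >= 1. *)
Lemma sum_inv_sqr_le (J : nat) : \sum_(j < J) (j.+1%:R ^+ 2)^-1 <= 2 :> R.
Proof.
suff : \sum_(j < J) (j.+1%:R ^+ 2)^-1 <= 2 * (1 - J.+1%:R^-1) :> R.
  have v0 : 0 <= J.+1%:R^-1 :> R by rewrite invr_ge0.
  by move=> /le_trans; apply; rewrite ler_piMr// lerBlDr lerDl.
elim: J => [|J IH]; first by rewrite big_ord0 invr1 subrr mulr0.
rewrite big_ord_recr /=; apply: le_trans (lerD IH (lexx _)) _.
have J1 : 1 <= J.+1%:R :> R by rewrite ler1n.
rewrite -[J.+2%:R]natr1; move: (J.+1%:R) J1 => u u1.
have u0 : 0 < u by lra.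
have u10 : 0 < u + 1 by lra.
rewrite -subr_ge0 (_ : _ - _ = (u - 1) / (u ^+ 2 * (u + 1))).
  by rewrite divr_ge0 ?mulr_ge0 ?sqr_ge0//; lra.
by field; rewrite !gt_eqF.
Qed.

(* Consecutive frequencies differ by at most [1 / freq j], and [\sum_j freq j^(-4)]
   is finite. *)
Definition freq (j : nat) : R := j.+1%:R `^ (1 / 2).

Lemma freq_ge1 j : 1 <= freq j.
Proof.
apply: (@le_trans _ _ (1 `^ (1 / 2))); first by rewrite powR1.
by rewrite ge0_ler_powR ?nnegrE ?ler1n//; lra.
Qed.

(** After interpolation and the power q = k + 2, the frequency factor is (j+1)^(-eta th q / 2), at
    most (j+1)^(-3). The weight j + 1 leaves (j+1)^(-2), whose sum over j is at most 2; two phases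
    make it 4. *)
Lemma wnorm_freq_bound (J k : nat) (a : 'I_J * bool -> R) (A K eta th p : R) :
  ~~ odd k -> 0 <= A -> 0 <= K -> 0 < th <= 1 -> 0 < p ->
  3 <= eta * th * k.+2%:R / 2 ->
  (forall i, `|a i| <= A) -> (forall i, `|a i| <= K * freq i.1 `^ (- eta)) ->
  wnorm (fun i : 'I_J * bool => i.1.+1%:R) k p a <=
    (4 * (K `^ th) ^+ k.+2) `^ (p / k.+2%:R) * A `^ (p * (1 - th)).
Proof.
move=> ek A0 K0 /andP[t0 t1] p0 h3 aA aK.
have t01 : 0 <= th <= 1 by rewrite (ltW t0).
have k0 : 0 < k.+2%:R :> R by rewrite ltr0n.
set A' := A `^ (1 - th); set K' := K `^ th.
have A'0 : 0 <= A' by exact: powR_ge0.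
have K'0 : 0 <= K' by exact: powR_ge0.
have term (i : 'I_J * bool) : i.1.+1%:R * a i ^+ k.+2 <= A' ^+ k.+2 * K' ^+ k.+2 * (i.1.+1%:R ^+ 2)^-1.
  set u : R := i.1.+1%:R; have u1 : 1 <= u by rewrite ler1n.
  have u0 : 0 < u by lra.
  have le1 := interpolate_le (normr_ge0 _) (aA i) (aK i) t01.
  rewrite exprn_even_norm//=; last by rewrite negbK.
  have -> : A' ^+ k.+2 * K' ^+ k.+2 * (u ^+ 2)^-1 = u * (A' ^+ k.+2 * K' ^+ k.+2 * (u ^+ 3)^-1).
    by field; rewrite gt_eqF.
  rewrite ler_pM2l//.
  apply: le_trans (_ : (A' * (K * freq i.1 `^ (- eta)) `^ th) ^+ k.+2 <= _).
    by rewrite lerXn2r ?nnegrE ?mulr_ge0 ?powR_ge0.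
  rewrite (powRM _ K0 (powR_ge0 _ _)) !exprMn -mulrA.
  rewrite ler_wpM2l ?exprn_ge0// ler_wpM2l ?exprn_ge0//.
  rewrite /freq -/u -!powRrM -(powR_mulrn k.+2 (powR_ge0 _ _)) -powRrM.
  rewrite -(powR_mulrn 3 (ltW u0)) -powRN ler_powR//.
  by move: h3; lra.
have sum4 : wsum (fun i : 'I_J * bool => i.1.+1%:R) k a <= 4 * K' ^+ k.+2 * A' ^+ k.+2.
  apply: (@le_trans _ _ (\sum_(i : 'I_J * bool) A' ^+ k.+2 * K' ^+ k.+2 * (i.1.+1%:R ^+ 2)^-1)).
    by apply: ler_sum => i _; exact: term.
  rewrite -mulr_sumr -(pair_bigA _ (fun (j : 'I_J) (c : bool) => (j.+1%:R ^+ 2)^-1)) /=.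
  under eq_bigr do rewrite sumr_const card_bool -[_ *+ 2]mulr_natl.
  rewrite -mulr_sumr.
  have AK0 : 0 <= A' ^+ k.+2 * K' ^+ k.+2 by rewrite mulr_ge0// exprn_ge0.
  have -> : 4 * K' ^+ k.+2 * A' ^+ k.+2 = A' ^+ k.+2 * K' ^+ k.+2 * (2 * 2) by ring.
  by rewrite ler_wpM2l// ler_wpM2l// sum_inv_sqr_le.
have -> : A `^ (p * (1 - th)) = (A' ^+ k.+2) `^ (p / k.+2%:R).
  rewrite -powR_mulrn// /A' -!powRrM; congr (_ `^ _).
  by field; rewrite gt_eqF.
have K4 : 0 <= 4 * K' ^+ k.+2 by apply: mulr_ge0 => //; exact: exprn_ge0.
have A4 : 0 <= A' ^+ k.+2 by exact: exprn_ge0.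
rewrite -(powRM _ K4 A4).
rewrite /wnorm ge0_ler_powR ?nnegrE ?divr_ge0 ?(ltW p0) ?(mulr_ge0 K4 A4)//.
by apply: wsum_ge0.
Qed.

End frequency_norms.

Section summability.
Context {R : realType} {b : nat} (f : seq 'I_b -> R).
Hypothesis b1 : (0 < b)%N.

Lemma sum1_words n : \sum_(u <- words n : seq (seq (ordinal b))) (1 : R) = b%:R ^+ n.
Proof.
elim: n => [|n IH]; first by rewrite big_seq1 expr0.
rewrite (big_wordsS (fun=> 1 : R)) exprSr -IH mulr_suml; apply: eq_bigr => u _.
by rewrite sumr_const card_ord mul1r.
Qed.

Variables (p m beta K : R).
Hypotheses (m0 : 0 <= m) (beta0 : 0 < beta) (mb : m * beta < 1) (K0 : 0 <= K).
Hypothesis fsum : forall n, \sum_(u <- words n) f u `^ p <= K * beta ^+ n.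

(** Lowering the exponent from p to p (1 - th) costs a factor (b / beta)^th per level. It tends to 1
    with th tending to 0, so the strict inequality [m * beta < 1] leaves room. *)
Lemma exists_small_exponent : exists2 th : R, 0 < th <= 1 / 2 & m * beta * (b%:R / beta) `^ th < 1.
Proof.
have mb0 : 0 <= m * beta by rewrite mulr_ge0// ltW.
have mb1 := mb; have bR : 0 < b%:R / beta by rewrite divr_gt0// ltr0n.
set L := `|ln (b%:R / beta)| + 1; have L0 : 0 < L by rewrite ltr_wpDl.
have L1 : ln (b%:R / beta) <= L by apply: le_trans (ler_norm _) _; rewrite lerDl.
pose th := Num.min (1 / 2) ((1 - m * beta) / 2 / L).
have th0 : 0 < th.
  by rewrite lt_min; apply/andP; split; rewrite ?divr_gt0 ?subr_gt0.
have [th1 th2] : th <= 1 / 2 /\ th <= (1 - m * beta) / 2 / L.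
  by split; rewrite ge_min lexx ?orbT.
exists th; first by rewrite th0.
have thL : th * L <= (1 - m * beta) / 2 by rewrite -ler_pdivlMr.
have le1 : (b%:R / beta) `^ th <= expR (th * L).
  by rewrite /powR gt_eqF// ler_expR ler_wpM2l// ltW.
apply: le_lt_trans (ler_wpM2l mb0 le1) _.
have e0 := expR_gt0 (th * L).
have := expR_ge1Dx (- (th * L)); rewrite expRN => h.
have h' : expR (th * L) * (1 - th * L) <= 1.
  by rewrite mulrC -ler_pdivlMr// div1r.
move: (th * L) thL (expR _) e0 h' => t tL E E0 h'.
move: (m * beta) mb0 mb1 tL => M M0 M1 tL.
have t1 : 0 < 1 - t by lra.
have E1 : E <= (1 - t)^-1 by rewrite -div1r ler_pdivlMr.
apply: le_lt_trans (ler_wpM2l M0 E1) _.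
by rewrite ltr_pdivrMr//; lra.
Qed.

Lemma geometric_sum_le (r : R) n : 0 <= r -> r < 1 -> \sum_(k < n) r ^+ k <= (1 - r)^-1.
Proof.
move=> r0 r1; have r10 : 0 < 1 - r by lra.
rewrite -div1r ler_pdivlMr// mulrC.
have -> : (1 - r) * \sum_(k < n) r ^+ k = 1 - r ^+ n by rewrite -[1 - r ^+ n]opprB subrX1 -mulNr opprB.
by rewrite lerBlDr lerDl exprn_ge0.
Qed.

(* Level by level, [y^(1-th) <= kap^(-th) * (y + kap)] with
   [kap = (beta / b)^n]. *)
Lemma weighted_sum_bounded : exists2 th : R, 0 < th <= 1 / 2 & exists2 B : R, 0 <= B &
  forall n, \sum_(v <- words_upto n) m ^+ (size v).-1 * f v `^ (p * (1 - th)) <= B.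
Proof.
have [th th01 small] := exists_small_exponent; have [th0 th1] := andP th01.
exists th => //; set gam := _ `^ th in small.
have gam0 : 0 < gam by rewrite powR_gt0// divr_gt0// ltr0n.
have bR : 0 < b%:R :> R by rewrite ltr0n.
(* kap^(-th) = gam^n, and the two summands of y + kap contribute K beta^n and b^n kap = beta^n,
   whence K + 1. *)
have level n : \sum_(v <- words n) f v `^ (p * (1 - th)) <= (K + 1) * (beta * gam) ^+ n.
  set kap := (beta / b%:R) ^+ n; have kap0 : 0 < kap by rewrite exprn_gt0// divr_gt0.
  have kth0 : 0 < kap `^ th by rewrite powR_gt0.
  have kapV : (kap `^ th)^-1 = gam ^+ n.
    have kg : kap `^ th = ((beta / b%:R) `^ th) ^+ n.
      have bb0 : 0 <= beta / b%:R by rewrite divr_ge0 ?ltW.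
      by rewrite /kap -(powR_mulrn n bb0) -(powR_mulrn n (powR_ge0 _ _)) -!powRrM (mulrC th).
    apply: (mulfI (lt0r_neq0 kth0)); rewrite divff ?gt_eqF// kg -exprMn /gam.
    rewrite -powRM ?divr_ge0 ?(ltW beta0) ?(ltW bR)//.
    have -> : beta / b%:R * (b%:R / beta) = 1 by field; rewrite !gt_eqF.
    by rewrite powR1 expr1n.
  apply: (@le_trans _ _ (\sum_(v <- words n) gam ^+ n * (f v `^ p + kap))).
    apply: ler_sum => v _.
    rewrite -kapV [leRHS]mulrC ler_pdivlMr// powRrM.
    have : 0 <= f v `^ p by exact: powR_ge0.
    move: (f v `^ p) => y y0.
    have [yk|/ltW ky] := leP y kap.
      apply: (@le_trans _ _ (kap `^ (1 - th) * kap `^ th)).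
        rewrite ler_wpM2r ?powR_ge0// ge0_ler_powR ?nnegrE ?(ltW kap0)//; lra.
      rewrite -powRD ?(gt_eqF kap0) ?implybT// subrK powRr1 ?(ltW kap0)//.
      by rewrite lerDr.
    have y0' : 0 < y by exact: lt_le_trans ky.
    apply: (@le_trans _ _ (y `^ (1 - th) * y `^ th)).
      rewrite ler_wpM2l ?powR_ge0// ge0_ler_powR ?nnegrE ?(ltW kap0) ?(ltW th0)//.
    rewrite -powRD ?(gt_eqF y0') ?implybT// subrK powRr1//.
    by rewrite lerDl ltW.
  rewrite -mulr_sumr big_split /= exprMn mulrA [leRHS]mulrC ler_wpM2l ?exprn_ge0 ?(ltW gam0)//.
  rewrite mulrDl mul1r lerD//.
  rewrite -[X in \sum_(_ <- _) X]mulr1 -mulr_sumr sum1_words /kap expr_div_n divfK//.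
  by rewrite expf_neq0// gt_eqF.
exists ((K + 1) * (beta * gam) * (1 - m * beta * gam)^-1).
  rewrite mulr_ge0 ?invr_ge0 ?subr_ge0 ?(ltW small)//.
  by rewrite mulr_ge0 ?addr_ge0// mulr_ge0 ?(ltW gam0) ?(ltW beta0).
move=> n.
apply: (@le_trans _ _ (\sum_(k < n) (K + 1) * (beta * gam) * (m * beta * gam) ^+ k)).
  elim: n => [|n IH]; first by rewrite big_nil big_ord0.
  rewrite words_uptoS big_cat big_ord_recr /=; apply: lerD => //.
  rewrite big_seq (eq_bigr (fun v => m ^+ n * f v `^ (p * (1 - th)))); last first.
    by move=> v; rewrite (mem_words n.+1) => /eqP ->.
  rewrite -big_seq -mulr_sumr.
  apply: le_trans (ler_wpM2l (exprn_ge0 _ m0) (level n.+1)) _.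
  rewrite le_eqVlt; apply/orP; left; apply/eqP.
  by rewrite -(mulrA m) [(m * _) ^+ n]exprMn (exprS _ n); ring.
rewrite -mulr_sumr ler_wpM2l//.
  by rewrite mulr_ge0 ?addr_ge0// mulr_ge0 ?(ltW gam0) ?(ltW beta0).
apply: geometric_sum_le => //.
by rewrite mulr_ge0 ?(ltW gam0)// mulr_ge0// ltW.
Qed.

End summability.

(** * Moment bounds for the cascade, uniform in the level *)

Section cascade_bounds.
Context {R : realType} {d : measure_display} {T : measurableType d}
  {P : probability T R} {b : nat} {W : seq 'I_b -> {RV P >-> R}}.
Local Notation word := (seq 'I_b).
Hypothesis b2 : (2 <= b)%N.
Hypothesis indW : mutually_independent [set u | u != [::]] W.
Variables (p m : R).
Hypotheses (p12 : 1 < p <= 2).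
Hypothesis mean1 : forall u, u != [::] -> (\int[P]_w (posw (W:=W) u w)%:E = 1)%E.
Hypothesis momp : forall u, u != [::] -> (\int[P]_w (posw (W:=W) u w `^ p)%:E = m%:E)%E.

Lemma cascade_sum_moment (J : finType) (wt : J -> R) (k : nat) (a : word -> J -> R) n :
  (forall i, 0 <= wt i) -> ~~ odd k ->
  (forall u i, a u i = \sum_(x < b) a (rcons u x) i) ->
  (\int[P]_w (wnorm wt k p
     (fun i => cascade_sum (W:=W) (a^~ i) n w - a [::] i))%:E <=
   (2 ^+ k.+2.+3 * (m + 1) *
      \sum_(v <- words_upto n) m ^+ (size v).-1 * wnorm wt k p (a v))%:E)%E.
Proof.
move=> wt0 ek aE.
under eq_integral => w _.
  rewrite (_ : (fun i => _) = (fun i : J => \sum_(v <- words_upto n)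
      wprod (W:=W) (size v).-1 v w * (posw (W:=W) v w - 1) * a v i)); last first.
    apply/funext => i; rewrite (cascade_sum_telescope (a := a^~ i))//.
    by rewrite addrC addKr.
  over.
apply: (cascade_moment_bound indW wt0 ek p12 mean1 momp).
- exact: words_upto_uniq.
- by move=> u; rewrite mem_words_upto; case: u.
- exact: words_upto_prefix.
Qed.

Variables (nu : probability (measurableTypeR R) R) (beta K : R).
Hypotheses (m0 : 0 <= m) (beta0 : 0 < beta) (mb : m * beta < 1) (K0 : 0 <= K).
Hypothesis fsum : forall n, \sum_(u <- words n : seq word) wmass nu u `^ p <= K * beta ^+ n.
Variables (Kc eta : R).
Hypotheses (Kc0 : 0 <= Kc) (eta0 : 0 < eta).
Hypothesis dec : forall (u : word) z al, 1 <= `|z| ->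
  `|cellint nu z al u| <= Kc * `|z| `^ (- eta).

Let b1 : (0 < b)%N := ltnW b2.
Let p0 : 0 < p. Proof. by have [p1 _] := andP p12; lra. Qed.

Definition phase (c : bool) : R := if c then - (pi / 2) else 0.

Hypothesis mass1 : wmass nu ([::] : word) = 1.

(** A single coordinate with k = 0, that is q = 2, makes [wnorm] equal to |x|^p. Masses are at most
    1, so lowering the exponent to p (1 - th) only increases the terms, and [weighted_sum_bounded]
    applies. *)
Lemma cascade_mass_bound : exists2 B : R, 0 <= B & forall n,
  (\int[P]_w (`|cascade_sum (W:=W) (wmass nu) n w - 1| `^ p)%:E <= B%:E)%E.
Proof.
have [th th01 [B B0 hB]] := weighted_sum_bounded b1 m0 beta0 mb K0 fsum.
have C0 : 0 <= 2 ^+ 5 * (m + 1) by rewrite mulr_ge0 ?exprn_ge0// addr_ge0.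
have nE (x : R) : wnorm (fun=> 1 : R) 0 p (fun _ : 'I_1 => x) = `|x| `^ p.
  rewrite /wnorm /wsum big_ord1 mul1r -(real_normK (num_real x)).
  rewrite -(powR_mulrn 2 (normr_ge0 x)) -powRrM; congr (_ `^ _).
  by field.
exists (2 ^+ 5 * (m + 1) * B); first by rewrite mulr_ge0.
move=> n.
have := @cascade_sum_moment 'I_1 (fun=> 1) 0 (fun u _ => wmass nu u) n (fun=> ler01) isT
  (fun u _ => wmass_rcons nu b2 u).
under eq_integral do rewrite nE mass1.
move=> /le_trans; apply; rewrite lee_fin ler_wpM2l//.
apply: le_trans (hB n); apply: ler_sum => v _; rewrite nE ler_wpM2l ?exprn_ge0//.
rewrite ger0_norm ?wmass_ge0//.
have [->|v0] := eqVneq (wmass nu v) 0.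
  by rewrite !powR0 ?gt_eqF// mulr_gt0//; lra.
rewrite ger_powR//; first by rewrite lt_neqAle eq_sym v0 wmass_ge0 wmass_le1.
by rewrite ler_piMr ?(ltW p0)//; lra.
Qed.

Lemma cascade_freq_bound : exists k : nat, ~~ odd k /\ exists2 B : R, 0 <= B &
  forall J n, (\int[P]_w (wnorm (fun i : 'I_J * bool => i.1.+1%:R) k p
    (fun i => cascade_sum (W:=W) (cellint nu (freq i.1) (phase i.2)) n w -
      cellint nu (freq i.1) (phase i.2) ([::] : word)))%:E <= B%:E)%E.
Proof.
have [th /andP[th0 th1] [B B0 hB]] :=
  weighted_sum_bounded b1 m0 beta0 mb K0 fsum.
have et0 : 0 < eta * th by rewrite mulr_gt0.
(* Twice an integer j > 3 / (eta th): then q/2 = j + 1, which gives the exponent 3 asked for by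
   [wnorm_freq_bound]. *)
pose k := (Num.truncn (3 / (eta * th))).+1.*2.
have ek : ~~ odd k by rewrite odd_double.
have k3 : 3 <= eta * th * k.+2%:R / 2.
  have := truncnS_gt (3 / (eta * th)); set j := (Num.truncn _).+1.
  rewrite ltr_pdivrMr// => h.
  have -> : k.+2%:R = j%:R * 2 + 2 :> R by rewrite /k -/j -addn2 natrD -muln2 natrM.
  by lra.
exists k; split => //.
pose D := (4 * (Kc `^ th) ^+ k.+2) `^ (p / k.+2%:R).
have D0 : 0 <= D by exact: powR_ge0.
have C0 : 0 <= 2 ^+ k.+2.+3 * (m + 1) by rewrite mulr_ge0 ?exprn_ge0// addr_ge0.
exists (2 ^+ k.+2.+3 * (m + 1) * (D * B)); first by rewrite mulr_ge0// mulr_ge0.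
move=> J n; apply: le_trans (cascade_sum_moment (J := ('I_J * bool)%type) (wt := fun i => i.1.+1%:R)
   (a := fun u i => cellint nu (freq i.1) (phase i.2) u) n _ ek _) _.
- by [].
- by move=> u i; exact: cellint_rcons.
rewrite lee_fin ler_wpM2l//.
apply: le_trans (ler_wpM2l D0 (hB n)); rewrite mulr_sumr; apply: ler_sum => v _.
rewrite mulrCA ler_wpM2l ?exprn_ge0//.
apply: (wnorm_freq_bound (eta := eta)) => //.
- exact: wmass_ge0.
- by apply/andP; split => //; lra.
- by move=> i; exact: norm_cellint_le.
- move=> i; have f1 := freq_ge1 (R:=R) i.1.
  have := dec v (phase i.2) (z := freq i.1).
  by rewrite ger0_norm ?(le_trans ler01 f1)//; apply.
Qed.

End cascade_bounds.

(** * From sampled frequencies to all frequencies *)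

Section frequency_sampling.
Context {R : realType}.

Lemma cos_lipschitz (u v : R) : `|cos u - cos v| <= `|u - v|.
Proof.
wlog uv : u v / v <= u => [h|].
  by have [/h//|/ltW /h] := leP v u; rewrite distrC [leRHS]distrC.
rewrite [leRHS]ger0_norm ?subr_ge0// ler_norml.
have h1 : v - cos v <= u - cos u.
  apply: (derive_ge0_le (f := fun t => t - cos t) (df := fun t => 1 + sin t)) => // t.
    by apply: is_derive_eq; rewrite opprK.
have h2 : v + cos v <= u + cos u.
  by apply: (derive_ge0_le (f := fun t => t + cos t) (df := fun t => 1 - sin t)).
by apply/andP; split; lra.
Qed.

Variable mu : {measure set (measurableTypeR R) -> \bar R}.
Hypothesis mufin : (mu setT < +oo)%E.
Hypothesis mu01 : mu (~` `[0, 1]%classic) = 0%E.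

Let m01 : measurable (`[0, 1]%classic : set (measurableTypeR R)).
Proof. exact: measurable_itv. Qed.

Lemma cosint_lipschitz y z al :
  `|cosint mu y al - cosint mu z al| <= `|y - z| * fine (mu setT).
Proof.
pose D x := cos (y * x + al) - cos (z * x + al).
have bD : bmeas (D : measurableTypeR R -> R).
  rewrite /D; under eq_fun do rewrite -[X in _ + X]mulN1r.
  apply: bmeasD; first exact: bmeas_cos.
  by apply: bmeasM; [exact: bmeas_cst|exact: bmeas_cos].
have -> : cosint mu y al - cosint mu z al = \int[mu]_x D x.
  rewrite /D; under [in RHS]eq_Rintegral do rewrite -[X in _ + X]mulN1r.
  rewrite (RintD mufin) ?(RintZ mufin) ?mulN1r//; first exact: bmeas_cos.
  - exact: bmeas_cos.
  - by apply: bmeasM; [exact: bmeas_cst|exact: bmeas_cos].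
have bI : bmeas (\1_(~` `[0, 1]%classic : set (measurableTypeR R)) : _ -> R).
  by apply: bmeas_indic; exact: measurableC.
have h : `|\int[mu]_x D x| <= \int[mu]_x (`|y - z| + 2 * \1_(~` `[0, 1]%classic) x).
  apply: (norm_Rint_le mufin) => //.
    by apply: bmeasD; [exact: bmeas_cst|apply: bmeasM => //; exact: bmeas_cst].
  move=> x; rewrite indicE; case: (boolP (x \in _)) => [_|].
    rewrite mulr1; apply: le_trans (ler_normB _ _) _.
    have := cos_max (y * x + al); have := cos_max (z * x + al).
    by have := normr_ge0 (y - z); lra.
  rewrite mulr0 addr0 notin_setE /= => /contrapT; rewrite in_itv /= => /andP[x0 x1].
  apply: le_trans (cos_lipschitz _ _) _.
  rewrite (_ : _ - _ = (y - z) * x); last by ring.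
  by rewrite normrM (ger0_norm x0) ler_piMr.
apply: le_trans h _.
rewrite (RintD mufin) ?(RintZ mufin) //; last 2 first.
- exact: bmeas_cst.
- by apply: bmeasM => //; exact: bmeas_cst.
by rewrite (Rint_indic mu (measurableC m01)) mu01 mulr0 addr0 Rint_cst.
Qed.

Lemma fourier_dim_gt0_freq (B eta : R) : 0 <= B -> 0 < eta <= 1 ->
  (forall j c, `|cosint mu (freq j) (phase c)| <= B * freq j `^ (- eta)) ->
  0 < fourier_dim mu.
Proof.
move=> B0 /andP[eta0 eta1] h; set M := fine (mu setT).
have M0 : 0 <= M by exact: fine_ge0.
apply: (fourier_dim_gt0 (C := 2 * (B * 2 + M)) eta0) => y al y1.
have y0 : 0 < y by lra.
(* The last sampled frequency z up to y: z^2 = j + 1 <= y^2 < j + 2 yields (y - z) y <= y^2 - z^2 <=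
   1, and 1/y <= y^(-eta) because eta <= 1. *)
pose j := (Num.truncn (y ^+ 2)).-1.
have /andP[j1 j2] : j.+1%:R <= y ^+ 2 < j.+2%:R.
  have := @truncn_itv _ (y ^+ 2) (sqr_ge0 y).
  by rewrite /j prednK// truncn_gt0 exprn_ege1.
pose z : R := freq j.
have z1 : 1 <= z by exact: freq_ge1.
have z2 : z ^+ 2 = j.+1%:R.
  by rewrite -powR_mulrn ?powR_ge0// -powRrM mul1r mulVf// powRr1.
have zy : z <= y by rewrite -(@ler_pXn2r _ 2) ?nnegrE ?z2//; lra.
have yz : y <= 2 * z.
  rewrite -(@ler_pXn2r _ 2) ?nnegrE//; [|lra|lra].
  rewrite exprMn z2; apply: le_trans (ltW j2) _.
  have : 1 <= j.+1%:R :> R by rewrite ler1n.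
  by rewrite -[j.+2%:R]natr1; lra.
have dyz : y - z <= y `^ (- eta).
  apply: (@le_trans _ _ y^-1).
    rewrite -div1r ler_pdivlMr//.
    move: j2; rewrite -[j.+2%:R]natr1 -z2; nra.
  by rewrite -powR_inv1 ?(ltW y0)// ler_powR// lerN2.
have zeta : z `^ (- eta) <= 2 * y `^ (- eta).
  have z0 : 0 < z by lra.
  rewrite !powRN -(@ler_pM2r _ (z `^ eta * y `^ eta)) ?mulr_gt0 ?powR_gt0//.
  rewrite mulrA mulVf ?gt_eqF ?powR_gt0// mul1r.
  rewrite -mulrA [_^-1 * _]mulrC -mulrA divff ?gt_eqF ?powR_gt0// mulr1.
  apply: (@le_trans _ _ ((2 * z) `^ eta)).
    by rewrite ge0_ler_powR ?nnegrE ?(ltW eta0)//; lra.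
  rewrite powRM ?(ltW z0)// ler_wpM2r ?powR_ge0//.
  by rewrite -[leRHS]powRr1// ler_powR//; lra.
have bound c : `|cosint mu y (phase c)| <= (B * 2 + M) * y `^ (- eta).
  have := ler_normD (cosint mu y (phase c) - cosint mu z (phase c)) (cosint mu z (phase c)).
  rewrite subrK => /le_trans; apply.
  rewrite mulrDl addrC; apply: lerD.
    by apply: le_trans (h j c) _; rewrite -mulrA ler_wpM2l.
  apply: le_trans (cosint_lipschitz _ _ _) _; rewrite mulrC ler_wpM2l//.
  by rewrite ger0_norm// subr_ge0.
apply: le_trans (norm_cosint_rotate mufin _ _) _.
by have := bound true; have := bound false; rewrite /phase; lra.
Qed.

End frequency_sampling.

(** * Consequences of weak convergence at a fixed sample point *)

Section weak_limits.
Context {R : realType} {b : nat} {d : measure_display} {Omega : measurableType d} {P : probability Omega R}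
  {W : seq 'I_b -> {RV P >-> R}} (nu : probability (measurableTypeR R) R).
Local Notation word := (seq 'I_b).
Hypothesis b2 : (2 <= b)%N.
Variables (w : Omega) (mu : {measure set (measurableTypeR R) -> \bar R}).
Hypotheses (W1 : W [::] w = 1) (W0 : forall u, 0 <= W u w).
Hypothesis wcvg : weak_cvg (fun n => cascade (fun u => W u : Omega -> R) nu n w) mu.

Let nufin : (nu setT < +oo)%E.
Proof. by rewrite probability_setT ltry. Qed.

Let mufin : (mu setT < +oo)%E := wcvg.1.

Lemma cascade_densityE n t : cascade_density (fun u => W u : Omega -> R) n w t =
  \sum_(u <- words n) wprod (W:=W) n u w * \1_(wcell u) t.
Proof.
rewrite -(big_words_tuple (fun u => wprod n u w * \1_(wcell u) t)).
apply: eq_bigr => u _; rewrite bitvE; congr (_ * _).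
rewrite big_nat_recl// take0 W1 mul1r; apply: eq_bigr => j _.
by rewrite /posw max_l.
Qed.

Lemma integral_cascade (f : R -> R) n : bmeas f -> (forall t, 0 <= f t) ->
  (\int[cascade (fun u => W u : Omega -> R) nu n w]_t (f t)%:E =
   (\sum_(u <- words n) wprod (W:=W) n u w * \int[nu]_t (\1_(wcell u) t * f t))%:E)%E.
Proof.
move=> bf f0.
have -> : cascade (fun u => W u : Omega -> R) nu n w = fun A =>
    (\int[nu]_(t in A) (\sum_(u <- words n) wprod (W:=W) n u w * \1_(wcell u) t)%:E)%E.
  by apply/funext => A; apply: eq_integral => t _; rewrite cascade_densityE.
rewrite (integral_cell_density nu (words n) (fun u => wprod_ge0 n u w) bf.1 f0).
rewrite -sumEFin; apply: eq_bigr => u _; rewrite EFinM; congr (_ * _)%E.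
rewrite /Rintegral fineK//; apply: integrable_fin_num => //.
by apply: (bmeas_integrable nufin); apply: bmeasM => //; exact: bmeas_wcell.
Qed.

Lemma cvg_cascade_sum (f : R -> R) : continuous f -> bmeas f -> (forall t, 0 <= f t) ->
  cascade_sum (W:=W) (fun u => \int[nu]_t (\1_(wcell u) t * f t)) n w @[n --> \oo] -->
  \int[mu]_x f x.
Proof.
move=> cf bf f0; have [_ [M fM]] := bf.
have bdf : bounded_fun f.
  by exists M; split; [exact: num_real|move=> x Mx y _; exact: le_trans (fM _) (ltW Mx)].
have := wcvg.2 f cf bdf; under eq_fun do rewrite integral_cascade//.
rewrite -[X in _ --> X]fineK; last first.
  by apply: integrable_fin_num => //; exact: (bmeas_integrable mufin).
by move/fine_cvgP => [_].
Qed.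

Lemma cvg_cascade_mass :
  cascade_sum (W:=W) (wmass nu) n w @[n --> \oo] --> fine (mu setT).
Proof.
have h := cvg_cascade_sum (f := fun=> 1) (fun=> @cvg_cst _ _ _ _ _) (bmeas_cst 1) (fun=> ler01).
rewrite Rint_cst mul1r in h.
rewrite (_ : cascade_sum (W:=W) (wmass nu) ^~ w =
  (fun n => cascade_sum (W:=W) (fun u => \int[nu]_t (\1_(wcell u) t * 1)) n w)); first exact: h.
apply/funext => n; apply: eq_bigr => u _; rewrite wmassE; congr (_ * _).
by apply: eq_Rintegral => t _; rewrite mulr1.
Qed.

(** [cvg_cascade_sum] takes nonnegative test functions, so it is applied to 1 + cos and the total
    mass is subtracted. *)
Lemma cvg_cascade_cos z al :
  cascade_sum (W:=W) (cellint nu z al) n w @[n --> \oo] --> cosint mu z al.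
Proof.
have cc : continuous (fun x : R => cos (z * x + al)).
  move=> x; apply: continuous_comp; last exact: continuous_cos.
  by apply: cvgD; [apply: cvgM; [exact: cvg_cst|exact: cvg_id]|exact: cvg_cst].
have c1 : continuous (fun x : R => 1 + cos (z * x + al)).
  by move=> x; apply: cvgD; [exact: cvg_cst|exact: cc].
have b1 : bmeas (fun x : measurableTypeR R => 1 + cos (z * x + al)).
  by apply: bmeasD; [exact: bmeas_cst|exact: bmeas_cos].
have p1 (x : R) : 0 <= 1 + cos (z * x + al) by have := cos_max (z * x + al); rewrite ler_norml; lra.
have h := cvgB (cvg_cascade_sum c1 b1 p1) cvg_cascade_mass.
have e : \int[mu]_x (1 + cos (z * x + al)) - fine (mu setT) = cosint mu z al.
  rewrite (RintD mufin (bmeas_cst 1) (bmeas_cos z al)) Rint_cst mul1r.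
  by rewrite addrAC subrr add0r.
rewrite e in h.
rewrite (_ : cascade_sum (W:=W) (cellint nu z al) ^~ w = (fun n =>
  cascade_sum (W:=W) (fun u => \int[nu]_t (\1_(wcell u) t * (1 + cos (z * t + al)))) n w -
  cascade_sum (W:=W) (wmass nu) n w)); first exact: h.
apply/funext => n; rewrite /cascade_sum -sumrB; apply: eq_bigr => u _.
rewrite -mulrBr; congr (_ * _).
under [X in _ = X - _]eq_Rintegral do rewrite mulrDr mulr1.
rewrite (RintD nufin (bmeas_wcell u) (bmeas_cellint z al u)) -wmassE.
by rewrite addrAC subrr add0r.
Qed.

(** The test function is the distance to [0, 1] capped at 1. It vanishes on every cell, so its
    integral against the limit is 0, yet it is positive outside [0, 1]. *)
Lemma weak_limit_carried : mu (~` `[0, 1]%classic) = 0%E.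
Proof.
pose f (x : R) := Num.min 1 (Num.max (Num.max (- x) (x - 1)) 0).
have cf : continuous f.
  move=> x; apply: (@continuous_min _ _ (fun=> 1) _ x); first exact: cvg_cst.
  apply: (@continuous_max _ _ _ (fun=> 0) x); last exact: cvg_cst.
  by apply: continuous_max; [exact: cvgN|apply: cvgB; [exact: cvg_id|exact: cvg_cst]].
have f0 x : 0 <= f x by rewrite le_min ler01 le_max lexx orbT.
have f1 x : f x <= 1 by rewrite ge_min lexx.
have bf : bmeas f.
  split; first exact: continuous_measurable_fun.
  by exists 1 => x; rewrite ger0_norm.
have h := cvg_cascade_sum cf bf f0.
have z0 (u : word) : \int[nu]_t (\1_(wcell u) t * f t) = 0.
  transitivity (\int[nu]_t (0 : R)); last by rewrite Rint_cst mul0r.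
  apply: eq_Rintegral => t _; rewrite indic_wcell.
  have [u0 u1] := @wcell_sub R b b2 u.
  case: (boolP (_ && _)) => [/andP[t0 t1]|]; last by rewrite mul0r.
  rewrite mul1r /f max_r ?minr_r//; last first.
    by rewrite ge_max; apply/andP; split; lra.
  by rewrite min_r.
have I0 : \int[mu]_x f x = 0.
  apply: (cvg_unique _ h) => //=.
  rewrite (_ : cascade_sum _ ^~ w = (fun=> 0 : R)); first exact: cvg_cst.
  by apply/funext => n; rewrite /cascade_sum big1// => u _; rewrite z0 mulr0.
have IE0 : (\int[mu]_x (f x)%:E = 0)%E.
  rewrite -(fineK (integrable_fin_num measurableT (bmeas_integrable mufin bf))).
  by rewrite [fine _]I0.
have mf : measurable_fun setT (EFin \o f : measurableTypeR R -> \bar R).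
  by apply/measurable_EFinP; exact: bf.1.
have /(ae_eq_integral_abs mu measurableT mf) fae : (\int[mu]_x `|(EFin \o f) x| = 0)%E.
  by rewrite -[RHS]IE0; apply: eq_integral => x _; rewrite gee0_abs// lee_fin.
apply: measure_negligible; first by apply: measurableC; exact: measurable_itv.
apply: negligibleS fae => x /= x01 /(_ I)[fx]; apply: x01; rewrite in_itv /=.
have [m1|m1] := leP (Num.max (Num.max (- x) (x - 1)) 0) 1.
  move: fx; rewrite /f min_r// => m0.
  have : Num.max (Num.max (- x) (x - 1)) 0 <= 0 by rewrite m0.
  by rewrite !ge_max lexx andbT => /andP[? ?]; apply/andP; split; lra.
by move: fx; rewrite /f min_l ?(ltW m1)// => /eqP; rewrite oner_eq0.
Qed.

End weak_limits.

(** * Consequences of Fatou's lemma *)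

Section fatou_consequences.
Context {R : realType} {d : measure_display} {T : measurableType d} (P : probability T R).

Lemma integral_limn_einf_le (f : nat -> T -> R) (B : R) :
  (forall n, measurable_fun setT (f n)) -> (forall n w, 0 <= f n w) ->
  (forall n, (\int[P]_w (f n w)%:E <= B%:E)%E) ->
  (\int[P]_w limn_einf (fun n => (f n w)%:E) <= B%:E)%E.
Proof.
move=> mf f0 fB.
apply: (le_trans (fatou P measurableT (f := fun n w => (f n w)%:E) _ _)).
- by move=> n; exact/measurable_EFinP.
- by move=> n w _; rewrite lee_fin.
have <- : limn_einf (fun=> B%:E) = B%:E by exact: (cvg_limn_einf_sup (cvg_cst _)).1.
exact: le_limn_einf.
Qed.

Lemma measurable_limn_einf (f : nat -> T -> R) : (forall n, measurable_fun setT (f n)) ->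
  measurable_fun setT (fun w => limn_einf (fun n => (f n w)%:E)).
Proof.
move=> mf; rewrite (_ : (fun w => _) =
    (fun w => - limn_esup (fun n => (- f n w)%:E))%E); last first.
  by apply/funext => w; rewrite (limn_esupN (fun n => (f n w)%:E)) oppeK.
apply: measurableT_comp => //; apply: measurable_fun_limn_esup => n.
by apply/measurable_EFinP; exact: measurable_funN.
Qed.

(** By Fatou the lower limit is integrable, hence finite almost everywhere, and infinitely many
    terms lie below it plus 1. *)
Lemma ae_frequently_bounded (f : nat -> T -> R) (B : R) :
  (forall n, measurable_fun setT (f n)) -> (forall n w, 0 <= f n w) ->
  (forall n, (\int[P]_w (f n w)%:E <= B%:E)%E) ->
  {ae P, forall w, exists M : R, forall N, exists2 n, (N <= n)%N & f n w <= M}.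
Proof.
move=> mf f0 fB; have mL := measurable_limn_einf mf.
have L0 w : (0 <= limn_einf (fun n => (f n w)%:E))%E.
  have {1}<- : limn_einf (fun=> 0%E : \bar R) = 0%E.
    exact: (cvg_limn_einf_sup (cvg_cst _)).1.
  by apply: le_limn_einf => n; rewrite lee_fin.
have iL : P.-integrable setT (fun w => limn_einf (fun n => (f n w)%:E)).
  apply/integrableP; split => //.
  under eq_integral do rewrite gee0_abs//.
  by apply: le_lt_trans (integral_limn_einf_le mf f0 fB) _; rewrite ltry.
apply: filterS (integrable_ae measurableT iL) => w /(_ I) fw.
exists (fine (limn_einf (fun n => (f n w)%:E)) + 1) => N.
set l := limn_einf _ in fw *.
have lt1 : (l < (fine l + 1)%:E)%E by rewrite -[ltLHS](fineK fw) lte_fin ltrDl.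
have : (einfs (fun n => (f n w)%:E) N < (fine l + 1)%:E)%E.
  by apply: le_lt_trans lt1; rewrite /l limn_einf_sup_einfs; apply: ereal_sup_ubound; exists N.
move=> /ereal_inf_lt[_ [n /= Nn <-]]; rewrite lte_fin => /ltW h.
by exists n.
Qed.

(** The constant is 1 plus the value of x - 1 from which e (x - 1)^(p-1) is at least 1. *)
Lemma le_powR_affine (p e x : R) : 1 < p -> 0 < e -> 0 <= x ->
  x <= e * `|x - 1| `^ p + (1 + e^-1 `^ (p - 1)^-1).
Proof.
move=> p1 e0 x0; have p10 : 0 < p - 1 by lra.
have ep0 : 0 <= e * `|x - 1| `^ p by rewrite mulr_ge0 ?powR_ge0// ltW.
set C := e^-1 `^ _; have C0 : 0 <= C by exact: powR_ge0.
have [xC|xC] := leP (x - 1) C; first by lra.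
have y0 : 0 < x - 1 by lra.
rewrite ger0_norm; last lra.
suff : x - 1 <= e * (x - 1) `^ p by lra.
rewrite -[p](subrK 1) powRD; last by rewrite (gt_eqF y0) implybT.
rewrite powRr1 ?(ltW y0)// mulrA ler_peMl ?(ltW y0)//.
rewrite mulrC -ler_pdivrMr// div1r.
have eV0 : 0 <= e^-1 by rewrite invr_ge0 ltW.
have -> : e^-1 = C `^ (p - 1) by rewrite /C -powRrM mulVf ?gt_eqF// powRr1.
by rewrite ge0_ler_powR ?nnegrE// ltW.
Qed.

(* Bounded in [L^p] with [p > 1], the sequence is uniformly integrable; here
   this is made quantitative by applying Fatou to [e |f n - 1|^p + C - f n]. *)
Lemma mean1_not_cvg0 (f : nat -> T -> R) (p B : R) : 1 < p -> 0 <= B ->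
  (forall n, measurable_fun setT (f n)) -> (forall n w, 0 <= f n w) ->
  (forall n, (\int[P]_w (f n w)%:E = 1)%E) ->
  (forall n, (\int[P]_w (`|f n w - 1| `^ p)%:E <= B%:E)%E) ->
  ~ {ae P, forall w, f n w @[n --> \oo] --> (0 : R)}.
Proof.
move=> p1 B0 mf f0 f1 fB f_cvg.
(* This makes e B < 1. Convergence to 0 would give C <= e B + C - 1 by Fatou, a contradiction. *)
pose e := (B + 1)^-1; have e0 : 0 < e by rewrite invr_gt0; lra.
pose C := 1 + e^-1 `^ (p - 1)^-1; have C0 : 0 <= C by rewrite addr_ge0 ?powR_ge0.
pose g n w := `|f n w - 1| `^ p.
have mg n : measurable_fun setT (g n).
  apply: (measurableT_comp (measurable_powR _)).
  by apply: measurableT_comp => //; exact: measurable_funB.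
have g0 n w : 0 <= g n w by exact: powR_ge0.
pose h n w := e * g n w + C - f n w.
have h0 n w : 0 <= h n w by rewrite subr_ge0; exact: le_powR_affine.
have meg n : measurable_fun setT (fun w => e * g n w) by exact: measurable_funM.
have megC n : measurable_fun setT (fun w => e * g n w + C) by exact: measurable_funD.
have mh n : measurable_fun setT (h n) by exact: measurable_funB.
have eg0 n w : 0 <= e * g n w by rewrite mulr_ge0 ?(ltW e0).
have hB n : (\int[P]_w (h n w)%:E <= (e * B + C - 1)%:E)%E.
  have : (\int[P]_w (h n w)%:E + 1%:E = e%:E * \int[P]_w (g n w)%:E + C%:E)%E.
    rewrite -[in LHS](f1 n) -(ge0_integralD_EFin P (mh n) (mf n) (h0 n) (f0 n)).
    under eq_integral do rewrite subrK.
    rewrite (ge0_integralD_EFin P (meg n) (measurable_cst _) (eg0 n))//.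
    by rewrite (ge0_integralMl_EFin P (mg n) (g0 n) (ltW e0)) integral_cst_prob.
  move=> E; rewrite EFinB leeBrDr// E (EFinD (e * B)) leeD2r// EFinM lee_pmul2l ?lte_fin//.
  exact: fB.
have := integral_limn_einf_le mh h0 hB.
have : (C%:E <= \int[P]_w limn_einf (fun n => (h n w)%:E))%E.
  rewrite -[leLHS](integral_cst_prob P); apply: ae_ge0_le_integral => //.
  - move=> w _; have {1}<- : limn_einf (fun=> 0%E : \bar R) = 0%E.
      exact: (cvg_limn_einf_sup (cvg_cst _)).1.
    by apply: le_limn_einf => n; rewrite lee_fin.
  - exact: measurable_limn_einf.
  apply: filterS f_cvg => w fw _.
  have <- : limn_einf (fun n => (C - f n w)%:E) = C%:E.
    apply: (cvg_limn_einf_sup _).1; apply/cvg_EFin; first exact: nearW.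
    by rewrite -[X in _ --> X]subr0; apply: cvgB => //; exact: cvg_cst.
  by apply: le_limn_einf => n; rewrite lee_fin /h lerD2r lerDr.
move=> /le_trans h1 /h1; rewrite lee_fin.
have : e * (B + 1) = 1 by rewrite mulVf// gt_eqF//; lra.
by lra.
Qed.

End fatou_consequences.

Section identical_distribution.
Context {R : realType} {d0 d : measure_display} {T0 : measurableType d0} {T : measurableType d}
  {P0 : probability T0 R} {P : probability T R} (X0 : {RV P0 >-> R}) (X : {RV P >-> R}).
Hypothesis eqd : forall A : set (measurableTypeR R), measurable A ->
  distribution P X A = distribution P0 X0 A.

Lemma integral_same_distribution (f : R -> \bar R) :
  measurable_fun setT f -> (forall x, (0 <= f x)%E) ->
  (\int[P]_w f (X w) = \int[P0]_w f (X0 w))%E.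
Proof.
move=> mf f0.
rewrite -(ge0_integral_distribution X mf f0) -(ge0_integral_distribution X0 mf f0).
by apply: eq_measure_integral => A mA _; exact: eqd.
Qed.

Lemma ae_ge0_same_distribution :
  {ae P0, forall w, 0 <= X0 w} -> {ae P, forall w, 0 <= X w}.
Proof.
move=> h0; have mN : measurable (`]-oo, 0[%classic : set (measurableTypeR R)).
  exact: measurable_itv.
have mX0 : measurable (X0 @^-1` `]-oo, 0[%classic).
  by rewrite -[X in measurable X]setTI; exact: measurable_funPT.
have X00 : P0 (X0 @^-1` `]-oo, 0[%classic) = 0%E.
  apply: measure_negligible => //.
  by apply: negligibleS h0 => w /=; rewrite in_itv /= => w0; rewrite leNgt w0.
have XN : P (X @^-1` `]-oo, 0[%classic) = 0%E by rewrite -X00; exact: eqd mN.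
exists (X @^-1` `]-oo, 0[%classic); split => //.
  by rewrite -[X in measurable X]setTI; exact: measurable_funPT.
by move=> w /=; rewrite in_itv /= ltNge => /negP.
Qed.

End identical_distribution.

(** * Non-degeneracy and Fourier decay of the limit *)

Section random_cascade.
Context {R : realType} {d : measure_display} {T : measurableType d}
  {P : probability T R} {b : nat} {W : seq 'I_b -> {RV P >-> R}}.
Local Notation word := (seq 'I_b).

Lemma measurable_cascade_sum (a : word -> R) n :
  measurable_fun setT (cascade_sum (W:=W) a n).
Proof.
apply: measurable_sum => u; apply: measurable_funM => //.
by apply: measurable_prod => j _; exact: measurable_posw.
Qed.

Lemma cascade_sum_ge0 (a : word -> R) n w : (forall u, 0 <= a u) -> 0 <= cascade_sum (W:=W) a n w.
Proof. by move=> a0; apply: sumr_ge0 => u _; rewrite mulr_ge0// wprod_ge0. Qed.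

Hypothesis b2 : (2 <= b)%N.
Hypothesis indW : mutually_independent [set u | u != [::]] W.
Hypothesis mean1 : forall u, u != [::] -> (\int[P]_w (posw (W:=W) u w)%:E = 1)%E.

Lemma integral_cascade_sum (a : word -> R) n : (forall u, 0 <= a u) ->
  (\int[P]_w (cascade_sum (W:=W) a n w)%:E = (\sum_(u <- words n) a u)%:E)%E.
Proof.
move=> a0; have mw (u : word) : measurable_fun setT (wprod (W:=W) n u).
  by apply: measurable_prod => j _; exact: measurable_posw.
under eq_integral do rewrite -sumEFin.
rewrite ge0_integral_sum//; last 2 first.
- by move=> u; apply/measurable_EFinP; apply: measurable_funM.
- by move=> u w _; rewrite lee_fin mulr_ge0// wprod_ge0.
rewrite -sumEFin !big_seq; apply: eq_bigr => u; rewrite mem_words => /eqP un.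
under eq_integral do rewrite mulrC.
rewrite (ge0_integralMl_EFin P (mw u) (fun w => wprod_ge0 n u w) (a0 u)).
have nu' : (n <= size u)%N by rewrite un.
rewrite (integral_wprod indW (g := id) (c := 1) mean1 _ _ nu') ?expr1n ?mule1//.
Qed.

Variables (nu : probability (measurableTypeR R) R) (Q : R.-ker T ~> measurableTypeR R).
Hypotheses (W1 : forall w, W [::] w = 1) (W0 : forall u, {ae P, forall w, 0 <= W u w}).
Hypothesis hQ : cascade_limit W nu Q.

(** Words are countable, so the exceptional events of all weights are discarded together by
    enumerating words through [pickle]. *)
Lemma ae_ge0_weak_cvg : {ae P, forall w, (forall u, 0 <= W u w) /\
  weak_cvg (fun n => cascade (fun u => W u : T -> R) nu n w) (Q w)}.
Proof.
have W0' : {ae P, forall w, forall n, forall u, unpickle n = Some u -> 0 <= W u w}.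
  apply: ae_foralln => n; case: (unpickle n) => [u|]; last exact: nearW.
  by apply: filterS (W0 u) => w Wu v [<-].
apply: filterS2 W0' hQ => w Ww Qw; split=> // u.
by apply: (Ww (pickle u)); rewrite pickleK.
Qed.

Variables (p m beta K Kc eta : R).
Hypotheses (p12 : 1 < p <= 2).
Hypothesis momp : forall u, u != [::] -> (\int[P]_w (posw (W:=W) u w `^ p)%:E = m%:E)%E.
Hypotheses (m0 : 0 <= m) (beta0 : 0 < beta) (mb : m * beta < 1) (K0 : 0 <= K).
Hypothesis fsum : forall n, \sum_(u <- words n : seq word) wmass nu u `^ p <= K * beta ^+ n.
Hypothesis mass1 : forall n, \sum_(u <- words n : seq word) wmass nu u = 1.
Hypotheses (Kc0 : 0 <= Kc) (eta0 : 0 < eta).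
Hypothesis dec : forall (u : word) z al, 1 <= `|z| ->
  `|cellint nu z al u| <= Kc * `|z| `^ (- eta).

Let mass_nil : wmass nu ([::] : word) = 1.
Proof. by have := mass1 0; rewrite big_seq1. Qed.

(** Were the limit almost surely zero, the total masses of Q_n nu would tend to 0 almost surely,
    although they have mean 1 and deviations from it bounded in L^p. *)
Lemma cascade_nondegenerate : (0 < P [set w | Q w setT != 0])%E.
Proof.
have [p1 _] := andP p12.
have mS : measurable [set w | Q w setT != 0%E].
  rewrite (_ : [set w | _] = ~` ((fun w => Q w setT) @^-1` [set 0%E])); last first.
    by apply/seteqP; split => w /=; [move=> /eqP|move=> h; apply/eqP].
  apply: measurableC; rewrite -[X in measurable X]setTI.
  by apply: (measurable_kernel Q setT measurableT).
rewrite lt0e measure_ge0 andbT; apply/negP => /eqP PS0.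
have [B B0 hB] := cascade_mass_bound b2 indW p12 mean1 momp m0 beta0 mb K0 fsum mass_nil.
apply: (mean1_not_cvg0 p1 B0 (measurable_cascade_sum (wmass nu)) _ _ hB).
- by move=> n w; apply: cascade_sum_ge0 => u; exact: wmass_ge0.
- by move=> n; rewrite integral_cascade_sum ?mass1// => u; exact: wmass_ge0.
have Q0 : {ae P, forall w, Q w setT = 0%E}.
  exists [set w | Q w setT != 0%E]; split => //.
  by move=> w /= h; apply/eqP.
apply: filterS2 Q0 ae_ge0_weak_cvg => w Qw [Ww Qc].
by have := cvg_cascade_mass (W1 w) Ww Qc; rewrite Qw.
Qed.

(** One term of the weighted sum is at most the whole. For the weight j + 1, the square of [freq j],
    this is decay of order -2/q in the frequency. *)
Lemma wnorm_coord_le (J : finType) (wt : J -> R) (k : nat) (x : J -> R) (M : R) i :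
  (forall i, 0 < wt i) -> ~~ odd k -> wnorm wt k p x <= M ->
  `|x i| <= (M `^ (k.+2%:R / p)) `^ (k.+2%:R)^-1 * wt i `^ (- (k.+2%:R)^-1).
Proof.
move=> wt0 ek xM; have [p1 _] := andP p12; have p0 : 0 < p by lra.
have wt0' j : 0 <= wt j by exact: ltW.
have q0 : 0 < k.+2%:R :> R by rewrite ltr0n.
have ek2 : ~~ odd k.+2 by rewrite /= negbK.
have s0 := wsum_ge0 wt0' ek x.
have sM : wsum wt k x <= M `^ (k.+2%:R / p).
  have -> : wsum wt k x = wnorm wt k p x `^ (k.+2%:R / p).
    rewrite /wnorm -powRrM (_ : p / _ * _ = 1) ?powRr1//.
    by field; rewrite !gt_eqF.
  have N0 : 0 <= wnorm wt k p x by exact: powR_ge0.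
  by rewrite ge0_ler_powR ?nnegrE ?divr_ge0 ?(ltW p0) ?(ltW q0) ?(le_trans N0).
have xi : wt i * `|x i| ^+ k.+2 <= M `^ (k.+2%:R / p).
  apply: le_trans sM; rewrite -exprn_even_norm// /wsum (bigD1 i)//= lerDl.
  by apply: sumr_ge0 => j _; rewrite mulr_ge0// exprn_even_ge0.
have -> : `|x i| = (`|x i| ^+ k.+2) `^ (k.+2%:R)^-1.
  by rewrite -(powR_mulrn k.+2 (normr_ge0 _)) -powRrM divff ?gt_eqF// powRr1.
have -> : wt i `^ (- (k.+2%:R)^-1) = (wt i)^-1 `^ (k.+2%:R)^-1.
  by rewrite -(powR_inv1 (wt0' i)) -powRrM mulN1r.
have wV0 : 0 <= (wt i)^-1 by rewrite invr_ge0.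
rewrite -(powRM _ (powR_ge0 _ _) wV0).
rewrite ge0_ler_powR ?nnegrE ?invr_ge0 ?(ltW q0) ?exprn_ge0 ?mulr_ge0 ?powR_ge0//.
by rewrite ler_pdivlMr// mulrC.
Qed.

(** The moment bound concerns the deviation from the transform of [nu]; that transform is added back
    at the end, with its own decay. *)
Lemma ae_fourier_dim_gt0 : {ae P, forall w, 0 < fourier_dim (Q w)}.
Proof.
have [k [ek [B B0 hB]]] :=
  cascade_freq_bound b2 indW p12 mean1 momp m0 beta0 mb K0 fsum Kc0 eta0 dec.
pose a j c := cellint nu (freq j) (phase c) ([::] : word).
pose X n (i : 'I_n * bool) w :=
  cascade_sum (W:=W) (cellint nu (freq i.1) (phase i.2)) n w - a i.1 i.2.
(* Diagonal choice: n frequencies at level n. A fixed frequency is eventually included, and a bound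
   along infinitely many n survives in the limit because each coordinate converges. *)
pose F n w := wnorm (fun i : 'I_n * bool => i.1.+1%:R) k p (fun i => X n i w).
have mF n : measurable_fun setT (F n).
  apply: measurable_wnorm => i; apply: measurable_funB => //.
  exact: measurable_cascade_sum.
apply: filterS2 (ae_frequently_bounded mF (fun n w => powR_ge0 _ _) (fun n => hB n n)) ae_ge0_weak_cvg.
move=> w [M FM] [Ww Qc].
have Qfin := Qc.1.
have q0 : 0 < k.+2%:R :> R by rewrite ltr0n.
pose L := (M `^ (k.+2%:R / p)) `^ (k.+2%:R)^-1; have L0 : 0 <= L by exact: powR_ge0.
have close j c : `|cosint (Q w) (freq j) (phase c) - a j c| <=
    L * freq j `^ (- (2 / k.+2%:R)).
  rewrite (_ : freq j `^ _ = j.+1%:R `^ (- (k.+2%:R)^-1)); last first.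
    by rewrite /freq -powRrM; congr (_ `^ _); field; rewrite gt_eqF.
  rewrite leNgt; apply/negP => lt.
  have cv : (cascade_sum (W:=W) (cellint nu (freq j) (phase c)) n w - a j c) @[n --> \oo] -->
      cosint (Q w) (freq j) (phase c) - a j c.
    by apply: cvgB; [exact: cvg_cascade_cos|exact: cvg_cst].
  have [N _ hN] := cvgr_norm_gt _ cv _ lt.
  have [n nN nM] := FM (maxn N j.+1).
  have jn : (j < n)%N by apply: leq_trans nN; exact: leq_maxr.
  have := hN n (leq_trans (leq_maxl _ _) nN); rewrite ltNge => /negP; apply.
  exact: (@wnorm_coord_le _ (fun i : 'I_n * bool => i.1.+1%:R) k (fun i => X n i w) M
    (Ordinal jn, c) (fun i => ltr0Sn _ _) ek nM).
(* The three constraints come from the gaps between frequencies, the decay of [nu], and the decay of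
   the deviation. *)
pose et := Num.min 1 (Num.min eta (2 / k.+2%:R)).
have et0 : 0 < et by rewrite !lt_min ltr01 eta0 divr_gt0.
have [e1 e2 e3] : [/\ et <= 1, et <= eta & et <= 2 / k.+2%:R].
  by rewrite /et !ge_min !lexx !orbT.
apply: (@fourier_dim_gt0_freq _ (Q w) Qfin (weak_limit_carried b2 (W1 w) Ww Qc)
  (Kc + L) et (addr_ge0 Kc0 L0)).
  by rewrite et0.
move=> j c; have f1 := freq_ge1 (R:=R) j; have f0 : 0 < freq j :> R by lra.
have mono e : et <= e -> (freq j : R) `^ (- e) <= freq j `^ (- et).
  by move=> ee; rewrite ler_powR// lerN2.
have := ler_normD (cosint (Q w) (freq j) (phase c) - a j c) (a j c).
rewrite subrK => /le_trans; apply; rewrite mulrDl addrC; apply: lerD.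
  have := dec [::] (phase c) (z := freq j); rewrite (ger0_norm (ltW f0)) => /(_ f1) h.
  by apply: (le_trans h); exact: (ler_wpM2l Kc0 (mono _ e2)).
by apply: (le_trans (close j c)); exact: (ler_wpM2l L0 (mono _ e3)).
Qed.

End random_cascade.

Theorem theorem11p1 (R : realType) (b : nat) (hb : (2 <= b)%N)
    (d0 : measure_display) (Omega0 : measurableType d0)
    (P0 : probability Omega0 R) (W0 : {RV P0 >-> R})
    (hW0 : random_weight W0)
    (d : measure_display) (Omega : measurableType d) (P : probability Omega R)
    (W : seq 'I_b -> {RV P >-> R}) (hW : iid_weights W0 W)
    (nu : probability (measurableTypeR R) R)
    (hnu : nu `[0, 1]%classic = 1%E)
    (hnuF : 0 < fourier_dim nu)
    (delta : R) (hdelta : 0 < delta)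
    (hmom : ('E_P0[(fun x => W0 x `^ (1 + delta))%R] < +oo)%E)
    (hent : ('E_P0[(fun x => W0 x * ln (W0 x))%R] * ((ln b%:R)^-1)%:E
             < lim (Lp_dim b nu p @[p --> (1 : R)^'+]))%E)
    (Q : R.-ker Omega ~> measurableTypeR R) (hQ : cascade_limit W nu Q) :
  (0 < P [set w | Q w setT != 0])%E /\
  {ae P, forall w, Q w setT != 0%E -> 0 < fourier_dim (Q w)}.
Proof.
have [W1 Wdist indW] := hW.
have [C [s [C0 s01 decay]]] := cosint_decay_of_fourier_dim hnuF.
have mass1 n := sum_wmass hb C0 s01 hnu decay n.
have [Kc Kc0 [eta eta0 dec]] := cellint_decay hb C0 s01 hnu decay.
have cellE n (u : n.-tuple 'I_b) : cell_mass nu u = wmass nu (val u).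
  by rewrite /cell_mass bitvE.
have mass1' n : \sum_(u : n.-tuple 'I_b) cell_mass nu u = 1.
  rewrite -(mass1 n) -(big_words_tuple (wmass nu)).
  by apply: eq_bigr => u _; exact: cellE.
have [p [m [beta [K [p12 mE beta0 mb [K0 hsum]]]]]] :=
  supercritical_exponent hb hW0 hdelta hmom mass1' hent.
have fsum n : \sum_(u <- words n : seq (seq 'I_b)) wmass nu u `^ p <= K * beta ^+ n.
  rewrite -(big_words_tuple (fun u => wmass nu u `^ p)).
  by apply: le_trans (hsum n); apply: ler_sum => u _; rewrite cellE.
(* Means and moments of each weight are transferred from [W0] through the common law of the positive
   parts. *)
have meang (g : R -> R) u : u != [::] -> measurable_fun setT g -> (forall x, 0 <= x -> 0 <= g x) ->
    (\int[P]_w (g (posw (W:=W) u w))%:E = \int[P0]_w (g (Num.max (W0 w) 0))%:E)%E.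
  move=> un mg g0.
  apply: (integral_same_distribution (Wdist u un) (f := fun x => (g (Num.max x 0))%:E)).
    by apply/measurable_EFinP; exact: (measurableT_comp mg measurable_max0).
  by move=> x; rewrite lee_fin g0// le_max lexx orbT.
have mean1 u : u != [::] -> (\int[P]_w (posw (W:=W) u w)%:E = 1)%E.
  by move=> un; rewrite (meang id)//; exact: integral_pos_weight.
have momp u : u != [::] -> (\int[P]_w (posw (W:=W) u w `^ p)%:E = m%:E)%E.
  move=> un; rewrite (meang (fun x => x `^ p))//.
  by move=> x _; exact: powR_ge0.
have m0 : 0 <= m.
  by rewrite -lee_fin -mE; apply: integral_ge0 => w _; rewrite lee_fin powR_ge0.
have Wge0 u : {ae P, forall w, 0 <= W u w}.
  have [->|un] := eqVneq u [::]; first by apply: nearW => w; rewrite W1.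
  apply: (ae_ge0_same_distribution (Wdist u un)).
  by have [] := hW0.
split.
  apply: (cascade_nondegenerate hb indW mean1 W1 Wge0 hQ p12 momp m0 beta0 mb K0 fsum mass1).
have := ae_fourier_dim_gt0 hb indW mean1 W1 Wge0 hQ p12 momp m0 beta0 mb K0 fsum Kc0 eta0 dec.
by apply: filterS => w h _.
Qed.
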